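(* Let $V\subset L^2(\mathbb{R}^{2n})$ be a twisted shift-invariant subspace, $J$ its associated range function, and $U:V\to L^2(\mathbb{R}^{2n})$ a twisted shift preserving operator with corresponding range operator $R$. Let $c>0$. Then $U$ is bounded below with constant $c$ (that is, $\|Uf\|\ge c\|f\|$ for all $f\in V$) if and only if $R(\xi,\xi')$ is bounded below with constant $c$ (that is, $\|R(\xi,\xi')a\|\ge c\|a\|$ for all $a\in J(\xi,\xi')$) for a.e. $\xi,\xi'\in\mathbb{T}^n$.
   Context: Fix $n\ge 1$; $\mathbb{T}^n$ is identified with $[0,1)^n$ with Lebesgue measure. For $\phi\in L^2(\mathbb{R}^{2n})$ and $k,l\in\mathbb{Z}^n$ the twisted translation is $T^t_{(k,l)}\phi(x,y)=e^{\pi i(x\cdot l-y\cdot k)}\phi(x-k,y-l)$. A closed subspace $V\subset L^2(\mathbb{R}^{2n})$ is twisted shift-invariant if $f\in V$ implies $T^t_{(k,l)}f\in V$ for all $k,l\in\mathbb{Z}^n$. A bounded linear operator $U:V\to L^2(\mathbb{R}^{2n})$ is twisted shift preserving if $UT^t_{(k,l)}f=T^t_{(k,l)}Uf$ for all $f\in V$, $k,l\in\mathbb{Z}^n$. The kernel of the Weyl transform of $\phi$ is $K_\phi(\xi,\eta)=\int_{\mathbb{R}^n}\phi(x,\eta-\xi)e^{\pi i x\cdot(\xi+\eta)}\,dx$ (extended from $L^1\cap L^2$ to $L^2(\mathbb{R}^{2n})$ by density), and the Weyl–Zak transform is $Z_W\phi(\xi,\xi',\eta)=\sum_{m\in\mathbb{Z}^n}K_\phi(m+\xi,\eta)e^{-2\pi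 i m\cdot\xi'}$, $\xi,\xi'\in\mathbb{T}^n$, $\eta\in\mathbb{R}^n$. The map $\mathcal{J}:L^2(\mathbb{R}^{2n})\to L^2(\mathbb{T}^n\times\mathbb{T}^n,L^2(\mathbb{R}^n))$, $\mathcal{J}f(\xi,\xi')(\eta)=Z_Wf(\xi,\xi',\eta)$, is an isometric isomorphism (onto). The range function associated with $V$ is $J(\xi,\xi')=\overline{\operatorname{span}}\{\mathcal{J}f(\xi,\xi'): f\in V\}\subset L^2(\mathbb{R}^n)$, understood up to null sets: (fixing representatives) take $f$ in a countable dense subset of $V$; $J$ is then the a.e.-unique measurable range function with $\mathcal{J}(V)=\{\Phi\in L^2(\mathbb{T}^n\times\mathbb{T}^n,L^2(\mathbb{R}^n)):\Phi(\xi,\xi')\in J(\xi,\xi')\text{ a.e.}\}$. $P(\xi,\xi')$ denotes the orthogonal projection of $L^2(\mathbb{R}^n)$ onto $J(\xi,\xi')$; $J$ is measurable if $(\xi,\xi')\mapsto\langle P(\xi,\xi')a,b\rangle$ is measurable for all $a,b\in L^2(\mathbb{R}^n)$. A range operator on $J$ is a map $R$ from $\mathbb{T}^n\times\mathbb{T}^n$ to the bounded linear operators from closed subspaces of $L^2(\mathbb{R}^n)$ into $L^2(\mathbb{R}^n)$ such that the domain of $R(\xi,\xi')$ is $J(\xi,\xi')$ for a.e. $\xi,\xi'$; it is measurable if $(\xi,\xi')\mapsto\langle R(\xi,\xi')P(\xi,\xi')a,b\rangle$ is measurable for all $a,b\in L^2(\mathbb{R}^n)$. The range operator corresponding to a twisted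 shift preserving $U:V\to L^2(\mathbb{R}^{2n})$ is the (a.e. unique) measurable range operator $R$ on $J$ with $\mathcal{J}(Uf)(\xi,\xi')=R(\xi,\xi')(\mathcal{J}f(\xi,\xi'))$ for a.e. $\xi,\xi'\in\mathbb{T}^n$, for every $f\in V$. *)

(* Defs.v *)
From HB Require Import structures.
From mathcomp Require Import all_boot all_order all_algebra finmap.
From mathcomp Require Import complex.
From mathcomp Require Import all_classical all_reals all_analysis.

Set Implicit Arguments.
Unset Strict Implicit.
Unset Printing Implicit Defensive.
Import Order.TTheory GRing.Theory Num.Theory.
Import numFieldNormedType.Exports.

Local Open Scope classical_set_scope.
Local Open Scope ring_scope.

(* [m1 \x m2] under a name of its own: inference of a sigma-finite structure on
   [m1 \x m2] itself fails, as the instance for products of probability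
   measures is keyed on the same constant. *)
Section sigma_finite_product.
Context d1 d2 (T1 : measurableType d1) (T2 : measurableType d2) {R : realType}.
Context (m1 : {sigma_finite_measure set T1 -> \bar R}).
Context (m2 : {sigma_finite_measure set T2 -> \bar R}).

Definition prodm : set (T1 * T2) -> \bar R := (m1 \x m2)%E.

HB.instance Definition _ := Measure.on prodm.

Let prodm_sigma_finite : sigma_finite setT prodm.
Proof.
have /sigma_finiteP[F [TF ndF Foo]] := sigma_finiteT m1.
have /sigma_finiteP[G [TG ndG Goo]] := sigma_finiteT m2.
exists (fun n => F n `*` G n).
 rewrite -setXTT TF TG predeqE => -[x y]; split.
    move=> [/= [n _ Fnx] [k _ Gky]]; exists (maxn n k) => //; split.
    - by move: x Fnx; exact/subsetPset/ndF/leq_maxl.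
    - by move: y Gky; exact/subsetPset/ndG/leq_maxr.
  by move=> [n _ []/= ? ?]; split; exists n.
move=> k; have [? ?] := Foo k; have [? ?] := Goo k.
split; first exact: measurableX.
by rewrite /prodm product_measure1E// lte_mul_pinfty// ge0_fin_numE.
Qed.

HB.instance Definition _ := Measure_isSigmaFinite.Build _ _ _ prodm
  prodm_sigma_finite.

End sigma_finite_product.

(* R^n is [n.-tuple R], with the product Borel sigma-algebra of
   MathComp-Analysis; Z^n is [n.-tuple int]. *)

Section lebesgue_measure_Rn.
Context {R : realType}.

Definition cons_pair n (z : R * n.-tuple R) : n.+1.-tuple R :=
  [tuple of z.1 :: z.2].

Lemma measurable_cons_pair n : measurable_fun [set: R * n.-tuple R] (@cons_pair n).
Proof. exact: measurable_cons. Qed.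

Section cons_measure.
Context n (mu : {sigma_finite_measure set (n.-tuple R) -> \bar R}).

Definition cons_measure : set (n.+1.-tuple R) -> \bar R :=
  pushforward (prodm lebesgue_measure mu) (@cons_pair n).

Let cons_measure0 : cons_measure set0 = 0%E.
Proof. by rewrite /cons_measure /pushforward preimage_set0 measure0. Qed.

Let cons_measure_ge0 A : (0 <= cons_measure A)%E.
Proof. by rewrite /cons_measure /pushforward; exact: measure_ge0. Qed.

Let cons_measure_sigma_additive : semi_sigma_additive cons_measure.
Proof.
exact: (@measure_semi_sigma_additive _ _ _
  (measure_function_pushforward__canonical__measure_function_Measure
    (prodm lebesgue_measure mu) (@measurable_cons_pair n))).
Qed.

HB.instance Definition _ := isMeasure.Build _ _ _ cons_measure
  cons_measure0 cons_measure_ge0 cons_measure_sigma_additive.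

Let cons_measure_sigma_finite : sigma_finite setT cons_measure.
Proof.
have [F FT Foo] := sigma_finiteT (prodm lebesgue_measure mu).
pose g (t : n.+1.-tuple R) : R * n.-tuple R := (thead t, [tuple of behead t]).
have mg : measurable_fun setT g.
  apply/measurable_fun_pair; first exact: measurable_tnth.
  exact: measurable_behead.
have gK z : g (cons_pair z) = z.
  by case: z => x t; rewrite /g /cons_pair theadE; congr pair; exact: val_inj.
exists (fun i => g @^-1` F i) => [|i].
  by rewrite -preimage_bigcup -FT preimage_setT.
have [mF Fi] := Foo i; split; first by rewrite -[X in measurable X]setTI; exact: mg.
rewrite /cons_measure /pushforward -comp_preimage (_ : g \o _ = id)//.
exact/funext.
Qed.

HB.instance Definition _ := Measure_isSigmaFinite.Build _ _ _ cons_measure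
  cons_measure_sigma_finite.

End cons_measure.

Fixpoint leb n : {sigma_finite_measure set (n.-tuple R) -> \bar R} :=
  match n with
  | 0 => dirac [tuple]
  | m.+1 => cons_measure (leb m)
  end.

(* The torus T^n is [0,1)^n: a measure carried by the unit cube, so that "a.e."
   with respect to [torus n] ignores everything outside of the cube. *)
Definition cube n : set (n.-tuple R) := [set x | forall i, 0 <= tnth x i < 1].

Lemma measurable_cube n : measurable (@cube n).
Proof.
rewrite (_ : @cube n = \bigcap_(i in [set: 'I_n]) ((@tnth n R)^~ i @^-1` `[0, 1[)).
  apply: fin_bigcap_measurable => // i _.
  by rewrite -[X in measurable X]setTI; exact: measurable_tnth.
apply/seteqP; split => x /= h i; first by move=> _; rewrite /= in_itv/=; exact: h.
by have := h i I; rewrite /= in_itv.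
Qed.

Definition torus n : set (n.-tuple R) -> \bar R :=
  mrestr (leb n) (@measurable_cube n).

HB.instance Definition _ n := Measure.on (@torus n).

Let torus_sigma_finite n : sigma_finite setT (@torus n).
Proof.
have [F FT Foo] := sigma_finiteT (leb n).
exists F => // i; have [mF Fi] := Foo i; split => //.
apply: le_lt_trans Fi; apply: le_measure; rewrite ?inE//.
by apply: measurableI => //; exact: measurable_cube.
Qed.

HB.instance Definition _ n := Measure_isSigmaFinite.Build _ _ _ (@torus n)
  (@torus_sigma_finite n).

End lebesgue_measure_Rn.
Arguments torus {R} n.
Arguments cube {R} n.

(* Elements of L^p(mu; C) are handled through representatives. The subspaces
   below are closed under a.e. equality because they are closed under L^2-limits,
   and [bounded_operator] forces an operator to respect a.e. equality. *)
Section complex_Lp.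
Context d (T : measurableType d) {R : realType}.
Context (mu : {measure set T -> \bar R}).
Implicit Types (f g : T -> R[i]) (V : set (T -> R[i])).

Definition Cmeasurable f :=
  measurable_fun setT (fun x => complex.Re (f x)) /\
  measurable_fun setT (fun x => complex.Im (f x)).

Definition CLnorm (p : \bar R) f : \bar R :=
  Lnorm mu p (fun x => (Normc.normc (f x))%:E).

Definition LpC (p : \bar R) : set (T -> R[i]) :=
  [set f | Cmeasurable f /\ (CLnorm p f < +oo)%E].

Definition L2norm f : \bar R := CLnorm 2%:E f.

Definition Cintegral f : R[i] :=
  Complex (Rintegral mu setT (fun x => complex.Re (f x)))
          (Rintegral mu setT (fun x => complex.Im (f x))).

Definition inner f g : R[i] := Cintegral (fun x => f x * conjc (g x)).

Definition closed_subspace V :=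
  [/\ V `<=` LpC 2%:E,
      V (cst 0),
      (forall a f g, V f -> V g -> V (fun x => a * f x + g x)) &
      (forall (u : nat -> T -> R[i]) f, (forall k, V (u k)) -> LpC 2%:E f ->
         L2norm (fun x => u k x - f x) @[k --> \oo] --> 0%E -> V f)].

Definition closed_span (S : set (T -> R[i])) : set (T -> R[i]) :=
  smallest closed_subspace S.

Definition ortho_proj V f : T -> R[i] :=
  xget (cst 0) [set g | V g /\ forall h, V h -> inner (fun x => f x - g x) h = 0].

Definition bounded_operator V (A : (T -> R[i]) -> (T -> R[i])) :=
  [/\ (forall f, V f -> LpC 2%:E (A f)),
      (forall a f g, V f -> V g ->
         A (fun x => a * f x + g x) = (fun x => a * A f x + A g x) %[ae mu]) &
      (exists M : R, forall f, V f -> (L2norm (A f) <= M%:E * L2norm f)%E)].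

Definition bounded_below V (A : (T -> R[i]) -> (T -> R[i])) (c : R) :=
  forall f, V f -> (c%:E * L2norm f <= L2norm (A f))%E.

Record partial_operator := PartialOperator {
  dom : set (T -> R[i]);
  op :> (T -> R[i]) -> (T -> R[i]);
  dom_closed : closed_subspace dom;
  op_bounded : bounded_operator dom op }.

End complex_Lp.

Section weyl_zak.
Context {R : realType} {n : nat}.
Local Notation Rn := (n.-tuple R).
Local Notation R2n := (Rn * Rn)%type.
Local Notation Zn := (n.-tuple int).
Implicit Types (x y : Rn) (k l m : Zn).

Definition dot x y : R := \sum_(i < n) tnth x i * tnth y i.
Definition addv x y : Rn := [tuple tnth x i + tnth y i | i < n].
Definition subv x y : Rn := [tuple tnth x i - tnth y i | i < n].
Definition intv k : Rn := [tuple (tnth k i)%:~R | i < n].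

Definition expi (t : R) : R[i] := Complex (cos t) (sin t).

Definition leb2 : {sigma_finite_measure set R2n -> \bar R} :=
  prodm (leb n) (leb n).

Definition torus2 : {sigma_finite_measure set R2n -> \bar R} :=
  prodm (torus n) (torus n).

Definition zak_measure : {sigma_finite_measure set (R2n * Rn)%type -> \bar R} :=
  prodm torus2 (leb n).

Definition twisted_translation k l (phi : R2n -> R[i]) : R2n -> R[i] :=
  fun z => expi (pi * (dot z.1 (intv l) - dot z.2 (intv k))) *
           phi (subv z.1 (intv k), subv z.2 (intv l)).

Definition twisted_shift_invariant (V : set (R2n -> R[i])) :=
  forall f k l, V f -> V (twisted_translation k l f).

Definition twisted_shift_preserving (V : set (R2n -> R[i]))
    (U : (R2n -> R[i]) -> (R2n -> R[i])) :=
  forall f k l, V f ->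
    U (twisted_translation k l f) = twisted_translation k l (U f) %[ae leb2].

Definition weyl_kernel_int (phi : R2n -> R[i]) : R2n -> R[i] :=
  fun z => Cintegral (leb n) (fun x =>
    phi (x, subv z.2 z.1) * expi (pi * dot x (addv z.1 z.2))).

(* Extension of [weyl_kernel_int] by density; the choice of [K] is unique up to
   a null set. *)
Definition weyl_kernel (phi : R2n -> R[i]) : R2n -> R[i] :=
  xget (cst 0) [set K | LpC leb2 2%:E K /\
    exists u : nat -> (R2n -> R[i]),
      [/\ (forall j, LpC leb2 1%:E (u j) /\ LpC leb2 2%:E (u j)),
          L2norm leb2 (fun z => u j z - phi z) @[j --> \oo] --> 0%E &
          L2norm leb2 (fun z => weyl_kernel_int (u j) z - K z) @[j --> \oo] --> 0%E]].

Definition zak_sum (K : R2n -> R[i]) (F : {fset Zn}) : R2n * Rn -> R[i] :=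
  fun w => \sum_(m <- F)
    K (addv (intv m) w.1.1, w.2) * expi (- (2 * pi * dot (intv m) w.1.2)).

(* The series over Z^n is summed in L^2(T^n x T^n x R^n), unconditionally. *)
Definition weyl_zak (phi : R2n -> R[i]) : R2n * Rn -> R[i] :=
  xget (cst 0) [set Z | LpC zak_measure 2%:E Z /\
    forall e : R, 0 < e -> exists F0 : {fset Zn}, forall F : {fset Zn},
      fsubset F0 F ->
      (L2norm zak_measure (fun w => zak_sum (weyl_kernel phi) F w - Z w)%R
       < e%:E)%E].

Definition calJ (f : R2n -> R[i]) : R2n -> Rn -> R[i] :=
  fun w eta => weyl_zak f (w, eta).

Definition range_function_of (V : set (R2n -> R[i]))
    (J : R2n -> set (Rn -> R[i])) :=
  (forall w, closed_subspace (leb n) (J w)) /\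
  exists f : nat -> R2n -> R[i],
    [/\ (forall i, V (f i)),
        (forall g (e : R), V g -> 0 < e ->
           exists i, (L2norm leb2 (fun z => g z - f i z)%R < e%:E)%E) &
        {ae torus2, forall w,
           J w = closed_span (leb n) (range (fun i => calJ (f i) w))}].

Definition range_operator (J : R2n -> set (Rn -> R[i]))
    (A : R2n -> partial_operator (leb n)) :=
  {ae torus2, forall w, dom (A w) = J w}.

(* Measurability is with respect to the completed measure: [A w] is only
   constrained on [J w] for almost every [w]. *)
Definition measurable_range_operator (J : R2n -> set (Rn -> R[i]))
    (A : R2n -> partial_operator (leb n)) :=
  forall a b, LpC (leb n) 2%:E a -> LpC (leb n) 2%:E b ->
    exists2 h : R2n -> R[i], Cmeasurable h &
      (fun w => inner (leb n) (A w (ortho_proj (leb n) (J w) a)) b) = h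
        %[ae torus2].

Definition corresponding_range_operator (V : set (R2n -> R[i]))
    (J : R2n -> set (Rn -> R[i]))
    (U : (R2n -> R[i]) -> (R2n -> R[i]))
    (A : R2n -> partial_operator (leb n)) :=
  [/\ range_operator J A,
      measurable_range_operator J A &
      forall f, V f -> {ae torus2, forall w,
        calJ (U f) w = A w (calJ f w) %[ae leb n]}].

End weyl_zak.

(* Main.v *)
From mathcomp Require Import all_boot all_order all_algebra finmap.
From mathcomp Require Import complex ring lra.
From mathcomp Require Import all_classical all_reals all_analysis.
From mathcomp Require Import measurable_realfun.
Require Import Defs.

Set Implicit Arguments.
Unset Strict Implicit.
Unset Printing Implicit Defensive.
Import Order.TTheory GRing.Theory Num.Theory.
Import numFieldNormedType.Exports.

Local Open Scope classical_set_scope.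
Local Open Scope ring_scope.

(** The Weyl-Zak transform is a composition of isometries (Plancherel in one
    variable and Parseval on the torus), hence [qn leb2 f], the squared norm of
    [f], is the integral over the torus of the squared norms of the fibers
    [calJ f w]. Integrating the fiberwise bound gives one implication. For the
    other, twisted translations act on the fibers as characters of the torus, so
    for every trigonometric polynomial p and f in V there is g in V whose fibers,
    and those of U g, are p times the fibers of f and of U f. The global bound for
    g reads c^2 int |p|^2 |J f|^2 <= int |p|^2 |J (U f)|^2. Trigonometric
    polynomials are dense in L^2 of any finite measure on the torus that has the
    density |J f|^2 + |J (U f)|^2, so |p|^2 can be replaced by an indicator and the
    bound holds almost everywhere. Applied to the countable dense sequence that
    defines the range function, it holds at almost every point on a dense subset
    of J w, hence on J w since R(w) is bounded. *)

(** * Squared norms and convergence in L^2 *)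

(** The Weyl kernel and the Zak series are picked by [xget], with default 0, so nothing is known of
    them until their defining predicates are shown to be inhabited. Hence completeness of L^2,
    Plancherel on R^n and Parseval on the torus are part of the proof. One density argument carries
    all of it: an iteration for the sign turns bounded functions of an algebra into indicators of
    their superlevel sets, and such sets generate the sigma-algebra. It is used with weight 1 on T^n
    for Parseval, and with weight |J (U f)|^2 + c^2 |J f|^2 on T^n x T^n for the passage to fibers.
    Plancherel follows from Parseval by cutting R^n into unit cubes. Norms are squared and take
    extended real values. The pointwise bound |z + w|^2 <= (1 + e) |z|^2 + (1 + 1/e) |w|^2 does the
    work of Minkowski's inequality, and e tends to 0 when exact constants matter. Functions are
    representatives: identities between fibers hold off a null set that depends on the functions
    involved. Only countably many may be combined before a point of the torus is fixed, which is why
    rational scalars and a dense sequence occur. *)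

Section squared_modulus.
Context {R : realType}.
Implicit Types (z w : R[i]).

Definition sqc z : R := complex.Re z ^+ 2 + complex.Im z ^+ 2.

Lemma sqc_ge0 z : 0 <= sqc z.
Proof. by rewrite addr_ge0// sqr_ge0. Qed.

Lemma sqcE z : Normc.normc z ^+ 2 = sqc z.
Proof. by case: z => a b; rewrite /= sqr_sqrtr// addr_ge0// sqr_ge0. Qed.

Lemma ReD z w : complex.Re (z + w) = complex.Re z + complex.Re w.
Proof. by case: z; case: w. Qed.

Lemma ImD z w : complex.Im (z + w) = complex.Im z + complex.Im w.
Proof. by case: z; case: w. Qed.

Lemma ReN z : complex.Re (- z) = - complex.Re z.
Proof. by case: z. Qed.

Lemma ImN z : complex.Im (- z) = - complex.Im z.
Proof. by case: z. Qed.

Lemma ReM z w : complex.Re (z * w) =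
  complex.Re z * complex.Re w - complex.Im z * complex.Im w.
Proof. by case: z; case: w. Qed.

Lemma ImM z w : complex.Im (z * w) =
  complex.Re z * complex.Im w + complex.Im z * complex.Re w.
Proof. by case: z => a b; case: w => c d. Qed.

Definition ReImE := (ReD, ImD, ReN, ImN, ReM, ImM).

Lemma eq_complexP z w : complex.Re z = complex.Re w ->
  complex.Im z = complex.Im w -> z = w.
Proof. by case: z; case: w => /= ? ? ? ? -> ->. Qed.

Lemma sqc0 : sqc 0 = 0.
Proof. by rewrite /sqc/= expr0n/= addr0. Qed.

Lemma sqc_eq0 z : sqc z = 0 -> z = 0.
Proof.
move/eqP; rewrite paddr_eq0 ?sqr_ge0// !sqrf_eq0 => /andP[/eqP a0 /eqP b0].
exact: eq_complexP.
Qed.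

Lemma sqcM z w : sqc (z * w) = sqc z * sqc w.
Proof. rewrite /sqc !ReImE; ring. Qed.

Lemma sqcN z : sqc (- z) = sqc z.
Proof. rewrite /sqc !ReImE; ring. Qed.

Lemma sqcB z w : sqc (z - w) = sqc (w - z).
Proof. by rewrite -sqcN opprB. Qed.

Lemma sqc_expi t : sqc (expi t) = 1.
Proof. by rewrite /sqc/= cos2Dsin2. Qed.

Lemma sqc_real (a : R) : sqc (Complex a 0) = a ^+ 2.
Proof. by rewrite /sqc/= expr0n/= addr0. Qed.

(** The weighted form of 2ab <= e a^2 + b^2 / e. It replaces the triangle inequality for squared
    norms: the weight of the main term can be brought as close to 1 as desired, at the cost of a
    large weight on the error term. *)
Lemma sqrrD_le (e a b : R) : 0 < e ->
  (a + b) ^+ 2 <= (1 + e) * a ^+ 2 + (1 + e^-1) * b ^+ 2.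
Proof.
move=> e0; rewrite -subr_ge0.
suff -> : (1 + e) * a ^+ 2 + (1 + e^-1) * b ^+ 2 - (a + b) ^+ 2 =
   e * (a - e^-1 * b) ^+ 2 by rewrite mulr_ge0 ?sqr_ge0// ltW.
by field; rewrite gt_eqF.
Qed.

Lemma sqcD_le (e : R) z w : 0 < e ->
  sqc (z + w) <= (1 + e) * sqc z + (1 + e^-1) * sqc w.
Proof.
move=> e0; rewrite /sqc !ReImE.
have := sqrrD_le (complex.Re z) (complex.Re w) e0.
have := sqrrD_le (complex.Im z) (complex.Im w) e0.
lra.
Qed.

Lemma sqcD2 z w : sqc (z + w) <= 2 * sqc z + 2 * sqc w.
Proof. by have := @sqcD_le 1 z w ltr01; rewrite invr1. Qed.

Lemma expiD (s t : R) : expi (s + t) = expi s * expi t.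
Proof.
by apply: eq_complexP; rewrite ReImE/= ?cosD ?sinD// addrC.
Qed.

Lemma expi0 : expi (0 : R) = 1.
Proof. by rewrite /expi cos0 sin0. Qed.

Lemma expi2piz (k : int) : expi (2 * pi * k%:~R : R) = 1.
Proof.
have nat (m : nat) : expi (2 * pi * m%:R : R) = 1.
  elim: m => [|m ih]; first by rewrite mulr0 expi0.
  rewrite -[m.+1%:R]natr1 mulrDr expiD ih mul1r mulr1 mulr_natl /expi cos2pi sin2pi//.
case: k => m; first exact: nat.
rewrite NegzE mulrNz mulrN; have := nat m.+1 => h.
have : expi (2 * pi * (m.+1)%:R : R) * expi (- (2 * pi * m.+1%:R)) = 1.
  by rewrite -expiD subrr expi0.
by rewrite h mul1r.
Qed.

End squared_modulus.

(** Bookkeeping for the case e = 1 of the weighted inequality, with both weights equal to 2. The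
    bounds [e / 4] found throughout originate here. *)
Lemma lte_quarters {R : realType} (e : R) (x y z : \bar R) : (0 <= x)%E -> (0 <= y)%E ->
  (z <= 2%:E * x + 2%:E * y)%E -> (x < (e / 4)%:E)%E -> (y < (e / 4)%:E)%E -> (z < e%:E)%E.
Proof.
case: x => [x| |]//; case: y => [y| |]// _ _ h xe ye; apply: le_lt_trans h _.
by move: xe ye; rewrite -!EFinM -EFinD !lte_fin; lra.
Qed.

Section qnorm.
Context d (T : measurableType d) {R : realType} (mu : {measure set T -> \bar R}).
Implicit Types (f g : T -> R[i]).

Lemma CmeasurableD f g : Cmeasurable f -> Cmeasurable g ->
  Cmeasurable (fun x => f x + g x).
Proof.
move=> [f1 f2] [g1 g2]; split; under eq_fun do rewrite ReImE.
  exact: measurable_funD.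
exact: measurable_funD.
Qed.

Lemma CmeasurableN f : Cmeasurable f -> Cmeasurable (fun x => - f x).
Proof.
move=> [f1 f2]; split; under eq_fun do rewrite ReImE; exact: measurable_funN.
Qed.

Lemma CmeasurableB f g : Cmeasurable f -> Cmeasurable g ->
  Cmeasurable (fun x => f x - g x).
Proof. by move=> mf /CmeasurableN; exact: CmeasurableD. Qed.

Lemma CmeasurableM f g : Cmeasurable f -> Cmeasurable g ->
  Cmeasurable (fun x => f x * g x).
Proof.
move=> [f1 f2] [g1 g2]; split; under eq_fun do rewrite ReImE.
  by apply: measurable_funB; apply: measurable_funM.
by apply: measurable_funD; apply: measurable_funM.
Qed.

Lemma Cmeasurable_cst (a : R[i]) : Cmeasurable (fun _ : T => a).
Proof. by split; exact: measurable_cst. Qed.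

Lemma CmeasurableZ (a : R[i]) f : Cmeasurable f -> Cmeasurable (fun x => a * f x).
Proof. by move=> mf; apply: CmeasurableM => //; exact: Cmeasurable_cst. Qed.

Lemma Cmeasurable_lin (a : R[i]) f g : Cmeasurable f -> Cmeasurable g ->
  Cmeasurable (fun x => a * f x + g x).
Proof. by move=> mf mg; apply: CmeasurableD => //; exact: CmeasurableZ. Qed.

Lemma Cmeasurable_expi (f : T -> R) : measurable_fun setT f ->
  Cmeasurable (fun x => expi (f x)).
Proof.
move=> mf; split => /=.
  apply: (measurableT_comp (f := cos)) => //.
  by apply: continuous_measurable_fun; exact: continuous_cos.
apply: (measurableT_comp (f := sin)) => //.
by apply: continuous_measurable_fun; exact: continuous_sin.
Qed.

Lemma Cmeasurable_sum I (s : seq I) (F : I -> T -> R[i]) :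
  (forall i, Cmeasurable (F i)) -> Cmeasurable (fun x => \sum_(i <- s) F i x).
Proof.
move=> mF; elim: s => [|i s ih].
  by under eq_fun do rewrite big_nil; exact: Cmeasurable_cst.
by under eq_fun do rewrite big_cons; exact: CmeasurableD.
Qed.

Lemma measurable_sqc f : Cmeasurable f -> measurable_fun setT (fun x => sqc (f x)).
Proof. by move=> [f1 f2]; apply: measurable_funD; exact: measurable_funX. Qed.

Lemma measurable_esqc f : Cmeasurable f ->
  measurable_fun setT (fun x => (sqc (f x))%:E).
Proof. by move=> /measurable_sqc/measurable_EFinP. Qed.

Definition qn f : \bar R := (\int[mu]_x (sqc (f x))%:E)%E.

Lemma qn_ge0 f : (0 <= qn f)%E.
Proof. by apply: integral_ge0 => x _; rewrite lee_fin sqc_ge0. Qed.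

Lemma eq_qn f g : (forall x, sqc (f x) = sqc (g x)) -> qn f = qn g.
Proof. by move=> fg; apply: eq_integral => x _; rewrite fg. Qed.

Lemma qnN f : qn (fun x => - f x) = qn f.
Proof. by apply: eq_qn => x; rewrite sqcN. Qed.

Lemma qnB f g : qn (fun x => f x - g x) = qn (fun x => g x - f x).
Proof. by apply: eq_qn => x; rewrite sqcB. Qed.

Lemma qn0 : qn (fun _ => 0) = 0%E.
Proof. by rewrite /qn integral0_eq// => x _; rewrite sqc0. Qed.

Lemma L2normE f : L2norm mu f = sqrte (qn f).
Proof.
rewrite -poweR12_sqrt ?qn_ge0// /L2norm /CLnorm unlock; congr (_ `^ _)%E.
apply: eq_integral => x _ /=.
by rewrite powR_mulrn// real_normK ?num_real// sqcE.
Qed.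

Lemma L2norm_ge0 f : (0 <= L2norm mu f)%E.
Proof. exact: Lnorm_ge0. Qed.

Lemma L2norm_lt (e : R) f : 0 < e -> (L2norm mu f < e%:E)%E = (qn f < (e ^+ 2)%:E)%E.
Proof.
move=> e0; rewrite L2normE; have := qn_ge0 f; case: (qn f) => [r| |]//=.
rewrite !lee_fin !lte_fin => r0.
by rewrite -(ltr_sqr (x := Num.sqrt r)) ?nnegrE ?sqrtr_ge0 ?ltW// sqr_sqrtr.
Qed.

Lemma L2norm_fin f : (L2norm mu f < +oo)%E = (qn f < +oo)%E.
Proof.
by rewrite L2normE; have := qn_ge0 f; case: (qn f) => [r| |]//=; rewrite !ltry.
Qed.

Lemma qn_scale (c : R) f : 0 <= c -> Cmeasurable f ->
  (\int[mu]_x (c%:E * (sqc (f x))%:E) = c%:E * qn f)%E.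
Proof.
move=> c0 mf; rewrite ge0_integralZl_EFin//.
  by move=> x _; rewrite lee_fin sqc_ge0.
exact: measurable_esqc.
Qed.

Lemma qnD (e : R) f g : 0 < e -> Cmeasurable f -> Cmeasurable g ->
  (qn (fun x => (f x + g x)%R) <= (1 + e)%:E * qn f + (1 + e^-1)%:E * qn g)%E.
Proof.
move=> e0 mf mg; have e1 : 0 <= e^-1 by rewrite invr_ge0 ltW.
have e2 : 0 <= 1 + e by rewrite addr_ge0// ltW.
have e3 : 0 <= 1 + e^-1 by rewrite addr_ge0.
rewrite -!qn_scale// -ge0_integralD//.
- apply: ge0_le_integral => //.
  + by move=> x _; rewrite lee_fin sqc_ge0.
  + by apply: measurable_esqc; exact: CmeasurableD.
  + by apply: emeasurable_funD; apply: measurable_funeM; exact: measurable_esqc.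
  + by move=> x _; rewrite -!EFinM -EFinD lee_fin sqcD_le.
- by move=> x _; rewrite -EFinM lee_fin mulr_ge0 ?sqc_ge0.
- by apply: measurable_funeM; exact: measurable_esqc.
- by move=> x _; rewrite -EFinM lee_fin mulr_ge0 ?sqc_ge0.
- by apply: measurable_funeM; exact: measurable_esqc.
Qed.

Lemma qnD2 f g : Cmeasurable f -> Cmeasurable g ->
  (qn (fun x => (f x + g x)%R) <= 2%:E * qn f + 2%:E * qn g)%E.
Proof. by move=> mf mg; have := qnD ltr01 mf mg; rewrite invr1. Qed.

Lemma qnZ (a : R[i]) f : Cmeasurable f -> qn (fun x => a * f x) = ((sqc a)%:E * qn f)%E.
Proof.
move=> mf; rewrite -qn_scale ?sqc_ge0//.
by apply: eq_integral => x _; rewrite sqcM EFinM.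
Qed.

Lemma qn_eq0 f : Cmeasurable f -> qn f = 0%E <-> f = cst 0 %[ae mu].
Proof.
move=> mf; have mF := measurable_esqc mf.
have E : (\int[mu]_x `|(sqc (f x))%:E|)%E = qn f.
  by apply: eq_integral => x _; rewrite gee0_abs// lee_fin sqc_ge0.
split => [q0|].
  have [+ _] := ae_eq_integral_abs mu measurableT mF.
  rewrite E => /(_ q0); apply: filterS => x /= /(_ I) [] /sqc_eq0 fx0 _//.
move=> f0; apply/eqP; rewrite -E; apply/eqP.
apply/(ae_eq_integral_abs mu measurableT mF).
by apply: filterS f0 => x /= h _; rewrite h// sqc0.
Qed.

Lemma ae_eq_qn f g : Cmeasurable f -> Cmeasurable g -> f = g %[ae mu] -> qn f = qn g.
Proof.
move=> mf mg fg; apply: ge0_ae_eq_integral => //.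
- exact: measurable_esqc.
- exact: measurable_esqc.
- by move=> x _; rewrite lee_fin sqc_ge0.
- by move=> x _; rewrite lee_fin sqc_ge0.
- by apply: filterS fg => x /= h _; rewrite h.
Qed.

Lemma qn_ae_eq f g : Cmeasurable f -> Cmeasurable g ->
  qn (fun x => f x - g x) = 0%E <-> f = g %[ae mu].
Proof.
move=> mf mg; rewrite qn_eq0; last exact: CmeasurableB.
split; apply: filterS => x /= h _; first by apply/eqP; rewrite -subr_eq0 h.
by rewrite h// subrr.
Qed.

Lemma LpC2P f : LpC mu 2%:E f <-> Cmeasurable f /\ (qn f < +oo)%E.
Proof. by rewrite /LpC/= -L2norm_fin. Qed.

Lemma qnD_lty f g : Cmeasurable f -> Cmeasurable g -> (qn f < +oo)%E -> (qn g < +oo)%E ->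
  (qn (fun x => (f x + g x)%R) < +oo)%E.
Proof.
move=> mf mg qf qg; apply: le_lt_trans (qnD2 mf mg) _.
by rewrite lte_add_pinfty// lte_mul_pinfty.
Qed.

Lemma qnB_lty f g : Cmeasurable f -> Cmeasurable g -> (qn f < +oo)%E -> (qn g < +oo)%E ->
  (qn (fun x => (f x - g x)%R) < +oo)%E.
Proof.
by move=> mf mg qf qg; apply: qnD_lty => //; [exact: CmeasurableN|rewrite qnN].
Qed.

End qnorm.

Section limits.
Context {R : realType}.

(** The order of choice matters: [e] is fixed first, so that [e * y] is small, and then [m] is taken
    small against [1 + e^-1], which is large. *)
Lemma lee_1e_approx (x y : \bar R) : (0 <= x)%E -> (0 <= y)%E ->
  (forall e m : R, 0 < e -> 0 < m ->
    (x <= (1 + e)%:E * y + (1 + e^-1)%:E * m%:E)%E) -> (x <= y)%E.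
Proof.
move=> x0 y0; case: y y0 => [r| |]// y0; last by rewrite leey.
case: x x0 => [s| |]// x0; last by move=> /(_ 1 1 ltr01 ltr01).
move: x0 y0; rewrite !lee_fin => s0 r0 h; apply/ler_addgt0Pr => n n0.
(* Each error term receives half of the slack [n]; the divisor [r + 1] stays positive when [r] is
   0. *)
pose e := n / 2 / (r + 1); pose m := n / 2 / (1 + e^-1).
have e0 : 0 < e by rewrite !divr_gt0// ltr_wpDl.
have ei0 : 0 < 1 + e^-1 by rewrite addr_gt0// invr_gt0.
have m0 : 0 < m by rewrite !divr_gt0.
have := h e m e0 m0; rewrite -!EFinM -EFinD lee_fin => /le_trans; apply.
have -> : (1 + e^-1) * m = n / 2 by rewrite /m mulrCA divff ?mulr1 ?gt_eqF.
have : e * (r + 1) = n / 2 by rewrite /e mulfVK// gt_eqF// ltr_wpDl.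
move: e0 ei0 m0; move: e m => e m; lra.
Qed.

Context d (T : measurableType d) (mu : {measure set T -> \bar R}).
Implicit Types (f g : T -> R[i]) (u : nat -> T -> R[i]).

Definition qcvg u f := forall e : R, 0 < e -> exists N, forall n, (N <= n)%N ->
  (qn mu (fun x => u n x - f x)%R < e%:E)%E.

Lemma L2norm_cvgP u f :
  (L2norm mu (fun x => u k x - f x) @[k --> \oo] --> 0%E) <-> qcvg u f.
Proof.
split.
  move=> /fine_cvgP[[N _ hN]] /cvgrPdist_lt h e e0.
  have s0 : 0 < Num.sqrt e by rewrite sqrtr_gt0.
  have [M _ hM] := h _ s0; exists (maxn N M) => n; rewrite geq_max => /andP[Nn Mn].
  rewrite -[X in X%:E](sqr_sqrtr (ltW e0)) -L2norm_lt//.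
  have := hM n Mn; rewrite /= sub0r normrN => {}hM.
  rewrite -(fineK (hN n Nn)) lte_fin; apply: le_lt_trans hM; exact: ler_norm.
move=> h.
have fin e : 0 < e -> exists N, forall n, (N <= n)%N -> (L2norm mu (fun x => u n x - f x)%R < e%:E)%E.
  move=> e0; have [|N hN] := h (e ^+ 2); first by rewrite exprn_gt0.
  by exists N => n /hN; rewrite L2norm_lt.
apply/fine_cvgP; split.
  have [N hN] := fin 1 ltr01; exists N => // n /= /hN hn.
  by rewrite ge0_fin_numE ?L2norm_ge0//; apply: lt_trans hn _; rewrite ltry.
apply/cvgrPdist_lt => e e0; have [N hN] := fin e e0; exists N => // n /= /hN hn.
have := L2norm_ge0 mu (fun x => u n x - f x).
rewrite sub0r normrN; move: hn; case: (L2norm _ _) => //= r.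
by rewrite lte_fin lee_fin => re r0; rewrite ger0_norm.
Qed.

Lemma qn_le_approx f (B : \bar R) : (0 <= B)%E -> Cmeasurable f ->
  (forall m : R, 0 < m -> exists g, [/\ Cmeasurable g, (qn mu g <= B)%E &
     (qn mu (fun x => f x - g x)%R < m%:E)%E]) -> (qn mu f <= B)%E.
Proof.
move=> B0 mf h; apply: lee_1e_approx => //; first exact: qn_ge0.
move=> e m e0 m0; have [g [mg gB gm]] := h m m0.
have -> : qn mu f = qn mu (fun x => g x + (f x - g x)).
  by congr qn; apply/funext => x; rewrite addrC subrK.
apply: le_trans (qnD _ e0 mg (CmeasurableB mf mg)) _.
by apply: leeD; apply: lee_wpmul2l => //; rewrite ?lee_fin ?addr_ge0 ?invr_ge0 ?ltW//.
Qed.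

End limits.

(** The two sequences may live on different measure spaces. Applied in both directions, it extends
    an isometry from approximants to limits without any continuity statement about the map
    itself. *)
Lemma qcvg_le {R : realType} d d' (T : measurableType d) (T' : measurableType d')
    (mu : {measure set T -> \bar R}) (nu : {measure set T' -> \bar R})
    u f v g : (forall n, Cmeasurable (u n)) -> (forall n, Cmeasurable (v n)) ->
  Cmeasurable f -> Cmeasurable g ->
  qcvg mu u f -> qcvg nu v g -> (forall n, (qn mu (u n) <= qn nu (v n))%E) ->
  (qn mu f <= qn nu g)%E.
Proof.
move=> mu_ mv mf mg uf vg uv.
apply: lee_1e_approx => [||e m e0 m0]; [exact: qn_ge0|exact: qn_ge0|].
have e1 : 0 < 1 + e by rewrite addr_gt0.
have e2 : 0 < 1 + e^-1 by rewrite addr_gt0 ?invr_gt0.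
have [N hN] := vg _ m0.
apply: qn_le_approx => //.
  by rewrite adde_ge0// mule_ge0 ?lee_fin ?qn_ge0 ?ltW.
move=> k k0; have [M hM] := uf _ k0; exists (u (maxn N M)); split => //.
- apply: le_trans (uv _) _; set n := maxn N M.
  have -> : qn nu (v n) = qn nu (fun x => g x + (v n x - g x)).
    by congr qn; apply/funext => x; rewrite addrC subrK.
  apply: le_trans (qnD _ e0 mg (CmeasurableB (mv _) mg)) _.
  apply: leeD => //; apply: lee_wpmul2l => //; rewrite ?lee_fin ?ltW//.
  by apply: hN; rewrite leq_maxl.
- by rewrite qnB; apply: hM; rewrite leq_maxr.
Qed.

(** * Fatou's lemma and completeness of L^2 *)

Section complete.
Context {R : realType} d (T : measurableType d) (mu : {measure set T -> \bar R}).
Implicit Types (f g : T -> R[i]) (u : nat -> T -> R[i]).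

Lemma limn_einf_le (v : nat -> \bar R) (B : \bar R) :
  (exists N, forall n, (N <= n)%N -> (v n <= B)%E) -> (limn_einf v <= B)%E.
Proof.
move=> [N hN]; rewrite limn_einf_lim; apply: lime_le.
  by apply: ereal_nondecreasing_is_cvgn; exact: nondecreasing_einfs.
apply: nearW => n; apply: le_trans (hN (maxn n N) _); last exact: leq_maxr.
by apply: ereal_inf_lbound; exists (maxn n N) => //=; rewrite leq_maxl.
Qed.

Lemma measurable_limn_einf (v : nat -> T -> \bar R) :
  (forall n, measurable_fun setT (v n)) ->
  measurable_fun setT (fun x => limn_einf (v^~ x)).
Proof.
move=> mv; rewrite /limn_einf.
apply: (measurableT_comp (f := fun x => oppe x) (g := fun x => limn_esup (fun n => oppe (v n x)))).
  exact: oppe_measurable.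
by apply: measurable_fun_limn_esup => n; apply: measurableT_comp.
Qed.

Lemma fatou_qn u f (B : \bar R) : (forall n, Cmeasurable (u n)) -> Cmeasurable f ->
  {ae mu, forall x, sqc (u n x) @[n --> \oo] --> sqc (f x)} ->
  (exists N, forall n, (N <= n)%N -> (qn mu (u n) <= B)%E) -> (qn mu f <= B)%E.
Proof.
move=> mu_ mf uf hN.
have -> : qn mu f = (\int[mu]_x limn_einf (fun n => (sqc (u n x))%:E))%E.
  apply: ge0_ae_eq_integral => //.
  - exact: measurable_esqc.
  - by apply: measurable_limn_einf => n; exact: measurable_esqc.
  - by move=> x _; rewrite lee_fin sqc_ge0.
  - move=> x _; rewrite limn_einf_lim; apply: lime_ge.
      by apply: ereal_nondecreasing_is_cvgn; exact: nondecreasing_einfs.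
    by apply: nearW => n; apply: le_ereal_inf_tmp => _ [k /= _ <-]; rewrite lee_fin sqc_ge0.
  apply: filterS uf => x ux _.
  by have /cvg_limn_einf_sup[-> _] : (sqc (u n x))%:E @[n --> \oo] --> (sqc (f x))%:E
    by apply/fine_cvgP; split; [exact: nearW|exact: ux].
apply: le_trans (fatou mu measurableT _ _) _.
- by move=> n; exact: measurable_esqc.
- by move=> n x _; rewrite lee_fin sqc_ge0.
- exact: limn_einf_le.
Qed.

End complete.

Section riesz_fischer.
Context {R : realType}.

Lemma geometric_steps_cvg (a : nat -> R) (C : R) :
  (forall k, `|a k.+1 - a k| <= C * 2^-1 ^+ k) -> cvgn a.
Proof.
move=> h.
have ga : cvgn (series (geometric C 2^-1)).
  apply: is_cvg_geometric_series.
  by rewrite ger0_norm ?invr_ge0// invf_lt1// ltr1n.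
have : cvgn [normed series (telescope a)].
  apply: (series_le_cvg _ _ _ ga) => k /=; rewrite ?normr_ge0//.
    exact: le_trans (normr_ge0 _) (h k).
  exact: h.
move=> /normed_cvg; rewrite telescopeK => ca.
have -> : a = (fun n => (a n - a 0%N) + a 0%N) by apply/funext => n; rewrite subrK.
by apply: is_cvgD => //; exact: is_cvg_cst.
Qed.

Context d (T : measurableType d) (mu : {measure set T -> \bar R}).
Implicit Types (f g : T -> R[i]) (u : nat -> T -> R[i]).

Lemma measurable_lim_esup (v : nat -> T -> R) :
  (forall n, measurable_fun setT (v n)) ->
  measurable_fun setT (fun x => fine (limn_esup (fun n => (v n x)%:E))).
Proof.
move=> mv; apply: (measurableT_comp (f := fine)) => //.
by apply: measurable_fun_limn_esup => n; exact/measurable_EFinP.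
Qed.

Lemma cvg_fine_limn_esup (a : nat -> R) : cvgn a ->
  a @ \oo --> fine (limn_esup (EFin \o a)).
Proof.
move=> ca; have : (a n)%:E @[n --> \oo] --> (limn a)%:E.
  by apply/fine_cvgP; split; [exact: nearW|exact: ca].
by move=> /cvg_limn_einf_sup[_ ->].
Qed.

(** The series of [4 ^+ k] times the squared increments has integral at most the sum of (4/8)^k, so
    it is finite almost everywhere. At such a point the k-th increment is at most a constant times
    2^-k, and the values converge. *)
Lemma rapid_cvg u : (forall n, Cmeasurable (u n)) ->
  (forall k, (qn mu (fun x => u k.+1 x - u k x)%R <= (8^-1 ^+ k)%:E)%E) ->
  exists2 f, Cmeasurable f &
   {ae mu, forall x, complex.Re (u n x) @[n --> \oo] --> complex.Re (f x) /\
                     complex.Im (u n x) @[n --> \oo] --> complex.Im (f x)}.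
Proof.
move=> mu_ hu.
(* An upper limit exists at every point and is measurable in [x]; it agrees with the limit wherever
   the latter exists. *)
exists (fun x => Complex (fine (limn_esup (fun n => (complex.Re (u n x))%:E)))
                         (fine (limn_esup (fun n => (complex.Im (u n x))%:E)))).
  by split => /=; apply: measurable_lim_esup => n; case: (mu_ n).
pose D k x := u k.+1 x - u k x.
have mD k : Cmeasurable (D k) by exact: CmeasurableB.
pose F k x := ((4 ^+ k)%:E * (sqc (D k x))%:E)%E.
have F0 k x : (0 <= F k x)%E by rewrite mule_ge0 ?lee_fin ?sqc_ge0.
have mF k : measurable_fun setT (F k).
  by apply: measurable_funeM; exact: measurable_esqc.
pose G x := (\sum_(0 <= k <oo) F k x)%E.
have IG : (\int[mu]_x G x < +oo)%E.
  rewrite integral_nneseries//.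
  apply: (@le_lt_trans _ _ (\sum_(0 <= k <oo) (2^-1 ^+ k)%:E)%E).
    apply: lee_nneseries => [k _ _|k _]; first by apply: integral_ge0 => x _; exact: F0.
    rewrite /F qn_scale//; apply: le_trans (lee_wpmul2l _ (hu k)) _ => //.
    rewrite -EFinM lee_fin -exprMn (_ : 4 * 8^-1 = 2^-1)//; lra.
  have := @cvg_geometric_series _ (1 : R) (2^-1).
  have -> : `|(2 : R)^-1| < 1 by rewrite ger0_norm ?invr_ge0// invf_lt1// ltr1n.
  move=> /(_ erefl) h.
  have -> : (\sum_(0 <= k <oo) (2^-1 ^+ k)%:E)%E = (1 * (1 - 2^-1)^-1 : R)%:E.
    apply/cvg_lim => //.
    rewrite (_ : (fun n => _) = EFin \o series (geometric (1 : R) 2^-1)).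
      by apply/fine_cvgP; split; [exact: nearW|exact: h].
    apply/funext => n; rewrite sumEFin/= /series/=.
    by under [in RHS]eq_bigr do rewrite mul1r.
  by rewrite ltry.
have mG : measurable_fun setT G by apply: ge0_emeasurable_sum.
have : mu.-integrable setT G.
  apply/integrableP; split => //.
  by under eq_integral do rewrite gee0_abs ?nneseries_ge0//.
move=> /(integrable_ae measurableT); apply: filterS => x /(_ I) Gx.
have bd k : sqc (D k x) <= fine (G x) * 4^-1 ^+ k.
  rewrite exprVn ler_pdivlMr ?exprn_gt0// mulrC -lee_fin fineK// EFinM.
  rewrite /G (nneseriesD1 (n := k))//.
  by rewrite leeDl// nneseries_ge0.
have G0 : 0 <= fine (G x) by rewrite fine_ge0// nneseries_ge0.
have bd2 (y z : R) k : y ^+ 2 <= z -> z <= fine (G x) * 4^-1 ^+ k ->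
    `|y| <= Num.sqrt (fine (G x)) * 2^-1 ^+ k.
  move=> yz zG; rewrite -(@ler_pXn2r _ 2%N)// ?nnegrE ?mulr_ge0 ?exprn_ge0 ?invr_ge0 ?sqrtr_ge0//.
  rewrite real_normK ?num_real// exprMn sqr_sqrtr// -exprM mulnC exprM.
  apply: le_trans yz (le_trans zG _).
  by rewrite (_ : 2^-1 ^+ 2 = 4^-1 :> R)//; field.
split; apply: cvg_fine_limn_esup; apply: geometric_steps_cvg => k.
  by apply: bd2 (bd k); rewrite /D /sqc !ReImE lerDl sqr_ge0.
by apply: bd2 (bd k); rewrite /D /sqc !ReImE lerDr sqr_ge0.
Qed.

Lemma riesz_fischer u : (forall n, Cmeasurable (u n)) ->
  (forall e : R, 0 < e -> exists N, forall m n, (N <= m)%N -> (N <= n)%N ->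
     (qn mu (fun x => u m x - u n x)%R < e%:E)%E) ->
  exists2 f, Cmeasurable f & qcvg mu u f.
Proof.
move=> mu_ hu.
have /choice[N hN] k : exists N, forall m n, (N <= m)%N -> (N <= n)%N ->
     (qn mu (fun x => u m x - u n x)%R < (8^-1 ^+ k)%:E)%E.
  by apply: hu; rewrite exprn_gt0// invr_gt0.
(* The running maximum makes [s] nondecreasing, at least [N k] for the rate, and at least [k] so
   that it tends to infinity. *)
pose s k := (\max_(i < k.+1) maxn (N i) i)%N.
have sN k : (N k <= s k)%N.
  by apply: leq_trans (leq_bigmax (@ord_max k)); exact: leq_maxl.
have sk k : (k <= s k)%N.
  by apply: leq_trans (leq_bigmax (@ord_max k)); exact: leq_maxr.
have sS k : (s k <= s k.+1)%N by rewrite /s [leqRHS]big_ord_recr; exact: leq_maxl.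
have rapid k : (qn mu (fun x => ((u \o s) k.+1 x - (u \o s) k x)%R) <= (8^-1 ^+ k)%:E)%E.
  by apply: ltW; apply: hN => //; exact: leq_trans (sN _) (sS _).
have [f mf fae] := rapid_cvg (fun k => mu_ (s k)) rapid.
(* Fatou's lemma is applied to [u m - u (s k)] as [k] grows, with [m] fixed. It gives a non-strict
   bound only, hence [e / 2]. *)
exists f => // e e0; have [M hM] := hu (e / 2) (divr_gt0 e0 (@ltr0Sn _ 1)).
exists M => m Mm; apply: (@le_lt_trans _ _ (e / 2)%:E).
  apply: (@fatou_qn _ _ _ _ (fun k x => u m x - u (s k) x)).
  - by move=> k; exact: CmeasurableB.
  - exact: CmeasurableB.
  - apply: filterS fae => x [cR cI]; rewrite /sqc.
    under eq_fun do rewrite !ReImE.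
    rewrite !ReImE !expr2.
    by apply: cvgD; apply: cvgM; apply: cvgB => //; exact: cvg_cst.
  - by exists M => k Mk; apply: ltW; apply: hM => //; exact: leq_trans (sk _).
by rewrite lte_fin; lra.
Qed.

End riesz_fischer.

(** * Lebesgue measure on R^n, unit cubes and sums over Z^n *)

Section tonelli.
Context {R : realType} d1 d2 (T1 : measurableType d1) (T2 : measurableType d2).
Context (m1 : {sigma_finite_measure set T1 -> \bar R}).
Context (m2 : {sigma_finite_measure set T2 -> \bar R}).
Implicit Types f : T1 * T2 -> \bar R.

Lemma tonelli1 f : measurable_fun setT f -> (forall z, 0 <= f z)%E ->
  (\int[prodm m1 m2]_z f z = \int[m1]_x \int[m2]_y f (x, y))%E.
Proof. by move=> mf f0; exact: (@fubini_tonelli1 _ _ T1 T2 R m1 m2 f mf f0). Qed.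

Lemma tonelli2 f : measurable_fun setT f -> (forall z, 0 <= f z)%E ->
  (\int[prodm m1 m2]_z f z = \int[m2]_y \int[m1]_x f (x, y))%E.
Proof. by move=> mf f0; rewrite tonelli1// fubini_tonelli. Qed.

Lemma measurable_integral1 f : measurable_fun setT f -> (forall z, 0 <= f z)%E ->
  measurable_fun setT (fun x => \int[m2]_y f (x, y))%E.
Proof. by move=> mf f0; exact: (@measurable_fun_fubini_tonelli_F _ _ T1 T2 R m2 f). Qed.

Lemma measurable_integral2 f : measurable_fun setT f -> (forall z, 0 <= f z)%E ->
  measurable_fun setT (fun y => \int[m1]_x f (x, y))%E.
Proof. by move=> mf f0; exact: (@measurable_fun_fubini_tonelli_G _ _ T1 T2 R m1 f). Qed.

Lemma measurable_pairl d (T : measurableType d) (f : T1 * T2 -> T) x :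
  measurable_fun setT f -> measurable_fun setT (fun y => f (x, y)).
Proof. by move=> mf; apply: (measurableT_comp mf); exact: pair1_measurable. Qed.

Lemma measurable_pairr d (T : measurableType d) (f : T1 * T2 -> T) y :
  measurable_fun setT f -> measurable_fun setT (fun x => f (x, y)).
Proof. by move=> mf; apply: (measurableT_comp mf); exact: pair2_measurable. Qed.

Lemma measurable_Rintegral2 (f : T1 * T2 -> R) : measurable_fun setT f ->
  measurable_fun setT (fun x => Rintegral m2 setT (fun y => f (x, y))).
Proof.
move=> mf; apply: (measurableT_comp (f := fine)) => //.
under eq_fun do rewrite integralE.
have mF := (measurable_EFinP setT f).2 mf.
apply: emeasurable_funB.
  have := measurable_integral1 (measurable_funepos mF) (funepos_ge0 _).
  by congr (measurable_fun _ _); apply/funext => x; apply: eq_integral => y _; rewrite !funeposE.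
have := measurable_integral1 (measurable_funeneg mF) (funeneg_ge0 _).
by congr (measurable_fun _ _); apply/funext => x; apply: eq_integral => y _; rewrite !funenegE.
Qed.

End tonelli.

Section transfer.
Context {R : realType} d1 d2 (T1 : measurableType d1) (T2 : measurableType d2).
Context (m1 : {measure set T1 -> \bar R}) (m2 : {measure set T2 -> \bar R}).

Lemma Rintegral_transfer (phi : T1 -> T2) :
  (forall f : T2 -> \bar R, measurable_fun setT f -> (forall x, 0 <= f x)%E ->
    \int[m1]_x f (phi x) = \int[m2]_x f x)%E ->
  forall f : T2 -> R, measurable_fun setT f ->
    Rintegral m1 setT (f \o phi) = Rintegral m2 setT f.
Proof.
move=> h f /measurable_EFinP mf; rewrite /Rintegral; congr fine.
rewrite integralE [RHS]integralE; congr (_ - _)%E.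
  rewrite -(h (EFin \o f)^\+%E) ?funepos_ge0//; last exact: measurable_funepos.
  by apply: eq_integral => x _; rewrite !funeposE.
rewrite -(h (EFin \o f)^\-%E) ?funeneg_ge0//; last exact: measurable_funeneg.
by apply: eq_integral => x _; rewrite !funenegE.
Qed.

End transfer.

Section Rn.
Context {R : realType}.
Local Notation leb1 := (@lebesgue_measure R).

(** The image measure gives half-open intervals their length, which characterizes Lebesgue
    measure. *)
Lemma lebesgue_translate (a : R) (A : set R) : measurable A ->
  pushforward leb1 ((fun x => a + x) : _ -> measurableTypeR R) A = leb1 A.
Proof.
have ma : measurable_fun setT ((fun x => a + x) : measurableTypeR R -> measurableTypeR R).
  by apply: measurable_funD => //; exact: measurable_cst.
move=> mA; apply/esym; apply: (@lebesgue_measure_unique _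
  (measure_function_pushforward__canonical__measure_function_Measure leb1 ma)) => //=.
move=> _ [[x y]] _ <-; rewrite /pushforward.
rewrite (_ : _ @^-1` _ = `](x - a), (y - a)]%classic).
  by rewrite !lebesgue_measure_itv/= !lte_fin ltrD2r -!EFinB opprB addrA subrK.
by apply/seteqP; split => z /=; rewrite !in_itv/= ltrBlDl lerBrDl.
Qed.

Lemma integral_translate1 (a : R) (f : R -> \bar R) :
  measurable_fun setT f -> (forall x, 0 <= f x)%E ->
  (\int[leb1]_x f (a + x)%R = \int[leb1]_x f x)%E.
Proof.
move=> mf f0.
have ma : measurable_fun setT ((fun x => a + x) : measurableTypeR R -> measurableTypeR R).
  by apply: measurable_funD => //; exact: measurable_cst.
have /= <- := ge0_integral_pushforward ma leb1 measurableT mf (fun x _ => f0 x).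
by apply: eq_measure_integral => A mA _; exact: lebesgue_translate.
Qed.

Lemma measurable_tnthc d (T : measurableType d) n (f : T -> n.-tuple R) i :
  measurable_fun setT f -> measurable_fun setT (fun x => tnth (f x) i).
Proof. by move=> mf; exact: (measurableT_comp (@measurable_tnth _ R n i) mf). Qed.

Lemma measurable_addvE d (T : measurableType d) n (f g : T -> n.-tuple R) :
  measurable_fun setT f -> measurable_fun setT g ->
  measurable_fun setT (fun x => addv (f x) (g x)).
Proof.
move=> mf mg; apply/measurable_fun_tnthP => i.
rewrite (_ : _ \o _ = fun x => tnth (f x) i + tnth (g x) i); last first.
  by apply/funext => x /=; rewrite tnth_mktuple.
by apply: measurable_funD; exact: measurable_tnthc.
Qed.

Lemma measurable_subvE d (T : measurableType d) n (f g : T -> n.-tuple R) :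
  measurable_fun setT f -> measurable_fun setT g ->
  measurable_fun setT (fun x => subv (f x) (g x)).
Proof.
move=> mf mg; apply/measurable_fun_tnthP => i.
rewrite (_ : _ \o _ = fun x => tnth (f x) i - tnth (g x) i); last first.
  by apply/funext => x /=; rewrite tnth_mktuple.
by apply: measurable_funB; exact: measurable_tnthc.
Qed.

Lemma measurable_dot d (T : measurableType d) n (f g : T -> n.-tuple R) :
  measurable_fun setT f -> measurable_fun setT g ->
  measurable_fun setT (fun x => dot (f x) (g x)).
Proof.
move=> mf mg; apply: measurable_sum => i.
by apply: measurable_funM; exact: measurable_tnthc.
Qed.

Lemma integral_leb0 (f : 0.-tuple R -> \bar R) : measurable_fun setT f ->
  (\int[leb 0]_x f x = f [tuple])%E.
Proof. by move=> mf; rewrite /= integral_dirac// diracE in_setT mul1e. Qed.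

Lemma integral_lebS n (f : n.+1.-tuple R -> \bar R) :
  measurable_fun setT f -> (forall x, 0 <= f x)%E ->
  (\int[leb n.+1]_x f x = \int[leb1]_a \int[leb n]_x f (cons_pair (a, x)))%E.
Proof.
move=> mf f0.
rewrite -(@tonelli1 _ _ _ _ _ leb1 (leb n) (fun z => f (cons_pair z)))//.
  have mcp : measurable_fun [set: (measurableTypeR R * n.-tuple R)%type] (@cons_pair R n).
    exact: measurable_cons_pair.
  have /= <- := ge0_integral_pushforward mcp (prodm leb1 (leb n)) measurableT mf (fun x _ => f0 x).
  exact: eq_measure_integral.
by apply: measurableT_comp mf _; exact: measurable_cons_pair.
Qed.

Lemma tuple_consP n (x : n.+1.-tuple R) : x = cons_pair (thead x, [tuple of behead x]).
Proof. by apply: val_inj => /=; case: x => -[|]. Qed.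

Lemma addv_cons n (a b : R) (x y : n.-tuple R) :
  addv (cons_pair (a, x)) (cons_pair (b, y)) = cons_pair (a + b, addv x y).
Proof.
apply: eq_from_tnth => i; rewrite tnth_mktuple.
by case: (unliftP ord0 i) => [j ->|->]; rewrite ?tnthS ?tnth0//= tnth_mktuple.
Qed.

Lemma integral_translate n (a : n.-tuple R) (f : n.-tuple R -> \bar R) :
  measurable_fun setT f -> (forall x, 0 <= f x)%E ->
  (\int[leb n]_x f (addv a x) = \int[leb n]_x f x)%E.
Proof.
elim: n a f => [a f mf f0|n ih a f mf f0].
  rewrite !integral_leb0//; first by congr f; apply: val_inj; case: (addv _ _) => -[].
  by apply: measurableT_comp mf _; apply: measurable_addvE => //; exact: measurable_cst.
have mt : measurable_fun setT (fun x => f (addv a x)).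
  by apply: measurableT_comp mf _; apply: measurable_addvE => //; exact: measurable_cst.
rewrite (tuple_consP a) in mt *; set b := thead a; set y := [tuple of behead a].
rewrite !integral_lebS//.
have mc : measurable_fun setT (fun z : R * n.-tuple R => f (cons_pair z)).
  by apply: measurableT_comp mf _; exact: measurable_cons_pair.
transitivity (\int[leb1]_c \int[leb n]_x f (cons_pair (b + c, x)%R))%E.
  apply: eq_integral => c _.
  rewrite -(ih y (fun x => f (cons_pair (b + c, x))))//; last first.
    by exact: (measurable_pairl (b + c) mc).
  by apply: eq_integral => x _; rewrite addv_cons.
rewrite (@integral_translate1 b (fun c => \int[leb n]_x f (cons_pair (c, x)))%E)//.
- exact: (measurable_integral1 (leb n) mc).
- by move=> c; apply: integral_ge0.
Qed.

Lemma integral_torus n (f : n.-tuple R -> \bar R) :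
  measurable_fun setT f -> (forall x, 0 <= f x)%E ->
  (\int[torus n]_x f x = \int[leb n]_(x in cube n) f x)%E.
Proof.
move=> mf f0; have mc := @measurable_cube R n.
rewrite (@ge0_negligible_integral _ _ _ (torus n) setT (~` cube n))//; last first.
- by rewrite -[LHS]/(leb n (~` cube n `&` cube n)) setIC setICr measure0.
- exact: measurableC.
rewrite setTD setCK; apply: eq_measure_integral => A mA AC.
by rewrite -[LHS]/(leb n (A `&` cube n)) setIidl.
Qed.

End Rn.

(** * Sums of nonnegative terms over a countable index set *)

Section zsum.
Context {R : realType} {C : countType}.
Implicit Types (G : C -> \bar R).

(** [pickle_inv] decodes only numbers that are codes, so no index occurs twice. The finite sets
    [zfirst N] increase to the whole type and link the finite sets of the Zak series to
    sequences. *)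
Definition zfirst N : seq C := pmap pickle_inv (iota 0 N).

Definition zsum G : \bar R := (\sum_(0 <= k <oo) oapp G 0 (pickle_inv k))%E.

Lemma zfirst_uniq N : uniq (zfirst N).
Proof.
rewrite /zfirst; apply: (@pmap_uniq _ _ pickle_inv choice.pickle).
  exact: pickle_invK.
exact: iota_uniq.
Qed.

Lemma mem_zfirst N m : (m \in zfirst N) = (choice.pickle m < N)%N.
Proof.
rewrite /zfirst mem_pmap; apply/mapP/idP => [[k]|h].
  rewrite mem_iota/= => kN; have := @pickle_invK C k.
  by case: (pickle_inv k) => //= m' mk [->]; rewrite mk.
by exists (choice.pickle m); rewrite ?mem_iota// pickleK_inv.
Qed.

Lemma zfirst_sub (s : seq C) : exists N, {subset s <= zfirst N}.
Proof.
elim: s => [|m s [N hN]]; first by exists 0%N.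
exists (maxn N (choice.pickle m).+1) => k; rewrite inE => /orP[/eqP ->|/hN].
  by rewrite mem_zfirst leq_maxr.
by rewrite !mem_zfirst => /leq_trans; apply; exact: leq_maxl.
Qed.

Lemma zsum_partial G N :
  (\sum_(0 <= k < N) oapp G 0 (pickle_inv k) = \sum_(m <- zfirst N) G m)%E.
Proof.
rewrite /zfirst /index_iota subn0; elim: (iota 0 N) => [|k s ih].
  by rewrite !big_nil.
rewrite big_cons ih/=; case: (pickle_inv k) => [m|]/=; first by rewrite big_cons.
by rewrite add0e.
Qed.

Lemma zsum_term_ge0 G : (forall m, 0 <= G m)%E ->
  forall k, (0 <= oapp G 0 (@pickle_inv C k))%E.
Proof. by move=> G0 k; case: (pickle_inv k). Qed.

Lemma zsum_cvg G : (forall m, 0 <= G m)%E ->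
  (\sum_(m <- zfirst N) G m)%E @[N --> \oo] --> zsum G.
Proof.
move=> G0; under eq_fun do rewrite -zsum_partial.
by apply: is_cvg_nneseries => k _ _; exact: zsum_term_ge0.
Qed.

Lemma zsum_ge0 G : (forall m, 0 <= G m)%E -> (0 <= zsum G)%E.
Proof. by move=> G0; apply: nneseries_ge0 => k _ _; exact: zsum_term_ge0. Qed.

Lemma le_sum_sub G (s t : seq C) : (forall m, 0 <= G m)%E -> uniq s -> uniq t ->
  {subset s <= t} -> (\sum_(m <- s) G m <= \sum_(m <- t) G m)%E.
Proof.
move=> G0 us ut st; rewrite [leRHS](bigID [in s])/=.
have P : perm_eq [seq i <- t | i \in s] s.
  apply: uniq_perm; rewrite ?filter_uniq// => x.
  by rewrite mem_filter andb_idr//; exact: st.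
rewrite -[X in (_ <= X + _)%E]big_filter (perm_big _ P).
by rewrite leeDl// sume_ge0.
Qed.

Lemma le_zsum G (s : seq C) : (forall m, 0 <= G m)%E -> uniq s ->
  (\sum_(m <- s) G m <= zsum G)%E.
Proof.
move=> G0 us; have [N sN] := zfirst_sub s.
apply: le_trans (le_sum_sub G0 us (zfirst_uniq N) sN) _.
rewrite -zsum_partial; apply: nneseries_lim_ge => k _ _; exact: zsum_term_ge0.
Qed.

Lemma zsum_le G (B : \bar R) : (forall m, 0 <= G m)%E ->
  (forall s, uniq s -> (\sum_(m <- s) G m <= B)%E) -> (zsum G <= B)%E.
Proof.
move=> G0 h; rewrite -(cvg_lim _ (zsum_cvg G0))//.
apply: lime_le; first by apply/cvg_ex; exists (zsum G); exact: zsum_cvg.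
by apply: nearW => N; apply: h; exact: zfirst_uniq.
Qed.

Lemma zsum1 G m : (forall m, 0 <= G m)%E -> (forall k, k != m -> G k = 0%E) ->
  zsum G = G m.
Proof.
move=> G0 h; apply/eqP; rewrite eq_le; apply/andP; split; last first.
  by have := le_zsum (s := [:: m]) G0 erefl; rewrite big_seq1.
apply: zsum_le => // s us; case: (boolP (m \in s)) => ms.
  rewrite (bigD1_seq m)//= big1 ?adde0//.
rewrite big1_seq// => k /andP[_ ks]; apply: h; apply: contraNneq ms => <-//.
Qed.

Lemma zsum_fin G (s : seq C) : uniq s -> (forall m, 0 <= G m)%E ->
  (forall m, m \notin s -> G m = 0%E) -> zsum G = (\sum_(m <- s) G m)%E.
Proof.
move=> us G0 Gs; apply/eqP; rewrite eq_le le_zsum// andbT.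
apply: zsum_le => // t ut; rewrite (bigID [in s])/= [X in (_ + X)%E]big1 ?adde0; last first.
  by move=> m; exact: Gs.
rewrite -big_filter; apply: le_sum_sub => //; first by rewrite filter_uniq.
by move=> m; rewrite mem_filter => /andP[].
Qed.

Lemma eq_zsum G G' : G =1 G' -> zsum G = zsum G'.
Proof. by move=> /funext ->. Qed.

(** Cauchy criterion for unconditional summation: once a sum over [zfirst N] is within [e] of the
    total, nothing outside of [zfirst N] can contribute [e] or more. *)
Lemma zsum_tail G : (forall m, 0 <= G m)%E -> (zsum G < +oo)%E ->
  forall e : R, 0 < e -> exists N, forall s, uniq s -> {subset zfirst N <= s} ->
    (\sum_(m <- s | m \notin zfirst N) G m < e%:E)%E.
Proof.
move=> G0 Gf e e0.
have Gfin : zsum G \is a fin_num by rewrite ge0_fin_numE// zsum_ge0.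
have [N hN] : exists N, (zsum G - e%:E < \sum_(m <- zfirst N) G m)%E.
  apply: contrapT => /forallNP h.
  have : (zsum G <= zsum G - e%:E)%E.
    rewrite -[leLHS](cvg_lim _ (zsum_cvg G0))//.
    apply: lime_le; first by apply/cvg_ex; exists (zsum G); exact: zsum_cvg.
    by apply: nearW => N; have /negP := h N; rewrite -leNgt.
  by rewrite -(fineK Gfin) -EFinB lee_fin; apply/negP; rewrite -ltNge ltrBlDr ltrDl.
exists N => s us Ns.
have := le_zsum G0 us; rewrite (bigID [in zfirst N])/=.
have P : perm_eq [seq i <- s | i \in zfirst N] (zfirst N).
  apply: uniq_perm; rewrite ?filter_uniq ?zfirst_uniq// => x.
  by rewrite mem_filter andb_idr//; exact: Ns.
rewrite -[X in (X + _)%E]big_filter (perm_big _ P).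
move: hN; set A := (\sum_(m <- _) _)%E; set B := (\sum_(m <- _ | _) _)%E.
have A0 : (0 <= A)%E by rewrite sume_ge0.
have B0 : (0 <= B)%E by rewrite sume_ge0.
move: A0 B0; rewrite -(fineK Gfin); case: A => [a| |]; case: B => [b| |]//=.
by rewrite -EFinB -EFinD !lte_fin !lee_fin; lra.
Qed.

Context d (T : measurableType d) (mu : {measure set T -> \bar R}).

Lemma integral_zsum (G : C -> T -> \bar R) :
  (forall m, measurable_fun setT (G m)) -> (forall m x, 0 <= G m x)%E ->
  (\int[mu]_x zsum (fun m => G m x) = zsum (fun m => \int[mu]_x G m x))%E.
Proof.
move=> mG G0; rewrite /zsum.
transitivity (\int[mu]_x \sum_(0 <= k <oo) oapp G (fun=> 0%E) (pickle_inv k) x)%E.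
  apply: eq_integral => x _; apply: eq_eseriesr => k _.
  by case: (pickle_inv k).
rewrite integral_nneseries//.
- by apply: eq_eseriesr => k _; case: (pickle_inv k) => //=; rewrite integral0.
- by move=> k; case: (pickle_inv k) => //=; exact: measurable_cst.
- by move=> k x _; case: (pickle_inv k) => //=.
Qed.

End zsum.

Section cubes.
Context {R : realType} {n : nat}.
Implicit Types (x y : n.-tuple R) (m k l : n.-tuple int).

Definition zfloor x : n.-tuple int := [tuple Num.floor (tnth x i) | i < n].

Lemma cube_zfloor x m : cube n (subv x (intv m)) <-> m = zfloor x.
Proof.
split => [h|-> i].
  apply: eq_from_tnth => i; rewrite tnth_mktuple; apply/esym/floor_def.
  by have := h i; rewrite !tnth_mktuple subr_ge0 ltrBlDl intrD.
rewrite !tnth_mktuple subr_ge0 ltrBlDl -[X in _ + X]/(1%:~R) -intrD.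
exact: floor_itv.
Qed.

Lemma addvK x y : addv x (subv y x) = y.
Proof. by apply: eq_from_tnth => i; rewrite !tnth_mktuple addrC subrK. Qed.

Lemma subvK x y : subv (addv x y) x = y.
Proof. by apply: eq_from_tnth => i; rewrite !tnth_mktuple addrAC subrr add0r. Qed.

Definition oppv x : n.-tuple R := [tuple - tnth x i | i < n].

Lemma addv_oppv x y : addv (oppv x) y = subv y x.
Proof. by apply: eq_from_tnth => i; rewrite !tnth_mktuple addrC. Qed.

Lemma integral_subv x (f : n.-tuple R -> \bar R) :
  measurable_fun setT f -> (forall x, 0 <= f x)%E ->
  (\int[leb n]_y f (subv y x) = \int[leb n]_y f y)%E.
Proof.
move=> mf f0; rewrite -(integral_translate (oppv x) mf f0).
by apply: eq_integral => y _; rewrite addv_oppv.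
Qed.

(** The integer translates of the unit cube tile R^n. At a given point only the term of index
    [zfloor x] survives, and each term is then moved back to the cube by translation invariance. *)
Lemma cube_decomp (f : n.-tuple R -> \bar R) :
  measurable_fun setT f -> (forall x, 0 <= f x)%E ->
  (\int[leb n]_x f x = zsum (fun m => \int[torus n]_x f (addv (intv m) x)))%E.
Proof.
move=> mf f0.
pose g m := (fun y => f (addv (intv m) y)) \_ (cube n).
have mfa m : measurable_fun setT (fun y => f (addv (intv m) y)).
  by apply: (measurableT_comp mf); apply: measurable_addvE => //; exact: measurable_cst.
have mc := @measurable_cube R n.
have mg m : measurable_fun setT (g m).
  have [h _] := measurable_restrictT (fun y => f (addv (intv m) y)) mc; apply: h; exact: measurable_funTS (mfa m).
have g0 m y : (0 <= g m y)%E by rewrite /g patchE; case: ifP.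
transitivity (\int[leb n]_x zsum (fun m => g m (subv x (intv m))))%E.
  apply: eq_integral => x _.
  rewrite (zsum1 (m := zfloor x))// => [|k kx].
    rewrite /g patchE mem_set ?addvK//; exact/cube_zfloor.
  by rewrite /g patchE memNset// => /cube_zfloor/eqP; apply/negP.
rewrite integral_zsum//; last first.
  move=> m; apply: (measurableT_comp (mg m)).
  by apply: measurable_subvE => //; exact: measurable_cst.
apply: eq_zsum => m; rewrite integral_subv//.
by rewrite integral_torus// [RHS]integral_mkcond.
Qed.

End cubes.

(** * Density of trigonometric polynomials *)

Section newton_sign.
Context {R : realType}.
Implicit Types y : R.

(* Newton's iteration for the sign: a polynomial map whose iterates tend to
   [Num.sg] on [-1, 1]. It turns superlevel sets of elements of an algebra into
   limits of elements of the algebra. *)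
Definition sgn_step y : R := y * (3 - y ^+ 2) / 2.

Lemma sgn_stepN y : sgn_step (- y) = - sgn_step y.
Proof. by rewrite /sgn_step; field. Qed.

(** The distance to the fixed point 1 is multiplied by (1 - y)(2 + y)/2 = 1 - (y + y^2)/2, which is
    at most 1 - y0/2 above [y0]. As the map does not decrease points of [0, 1], the lower bound [y0]
    persists and the contraction can be iterated. *)
Lemma sgn_step_bounds y0 y : 0 <= y0 -> y0 <= y -> y <= 1 ->
  [/\ y0 <= sgn_step y, sgn_step y <= 1 & 1 - sgn_step y <= (1 - y0 / 2) * (1 - y)].
Proof.
move=> y00 y0y y1.
have E1 : sgn_step y - y = y * ((1 - y) * (1 + y)) / 2 by rewrite /sgn_step; field.
have E2 : 1 - sgn_step y = (1 - y) * ((1 - y) * (2 + y)) / 2 by rewrite /sgn_step; field.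
have P1 : 0 <= y * ((1 - y) * (1 + y)) by rewrite !mulr_ge0//; lra.
have P2 : 0 <= (1 - y) * ((1 - y) * (2 + y)) by rewrite !mulr_ge0//; lra.
have P3 : 0 <= (1 - y) * (2 - y0 - (1 - y) * (2 + y)).
  apply: mulr_ge0; first lra.
  have -> : 2 - y0 - (1 - y) * (2 + y) = y ^+ 2 + (y - y0) by ring.
  by rewrite addr_ge0 ?sqr_ge0 ?subr_ge0.
split; [lra|lra|].
rewrite E2; have -> : (1 - y0 / 2) * (1 - y) =
  ((1 - y) * ((1 - y) * (2 + y)) + (1 - y) * (2 - y0 - (1 - y) * (2 + y))) / 2 by field.
lra.
Qed.

Lemma iter_sgn_stepN m y : iter m sgn_step (- y) = - iter m sgn_step y.
Proof. by elim: m => //= m ->; rewrite sgn_stepN. Qed.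

Lemma iter_sgn_step_bounds m y : 0 <= y -> y <= 1 ->
  [/\ y <= iter m sgn_step y, iter m sgn_step y <= 1 &
    1 - iter m sgn_step y <= (1 - y / 2) ^+ m].
Proof.
move=> y0 y1; elim: m => [|m [h1 h2 h3]] /=; first by rewrite expr0; split => //; lra.
have [H1 H2 H3] := sgn_step_bounds y0 h1 h2; split => //.
by apply: le_trans H3 _; rewrite exprS ler_wpM2l//; lra.
Qed.

Lemma iter_sgn_step_le1 m y : `|y| <= 1 -> `|iter m sgn_step y| <= 1.
Proof.
wlog y0 : y / 0 <= y => [hw|].
  have [|y0] := leP 0 y; first exact: hw.
  by rewrite -normrN -[X in _ -> X <= _]normrN -iter_sgn_stepN; apply: hw; lra.
rewrite ger0_norm// => y1; have [h1 h2 _] := iter_sgn_step_bounds m y0 y1.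
by rewrite ger0_norm// (le_trans y0).
Qed.

Lemma iter_sgn_step_cvg y : `|y| <= 1 -> iter m sgn_step y @[m --> \oo] --> Num.sg y.
Proof.
wlog y0 : y / 0 <= y => [hw y1|].
  have [|y0] := leP 0 y => [y0|]; first exact: hw.
  have -> : (fun m => iter m sgn_step y) = (fun m => - iter m sgn_step (- y)).
    by apply/funext => m; rewrite iter_sgn_stepN opprK.
  rewrite -[Num.sg y]opprK -sgrN; apply: cvgN; apply: hw; rewrite ?normrN//; lra.
rewrite ger0_norm// => y1.
move: y0; rewrite le_eqVlt => /predU1P[<-|y0].
  rewrite sgr0 [X in X @ _](_ : _ = cst 0); first exact: cvg_cst.
  apply/funext => m; have := iter_sgn_stepN m 0; rewrite oppr0 => h /=.
  by apply/eqP; rewrite -eqNr -h.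
rewrite gtr0_sg//.
have g0 : (1 - y / 2) ^+ m @[m --> \oo] --> (0 : R).
  by apply: cvg_expr; rewrite ger0_norm; lra.
have g1 : 1 - (1 - y / 2) ^+ m @[m --> \oo] --> (1 : R).
  by rewrite -[X in _ --> X]subr0; apply: cvgB => //; exact: cvg_cst.
apply: (@squeeze_cvgr _ _ _ _ (fun m => 1 - (1 - y / 2) ^+ m) (cst 1)) => //; last exact: cvg_cst.
apply: nearW => m; have [_ -> h] := iter_sgn_step_bounds m (ltW y0) y1.
by rewrite andbT; lra.
Qed.

End newton_sign.

Lemma cvge0_lt {R : realType} (u : nat -> \bar R) : u n @[n --> \oo] --> 0%E ->
  forall e : R, 0 < e -> exists N, forall n, (N <= n)%N -> (u n < e%:E)%E.
Proof.
move=> /fine_cvgP[[N _ hN] /cvgrPdist_lt h] e e0.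
have [M _ hM] := h _ e0; exists (maxn N M) => n; rewrite geq_max => /andP[Nn Mn].
have := hM n Mn; rewrite /= sub0r normrN => {}hM.
by rewrite -(fineK (hN n Nn)) lte_fin; apply: le_lt_trans hM; exact: ler_norm.
Qed.

(** * Closure of an algebra of bounded functions in a weighted L^2 space *)

Section density.
Context {R : realType} d (T : measurableType d) (mu : {measure set T -> \bar R}).
Context (kap : T -> R) (mkap : measurable_fun setT kap).
Hypothesis kap_fin : (\int[mu]_x (kap x ^+ 2)%:E < +oo)%E.
Context (A : set (T -> R)).
Hypothesis A_meas : forall f, A f -> measurable_fun setT f.
Hypothesis A_bd : forall f, A f -> exists M : R, forall x, `|f x| <= M.
Hypothesis A_cst : forall c, A (fun=> c).
Hypothesis A_lin : forall a f g, A f -> A g -> A (fun x => a * f x + g x).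
Hypothesis A_mul : forall f g, A f -> A g -> A (fun x => f x * g x).
Implicit Types f g : T -> R.

(** The density of the measure is written [kap ^+ 2], so that [wn f] is the squared norm of
    [kap * f] for the original measure and the bounds on [qn] apply. *)
Definition wn f : \bar R := (\int[mu]_x (kap x ^+ 2 * f x ^+ 2)%:E)%E.

(* The bounded part of the closure of [A] in L^2(kap^2 mu). *)
Definition wclosure : set (T -> R) := [set f : T -> R | [/\ measurable_fun setT f,
  exists M : R, forall x, `|f x| <= M &
  forall e : R, 0 < e -> exists2 p, A p & (wn (fun x => f x - p x)%R < e%:E)%E]].

Let emb f x : R[i] := Complex (kap x * f x) 0.

Let wnE f : wn f = qn mu (emb f).
Proof. by apply: eq_integral => x _; rewrite sqc_real exprMn. Qed.

Let memb f : measurable_fun setT f -> Cmeasurable (emb f).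
Proof. by move=> mf; split => /=; [exact: measurable_funM|exact: measurable_cst]. Qed.

Lemma wnD f g : measurable_fun setT f -> measurable_fun setT g ->
  (wn (fun x => (f x + g x)%R) <= 2%:E * wn f + 2%:E * wn g)%E.
Proof.
move=> mf mg; rewrite !wnE; apply: le_trans (qnD2 mu (memb mf) (memb mg)).
by rewrite (@eq_qn _ _ _ _ _ (fun x => emb f x + emb g x))// => x; congr sqc;
   apply: eq_complexP; rewrite ReImE/= ?mulrDr ?addr0.
Qed.

Lemma wnM (M : R) f g : measurable_fun setT f -> measurable_fun setT g ->
  (forall x, `|f x| <= M) ->
  (wn (fun x => (f x * g x)%R) <= (M ^+ 2)%:E * wn g)%E.
Proof.
move=> mf mg fM; rewrite !wnE -qn_scale ?sqr_ge0//; last exact: memb.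
apply: ge0_le_integral => //.
- by move=> x _; rewrite lee_fin sqc_ge0.
- by apply: measurable_esqc; apply: memb; exact: measurable_funM.
- by apply: measurable_funeM; apply: measurable_esqc; exact: memb.
move=> x _; rewrite -EFinM lee_fin !sqc_real !exprMn mulrCA; apply: ler_wpM2r.
  by rewrite mulr_ge0 ?sqr_ge0.
by rewrite -[f x ^+ 2]real_normK ?num_real// lerXn2r ?nnegrE// (le_trans _ (fM x)).
Qed.

Lemma wn_ge0 f : (0 <= wn f)%E.
Proof. by rewrite wnE; exact: qn_ge0. Qed.

Lemma wclosure_sub f : A f -> wclosure f.
Proof.
move=> Af; split; [exact: A_meas|exact: A_bd|move=> e e0; exists f => //].
by rewrite /wn integral0_eq ?lte_fin// => x _; rewrite subrr expr0n mulr0.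
Qed.

Lemma wclosure_lin a f g : wclosure f -> wclosure g ->
  wclosure (fun x => a * f x + g x).
Proof.
move=> [mf [M fM] hf] [mg [N gN] hg]; split.
- by apply: measurable_funD => //; apply: measurable_funM => //; exact: measurable_cst.
- exists (`|a| * M + N) => x; apply: le_trans (ler_normD _ _) _.
  by rewrite normrM lerD// ler_wpM2l.
(* Any positive number above [a ^+ 2] would do: the error on [f] is multiplied by [a ^+ 2]. *)
move=> e e0; pose b := a ^+ 2 + 1.
have b0 : 0 < b by rewrite ltr_pwDr ?sqr_ge0.
have [p Ap fp] := hf (e / (4 * b)) (divr_gt0 e0 (mulr_gt0 (ltr0Sn _ 3) b0)).
have [q Aq gq] := hg (e / 4) (divr_gt0 e0 (ltr0Sn _ 3)).
exists (fun x => a * p x + q x); first exact: A_lin.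
have mp := A_meas Ap; have mq := A_meas Aq.
rewrite (_ : (fun x => _) = (fun x => a * (f x - p x) + (g x - q x))); last first.
  by apply/funext => x; ring.
have mfp : measurable_fun setT (fun x => f x - p x) by exact: measurable_funB.
have mgq : measurable_fun setT (fun x => g x - q x) by exact: measurable_funB.
have mafp : measurable_fun setT (fun x => a * (f x - p x)).
  by apply: measurable_funM => //; exact: measurable_cst.
apply: le_lt_trans (wnD mafp mgq) _.
have := @wnM `|a| (cst a) _ (@measurable_cst _ _ _ _ _ _) mfp (fun=> lexx _).
rewrite real_normK ?num_real//.
move: (wn_ge0 (fun x => f x - p x)) (wn_ge0 (fun x => g x - q x)) (wn_ge0 (fun x => a * (f x - p x))) fp gq.
set X := wn _; set Y := wn _; set Z := wn _; move: X Y Z => [x| |] [y| |] [z| |]//.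
rewrite -!EFinM -EFinD !lee_fin !lte_fin => x0 y0 z0 xe ye h.
have : x * b < e / 4.
  by move: xe; rewrite invfM mulrA ltr_pdivlMr.
rewrite /b; move: h; nra.
Qed.

(** From fg - pq = f (g - q) + q (f - p): first [q] is chosen using the bound of [f], and only then
    [p], whose precision depends on the bound of [q]. Boundedness is part of [wclosure] for the sake
    of this step. *)
Lemma wclosure_mul f g : wclosure f -> wclosure g -> wclosure (fun x => f x * g x).
Proof.
move=> [mf [M fM] hf] [mg [N gN] hg]; split.
- exact: measurable_funM.
- by exists (M * N) => x; rewrite normrM ler_pM.
move=> e e0; pose b := M ^+ 2 + 1.
have b0 : 0 < b by rewrite ltr_pwDr ?sqr_ge0.
have [q Aq gq] := hg (e / (4 * b)) (divr_gt0 e0 (mulr_gt0 (ltr0Sn _ 3) b0)).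
have [K qK] := A_bd Aq; pose c := K ^+ 2 + 1.
have c0 : 0 < c by rewrite ltr_pwDr ?sqr_ge0.
have [p Ap fp] := hf (e / (4 * c)) (divr_gt0 e0 (mulr_gt0 (ltr0Sn _ 3) c0)).
exists (fun x => p x * q x); first exact: A_mul.
have mp := A_meas Ap; have mq := A_meas Aq.
rewrite (_ : (fun x => _) = (fun x => f x * (g x - q x) + q x * (f x - p x))); last first.
  by apply/funext => x; ring.
have mfp : measurable_fun setT (fun x => f x - p x) by exact: measurable_funB.
have mgq : measurable_fun setT (fun x => g x - q x) by exact: measurable_funB.
have m1 : measurable_fun setT (fun x => f x * (g x - q x)) by exact: measurable_funM.
have m2 : measurable_fun setT (fun x => q x * (f x - p x)) by exact: measurable_funM.
apply: le_lt_trans (wnD m1 m2) _.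
have := wnM mf mgq fM; have := wnM mq mfp qK.
move: (wn_ge0 (fun x => f x - p x)) (wn_ge0 (fun x => g x - q x)) fp gq.
move: (wn_ge0 (fun x => f x * (g x - q x))) (wn_ge0 (fun x => q x * (f x - p x))).
set X := wn (fun x => f x - p x); set Y := wn (fun x => g x - q x).
set Z := wn _; set Z' := wn _; move: X Y Z Z' => [x| |] [y| |] [z| |] [z'| |]//.
rewrite -!EFinM -EFinD !lee_fin !lte_fin => z0 z'0 x0 y0 xe ye h1 h2.
have : x * c < e / 4 by move: xe; rewrite invfM mulrA ltr_pdivlMr.
have : y * b < e / 4 by move: ye; rewrite invfM mulrA ltr_pdivlMr.
rewrite /b /c; move: h1 h2; lra.
Qed.

Lemma wclosure_ae f g : measurable_fun setT g -> (exists M : R, forall x, `|g x| <= M) ->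
  f = g %[ae mu] -> wclosure f -> wclosure g.
Proof.
move=> mg gM fg [mf _ hf]; split => // e /hf[p Ap fp]; exists p => //.
have mp := A_meas Ap.
have mm (h : T -> R) : measurable_fun setT h -> measurable_fun setT (fun x => (kap x ^+ 2 * (h x - p x) ^+ 2)%:E).
  by move=> mh; apply/measurable_EFinP; apply: measurable_funM; apply: measurable_funX => //; exact: measurable_funB.
rewrite (_ : wn _ = wn (fun x => f x - p x))//; apply: ge0_ae_eq_integral => //.
- exact: mm.
- exact: mm.
- by move=> x _; rewrite lee_fin mulr_ge0 ?sqr_ge0.
- by move=> x _; rewrite lee_fin mulr_ge0 ?sqr_ge0.
- by apply: filterS fg => x h _; rewrite h.
Qed.

(** Dominated convergence: the squared differences are at most 4 M^2, and [kap ^+ 2] has finite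
    integral. *)
Lemma wclosure_lim (M : R) (u : nat -> T -> R) g : (forall m, wclosure (u m)) ->
  (forall m x, `|u m x| <= M) -> (forall x, u m x @[m --> \oo] --> g x) -> wclosure g.
Proof.
move=> Wu uM ug.
have mu_ m : measurable_fun setT (u m) by case: (Wu m).
have mg : measurable_fun setT g.
  by apply: (measurable_fun_cvg (h := u)) => // x _; exact: ug.
have gM x : `|g x| <= M.
  have := ug x => /cvg_norm h; rewrite -(cvg_lim _ h)//; apply: limr_le.
    by apply/cvg_ex; eexists; exact: h.
  exact: nearW.
split => //; first by exists M.
have mB m : measurable_fun setT (fun x => g x - u m x) by exact: measurable_funB.
have mF m : measurable_fun setT (fun x => (kap x ^+ 2 * (g x - u m x) ^+ 2)%:E).
  by apply/measurable_EFinP; apply: measurable_funM; exact: measurable_funX.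
have h : (wn (fun x => g x - u m x)%R)%E @[m --> \oo] --> (\int[mu]_x (cst 0%E x))%E.
  apply: (@dominated_cvg _ _ _ mu setT measurableT _ _
    (fun x => (4 * M ^+ 2)%:E * (kap x ^+ 2)%:E)%E) => //.
  - move=> x _; apply/fine_cvgP; split; first exact: nearW.
    rewrite -[X in _ --> X](mulr0 (kap x ^+ 2)); apply: cvgM; first exact: cvg_cst.
    rewrite -[X in _ --> X](expr0n _ 2) -(subrr (g x)) !expr2 /=.
    by apply: cvgM; apply: cvgB => //; exact: cvg_cst.
  - apply: integrableZl => //; apply/integrableP; split.
      by apply/measurable_EFinP; exact: measurable_funX.
    by under eq_integral do rewrite gee0_abs ?lee_fin ?sqr_ge0//.
  - move=> m x _; rewrite gee0_abs ?lee_fin ?(mulr_ge0 (sqr_ge0 _) (sqr_ge0 _))//.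
    rewrite mulrC ler_wpM2r ?sqr_ge0//.
    rewrite -[_ ^+ 2]real_normK ?num_real// (_ : 4 * M ^+ 2 = (2 * M) ^+ 2); last by ring.
    have M0 : 0 <= M by rewrite (le_trans _ (gM x)).
    rewrite lerXn2r ?nnegrE ?mulr_ge0//; apply: le_trans (ler_normB _ _) _.
    by rewrite mulr_natl mulr2n lerD.
rewrite integral0 in h => e e0.
have [N hN] := cvge0_lt h (divr_gt0 e0 (ltr0Sn _ 3)).
have [mu_N _ /(_ _ (divr_gt0 e0 (ltr0Sn _ 3)))[p Ap up]] := Wu N.
exists p => //; have mp := A_meas Ap.
rewrite (_ : (fun x => _) = (fun x => (g x - u N x) + (u N x - p x))); last first.
  by apply/funext => x; ring.
exact: (lte_quarters (wn_ge0 _) (wn_ge0 _) (wnD (mB N) (measurable_funB mu_N mp)) (hN N (leqnn N))).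
Qed.

Lemma wclosure_cst c : wclosure (fun=> c).
Proof. exact: wclosure_sub. Qed.

Lemma wclosure_iter_sgn_step m f : wclosure f -> wclosure (fun x => iter m sgn_step (f x)).
Proof.
move=> Wf; elim: m => //= m ih.
rewrite (_ : (fun x => _) = (fun x => (3 / 2) * iter m sgn_step (f x) + ((- 2^-1) *
  (iter m sgn_step (f x) * (iter m sgn_step (f x) * iter m sgn_step (f x))) + 0))).
  by apply: wclosure_lin => //; apply: wclosure_lin; [do 2 apply: wclosure_mul => //|exact: wclosure_cst].
by apply/funext => x; rewrite /sgn_step; field.
Qed.

Lemma wclosure_sgr f : wclosure f -> (forall x, `|f x| <= 1) -> wclosure (fun x => Num.sg (f x)).
Proof.
move=> Wf f1; apply: (@wclosure_lim 1 (fun m x => iter m sgn_step (f x))).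
- by move=> m; exact: wclosure_iter_sgn_step.
- by move=> m x; exact: iter_sgn_step_le1.
- by move=> x; exact: iter_sgn_step_cvg.
Qed.

Lemma wclosure_superlevel f t : wclosure f -> wclosure (\1_[set x | t < f x] : T -> R).
Proof.
move=> Wf; have [mf [M fM] _] := Wf.
(* Dividing [f - t] by [N] brings it into [-1, 1], where the iteration converges. The maximum with 0
   covers a negative [M], possible when the type is empty. *)
pose N := Num.max M 0 + `|t| + 1.
have N0 : 0 < N by rewrite ltr_wpDl// addr_ge0// le_max lexx orbT.
pose s x := N^-1 * f x + - (N^-1 * t).
have Ws : wclosure s by apply: wclosure_lin => //; exact: wclosure_cst.
have sE x : s x = N^-1 * (f x - t) by rewrite /s mulrBr.
have s1 x : `|s x| <= 1.
  rewrite sE normrM gtr0_norm ?invr_gt0// ler_pdivrMl// mulr1.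
  apply: le_trans (ler_normB _ _) _; rewrite /N.
  have : M <= Num.max M 0 by rewrite le_max lexx.
  by have := fM x; lra.
have Wg := wclosure_sgr Ws s1.
(* The polynomial (v + v^2)/2 takes the values 1, 0, 0 at v = 1, 0, -1. *)
rewrite (_ : \1__ = (fun x => 2^-1 * Num.sg (s x) + (2^-1 * (Num.sg (s x) * Num.sg (s x)) + 0))).
  by apply: wclosure_lin => //; apply: wclosure_lin; [exact: wclosure_mul|exact: wclosure_cst].
apply/funext => x; rewrite indicE sE sgrM gtr0_sg ?invr_gt0// mul1r.
have [tf|ft|->] := ltgtP t (f x).
- by rewrite mem_set//= gtr0_sg ?subr_gt0//; field.
- rewrite memNset/=; last by rewrite ltNge (ltW ft).
  by rewrite ltr0_sg ?subr_lt0//; field.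
- by rewrite memNset/= ?ltxx// subrr sgr0; field.
Qed.

Definition wsets : set (set T) := [set E | measurable E /\ wclosure (\1_E : T -> R)].

Lemma wsetsC E : wsets E -> wsets (~` E).
Proof.
move=> [mE WE]; split; first exact: measurableC.
rewrite (_ : \1__ = (fun x => (-1) * \1_E x + 1)).
  by apply: wclosure_lin => //; exact: wclosure_cst.
by apply/funext => x; rewrite !indicE in_setC; case: (x \in E) => /=; ring.
Qed.

(** For a countable union, the indicator of the complement is the limit of the finite products of
    the functions 1 - 1_F. These are bounded by 1, so closure under products and under bounded
    limits applies. *)
Lemma wsets_sigma_algebra : sigma_algebra setT wsets.
Proof.
split.
- split; first exact: measurable0.
  rewrite (_ : \1__ = (fun=> 0)); first exact: wclosure_cst.
  by apply/funext => x; rewrite indicE in_set0.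
- by move=> E; rewrite setTD; exact: wsetsC.
move=> F WF; split; first by apply: bigcup_measurable => k _; case: (WF k).
pose p m x : R := \prod_(i < m) (1 - \1_(F i) x).
have pE m x : p m x = (~~ [exists i : 'I_m, x \in F i])%:R.
  rewrite /p; case: existsP => [[i xi]|h].
    by rewrite (bigD1 i)//= indicE xi subrr mul0r.
  rewrite big1// => i _; rewrite indicE; case: (boolP (x \in F i)) => [xi|]; last by rewrite subr0.
  by exfalso; apply: h; exists i.
have Wp m : wclosure (p m).
  elim: m => [|m ih].
    by rewrite (_ : p 0%N = fun=> 1); [exact: wclosure_cst|apply/funext => x; rewrite /p big_ord0].
  rewrite (_ : p m.+1 = (fun x => p m x * ((-1) * \1_(F m) x + 1))).
    apply: wclosure_mul => //; apply: wclosure_lin; [by case: (WF m)|exact: wclosure_cst].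
  by apply/funext => x; rewrite /p big_ord_recr/=; congr (_ * _); ring.
rewrite (_ : \1__ = (fun x => (-1) * \1_(~` \bigcup_k F k) x + 1)); last first.
  by apply/funext => x; rewrite !indicE in_setC; case: (x \in \bigcup_k F k) => /=; ring.
apply: wclosure_lin; last exact: wclosure_cst.
apply: (@wclosure_lim 1 p) => //.
  by move=> m x; rewrite pE; case: (~~ _); rewrite ?normr1 ?normr0.
move=> x; rewrite indicE in_setC.
have [/set_mem [i _ Fix]|nx] := boolP (x \in \bigcup_k F k).
  apply: (cvg_trans (near_eq_cvg (f := cst 0) _)); last exact: cvg_cst.
  exists i.+1 => // m /= im; rewrite pE; case: existsP => // h; exfalso; apply: h.
  by exists (Ordinal im); rewrite mem_set.
rewrite [X in X @ _](_ : _ = cst 1); first exact: cvg_cst.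
apply/funext => m; rewrite pE; case: existsP => // -[i /set_mem Fix].
by exfalso; move/negP: nx; apply; rewrite mem_set//; exists i.
Qed.

(** Generation is used twice: half-lines generate the Borel sets of R, and preimages of these by the
    coordinates generate the sigma-algebra of R^n. *)
Lemma wsets_tuple n (phi : T -> n.-tuple R) : measurable_fun setT phi ->
  (forall i a, wsets (phi @^-1` [set y | a < tnth y i])) ->
  forall B, measurable B -> wsets (phi @^-1` B).
Proof.
move=> mphi h.
have sC := wsets_sigma_algebra.
have coord i (B : set R) : measurable B -> wsets (phi @^-1` ((@tnth n R)^~ i @^-1` B)).
  suff H : @measurable _ (measurableTypeR R) `<=`
      [set B | wsets (phi @^-1` ((@tnth n R)^~ i @^-1` B))] by move=> /H.
  rewrite -[X in X `<=` _]/(measurable) RGenOInfty.measurableE.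
  apply: smallest_sub; last by move=> _ [a ->]; have := h i a; congr wsets; apply/seteqP; split => x /=; rewrite in_itv/= andbT.
  split.
  - by rewrite /= !preimage_set0; case: sC.
  - by move=> B0 /= W; rewrite setTD; exact: wsetsC W.
  - by move=> F /= WF; case: sC => _ _ /(_ _ WF); rewrite /= !preimage_bigcup.
suff H : g_sigma_preimage (fun i (x : n.-tuple R) => tnth x i) `<=`
    [set B | wsets (phi @^-1` B)] by move=> B /H.
apply: smallest_sub.
  split.
  - by rewrite /= preimage_set0; case: sC.
  - by move=> B0 /= W; rewrite setTD; exact: wsetsC W.
  - by move=> F /= WF; case: sC => _ _ /(_ _ WF); rewrite /= preimage_bigcup.
move=> B; rewrite -bigcup_seq => -[i /= _ [C mC <-]]; rewrite /= setTI.
exact: coord.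
Qed.

End density.

Section arcs.
Context {R : realType}.

Lemma ltr_cos0pi (u v : R) : 0 <= u <= pi -> 0 <= v <= pi ->
  (cos u < cos v) = (v < u).
Proof. by move=> hu hv; rewrite ltr_cos// in_itv. Qed.

(* Intervals of the circle are superlevel sets of trigonometric polynomials of
   degree one. *)
Lemma cos_arc (a x : R) : 0 <= a < 1 -> 0 <= x < 1 ->
  (cos (pi * (1 - a)) < cos (2 * pi * x + - (pi * (a + 1)))) = (a < x).
Proof.
move=> /andP[a0 a1] /andP[x0 x1]; have p0 := pi_gt0 R.
have pa : 0 <= pi * a by rewrite mulr_ge0// ltW.
have pa1 : 0 < pi * (1 - a) by rewrite mulr_gt0// subr_gt0.
have px1 : 0 < pi * (1 - x) by rewrite mulr_gt0// subr_gt0.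
have px : 0 <= pi * x by rewrite mulr_ge0// ltW.
have [ax|xa] := ltP a x.
  have pax : 0 < pi * (x - a) by rewrite mulr_gt0// subr_gt0.
  set u := 2 * pi * x + _.
  have -> : cos u = cos `|u|.
    by have [|] := leP 0 u => h; [rewrite ger0_norm|rewrite ltr0_norm// cosN].
  rewrite ltr_cos0pi ?normr_ge0/=.
  - by rewrite /u ltr_norml; apply/andP; split; lra.
  - by apply/andP; split; lra.
  - by rewrite /u ler_norml; apply/andP; split; lra.
apply/negbTE; rewrite -leNgt.
have pax : 0 <= pi * (a - x) by rewrite mulr_ge0 ?subr_ge0// ltW.
(* Here [- u] lies between [pi * (1 - a)] and [2 * pi]. Beyond [pi], where the cosine is no longer
   decreasing, it is replaced by [u + pi *+ 2], which has the same cosine and lies between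
   [pi * (1 - a)] and [pi]. *)
set u := 2 * pi * x + _; rewrite -(cosN u).
have [h|h] := leP (- u) pi.
  rewrite leNgt ltr_cos0pi -?leNgt.
  - by rewrite /u; lra.
  - by move: h; rewrite /u => h; apply/andP; split; lra.
  - by move: h; rewrite /u => h; apply/andP; split; lra.
have -> : cos (- u) = cos (u + pi *+ 2) by rewrite cosD2pi cosN.
rewrite leNgt ltr_cos0pi -?leNgt.
- by rewrite /u mulr2n; lra.
- by move: h; rewrite /u mulr2n => h; apply/andP; split; lra.
- by move: h; rewrite /u mulr2n => h; apply/andP; split; lra.
Qed.

End arcs.

(** * Trigonometric polynomials *)

Section trig.
Context {R : realType} d (T : measurableType d) (P : set (T -> R)).
Implicit Types (f g : T -> R[i]) (p q : T -> R).

(** [P] is a set of real phases, so that one development serves T^n and T^n x T^n. The inductive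
    form lets a multiplier property be proved for the exponentials and then carried to linear
    combinations. *)
Inductive trig : (T -> R[i]) -> Prop :=
| trig_expi p : P p -> trig (fun x => expi (p x))
| trig0 : trig (fun=> 0)
| trig_lin a f g : trig f -> trig g -> trig (fun x => a * f x + g x).

Definition rtrig : set (T -> R) := [set p | trig (fun x => Complex (p x) 0)].

Hypothesis P0 : P (fun=> 0).
Hypothesis PD : forall p q, P p -> P q -> P (fun x => p x + q x).
Hypothesis PN : forall p, P p -> P (fun x => - p x).
Hypothesis Pm : forall p, P p -> measurable_fun setT p.

Lemma trigZ a f : trig f -> trig (fun x => a * f x).
Proof.
move=> tf; rewrite (_ : (fun x => _) = (fun x => a * f x + 0)); last first.
  by apply/funext => x; rewrite addr0.
exact: trig_lin tf trig0.
Qed.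

Lemma trig_cst a : trig (fun=> a).
Proof.
rewrite (_ : (fun=> a) = (fun x => a * expi ((fun=> 0) x))); last first.
  by apply/funext => x; rewrite expi0 mulr1.
exact/trigZ/trig_expi.
Qed.

Lemma trigM f g : trig f -> trig g -> trig (fun x => f x * g x).
Proof.
elim=> [p Pp| |a f1 f2 tf1 ih1 tf2 ih2] tg.
- elim: tg => [q Pq| |a g1 g2 _ ih1 _ ih2].
  + rewrite (_ : (fun x => _) = (fun x => expi (p x + q x))).
      exact/trig_expi/PD.
    by apply/funext => x; rewrite expiD.
  + rewrite (_ : (fun x => _) = (fun=> 0)); first exact: trig0.
    by apply/funext => x; rewrite mulr0.
  + rewrite (_ : (fun x => _) = (fun x => a * (expi (p x) * g1 x) + expi (p x) * g2 x)).
      exact: trig_lin.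
    by apply/funext => x; ring.
- rewrite (_ : (fun x => _) = (fun=> 0)); first exact: trig0.
  by apply/funext => x; rewrite mul0r.
- rewrite (_ : (fun x => _) = (fun x => a * (f1 x * g x) + f2 x * g x)).
    by apply: trig_lin; [exact: ih1|exact: ih2].
  by apply/funext => x; ring.
Qed.

Lemma trig_measurable f : trig f -> Cmeasurable f.
Proof.
elim=> [p Pp| |a f1 f2 tf1 ih1 tf2 ih2].
- exact/Cmeasurable_expi/Pm.
- exact: Cmeasurable_cst.
- exact: Cmeasurable_lin.
Qed.

Lemma trig_bounded f : trig f -> exists M : R, forall x, sqc (f x) <= M.
Proof.
elim=> [p Pp| |a f1 f2 _ [M1 h1] _ [M2 h2]].
- by exists 1 => x; rewrite sqc_expi.
- by exists 0 => x; rewrite sqc0.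
- exists (2 * (sqc a * M1) + 2 * M2) => x; apply: le_trans (sqcD2 _ _) _.
  by rewrite lerD// ler_wpM2l// sqcM ler_wpM2l ?sqc_ge0.
Qed.

Lemma rtrig_measurable p : rtrig p -> measurable_fun setT p.
Proof. by move=> /trig_measurable[]. Qed.

Lemma rtrig_bounded p : rtrig p -> exists M : R, forall x, `|p x| <= M.
Proof.
move=> /trig_bounded[M hM]; exists (M + 1) => x; have := hM x.
rewrite sqc_real -real_normK ?num_real// => h.
have := sqr_ge0 (`|p x| - 1); rewrite sqrrB1; have := normr_ge0 (p x).
by move: (`|p x|) h => y h y0; nra.
Qed.

Lemma rtrig_cst c : rtrig (fun=> c).
Proof. exact: trig_cst. Qed.

Lemma rtrig_lin a p q : rtrig p -> rtrig q -> rtrig (fun x => a * p x + q x).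
Proof.
move=> tp tq; rewrite /rtrig/=.
rewrite (_ : (fun x => _) = (fun x => Complex a 0 * Complex (p x) 0 + Complex (q x) 0)).
  exact: trig_lin.
by apply/funext => x; apply: eq_complexP; rewrite !ReImE/=; ring.
Qed.

Lemma rtrigM p q : rtrig p -> rtrig q -> rtrig (fun x => p x * q x).
Proof.
move=> tp tq; rewrite /rtrig/=.
rewrite (_ : (fun x => _) = (fun x => Complex (p x) 0 * Complex (q x) 0)).
  exact: trigM.
by apply/funext => x; apply: eq_complexP; rewrite !ReImE/=; ring.
Qed.

Lemma rtrig_cos p c : P p -> rtrig (fun x => cos (p x + c)).
Proof.
move=> Pp; rewrite /rtrig/=.
rewrite (_ : (fun x => _) = (fun x => (Complex 2^-1 0 * expi c) * expi (p x) +
     (Complex 2^-1 0 * expi (- c)) * expi (- p x))).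
  apply: trig_lin; first exact: trig_expi.
  by apply: trigZ; apply: trig_expi; exact: PN.
by apply/funext => x; apply: eq_complexP; rewrite !ReImE/= ?cosN ?sinN ?cosD; field.
Qed.

Context (mu : {measure set T -> \bar R}) (kap : T -> R).
Hypothesis mkap : measurable_fun setT kap.
Hypothesis kap_fin : (\int[mu]_x (kap x ^+ 2)%:E < +oo)%E.

Local Notation wcl := (wclosure mu kap rtrig).
Local Notation wst := (wsets mu kap rtrig).

(** It suffices to treat the sets where a coordinate exceeds [a]. Almost everywhere the coordinate
    is in [0, 1), so for [a < 0] the set has null complement and for [1 <= a] it is null; in between
    it is an arc, that is, a superlevel set of a cosine. *)
Lemma wsets_trig_coord n (phi : T -> n.-tuple R) : measurable_fun setT phi ->
  {ae mu, forall x, cube n (phi x)} ->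
  (forall i, P (fun x => 2 * pi * tnth (phi x) i)) ->
  forall B, measurable B -> wst (phi @^-1` B).
Proof.
move=> mphi cphi Pphi; apply: (wsets_tuple mkap kap_fin rtrig_measurable rtrig_bounded rtrig_cst rtrig_lin rtrigM) => //.
move=> i a.
have mE : measurable (phi @^-1` [set y | a < tnth y i]).
  rewrite -[X in measurable X]setTI; apply: mphi => //.
  rewrite (_ : [set y | _] = (@tnth n R)^~ i @^-1` `]a, +oo[%classic).
    by rewrite -[X in measurable X]setTI; exact: measurable_tnth.
  by apply/seteqP; split => y /=; rewrite in_itv/= andbT.
split => //.
have bd E : exists M : R, forall x : T, `|\1_E x| <= M :> R.
  by exists 1 => x; rewrite indicE; case: (x \in E); rewrite ?normr1 ?normr0.
have mI : measurable_fun setT (\1_(phi @^-1` [set y | a < tnth y i]) : T -> R).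
  exact: measurable_indic.
have wc c : wcl (fun=> c).
  exact: (wclosure_sub mu kap rtrig_measurable rtrig_bounded (rtrig_cst c)).
have [a0|a0] := ltP a 0.
  apply: (@wclosure_ae _ _ _ _ _ mkap _ rtrig_measurable (fun=> 1)) => //.
  apply: filterS cphi => x /(_ i) /andP[x0 _] _; rewrite indicE mem_set//=.
  exact: lt_le_trans x0.
have [a1|a1] := leP 1 a.
  apply: (@wclosure_ae _ _ _ _ _ mkap _ rtrig_measurable (fun=> 0)) => //.
  apply: filterS cphi => x /(_ i) /andP[_ x1] _; rewrite indicE memNset//=.
  by apply/negP; rewrite -leNgt (le_trans (ltW x1)).
pose f x := cos (2 * pi * tnth (phi x) i + - (pi * (a + 1))).
have rf : rtrig f by exact: rtrig_cos.
apply: (@wclosure_ae _ _ _ _ _ mkap _ rtrig_measurable (\1_[set x | cos (pi * (1 - a)) < f x])) => //.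
- apply: filterS cphi => x /(_ i) xi _; rewrite !indicE; congr ((_ : bool)%:R).
  have E : (cos (pi * (1 - a)) < f x) = (a < tnth (phi x) i) by rewrite /f cos_arc ?a0.
  by apply/idP/idP => /set_mem/= h; rewrite mem_set//= ?E// -E.
- apply: (wclosure_superlevel mkap kap_fin rtrig_measurable rtrig_bounded rtrig_cst rtrig_lin rtrigM).
  exact: (wclosure_sub mu kap rtrig_measurable rtrig_bounded).
Qed.

End trig.

(** * Parseval and Plancherel *)

Section Cintegral.
Context {R : realType} d (T : measurableType d) (mu : {measure set T -> \bar R}).
Implicit Types (f g : T -> R[i]).

Definition nrm1 f : \bar R := (\int[mu]_x (Normc.normc (f x))%:E)%E.

Definition Cintegrable f := Cmeasurable f /\ (nrm1 f < +oo)%E.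

Lemma normc_ge0 (z : R[i]) : 0 <= Normc.normc z.
Proof. by case: z => a b /=; rewrite sqrtr_ge0. Qed.

Lemma normcE (z : R[i]) : Normc.normc z = Num.sqrt (sqc z).
Proof. by case: z. Qed.

Lemma normcD_le (z w : R[i]) : Normc.normc (z + w) <= Normc.normc z + Normc.normc w.
Proof. exact: (@le_normcD R). Qed.

Lemma normr_Re_le (z : R[i]) : `|complex.Re z| <= Normc.normc z.
Proof.
rewrite -(@ler_sqr R) ?nnegrE ?normc_ge0// real_normK ?num_real// sqcE.
by rewrite lerDl sqr_ge0.
Qed.

Lemma normr_Im_le (z : R[i]) : `|complex.Im z| <= Normc.normc z.
Proof.
rewrite -(@ler_sqr R) ?nnegrE ?normc_ge0// real_normK ?num_real// sqcE.
by rewrite lerDr sqr_ge0.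
Qed.

Lemma measurable_normc f : Cmeasurable f ->
  measurable_fun setT (fun x => Normc.normc (f x)).
Proof.
move=> mf; under eq_fun do rewrite normcE.
apply: (measurableT_comp (f := @Num.sqrt R)); last exact: measurable_sqc.
by apply: continuous_measurable_fun; exact: sqrt_continuous.
Qed.

Lemma measurable_enormc f : Cmeasurable f ->
  measurable_fun setT (fun x => (Normc.normc (f x))%:E).
Proof. by move=> /measurable_normc/measurable_EFinP. Qed.

Lemma nrm1_ge0 f : (0 <= nrm1 f)%E.
Proof. by apply: integral_ge0 => x _; rewrite lee_fin normc_ge0. Qed.

Lemma CLnorm1E f : CLnorm mu 1%:E f = nrm1 f.
Proof. by rewrite /CLnorm Lnorm1; apply: eq_integral => x _; rewrite gee0_abs// lee_fin normc_ge0. Qed.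

Lemma LpC1P f : LpC mu 1%:E f <-> Cintegrable f.
Proof. by rewrite /LpC/= CLnorm1E. Qed.

Lemma CintegrableD f g : Cintegrable f -> Cintegrable g ->
  Cintegrable (fun x => f x + g x).
Proof.
move=> [mf f1] [mg g1]; split; first exact: CmeasurableD.
apply: (@le_lt_trans _ _ (nrm1 f + nrm1 g)%E); last exact: lte_add_pinfty.
rewrite /nrm1 -ge0_integralD//.
- apply: ge0_le_integral => //.
  + by move=> x _; rewrite lee_fin normc_ge0.
  + by apply: measurable_enormc; exact: CmeasurableD.
  + by apply: emeasurable_funD; exact: measurable_enormc.
  + by move=> x _; rewrite -EFinD lee_fin normcD_le.
- by move=> x _; rewrite lee_fin normc_ge0.
- exact: measurable_enormc.
- by move=> x _; rewrite lee_fin normc_ge0.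
- exact: measurable_enormc.
Qed.

Lemma CintegrableMb (M : R) f g : Cintegrable f -> Cmeasurable g ->
  (forall x, Normc.normc (g x) <= M) -> Cintegrable (fun x => f x * g x).
Proof.
move=> [mf f1] mg gM; split; first exact: CmeasurableM.
apply: (@le_lt_trans _ _ (`|M|%:E * nrm1 f)%E); last by rewrite lte_mul_pinfty.
rewrite /nrm1 -ge0_integralZl_EFin//; last 2 first.
- by move=> x _; rewrite lee_fin normc_ge0.
- exact: measurable_enormc.
apply: ge0_le_integral => //.
- by move=> x _; rewrite lee_fin normc_ge0.
- by apply: measurable_enormc; exact: CmeasurableM.
- by apply: measurable_funeM; exact: measurable_enormc.
- move=> x _; rewrite -EFinM lee_fin Normc.normcM mulrC ler_wpM2r ?normc_ge0//.
  exact: le_trans (gM x) (ler_norm _).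
Qed.

Lemma CintegrableZ (a : R[i]) f : Cintegrable f -> Cintegrable (fun x => a * f x).
Proof.
move=> f1; rewrite (_ : (fun x => _) = (fun x => f x * a)); last first.
  by apply/funext => x; rewrite mulrC.
by apply: (CintegrableMb (M := Normc.normc a)) => //; exact: Cmeasurable_cst.
Qed.

Lemma CintegrableN f : Cintegrable f -> Cintegrable (fun x => - f x).
Proof.
move=> f1; rewrite (_ : (fun x => _) = (fun x => -1 * f x)); first exact: CintegrableZ.
by apply/funext => x; rewrite mulN1r.
Qed.

Lemma Cintegrable_Re f : Cintegrable f -> mu.-integrable setT (EFin \o (fun x => complex.Re (f x))).
Proof.
move=> [[mf1 mf2] f1]; apply/integrableP; split; first exact/measurable_EFinP.
apply: le_lt_trans f1; apply: ge0_le_integral => //.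
- by apply: measurableT_comp => //; exact/measurable_EFinP.
- exact: measurable_enormc.
- by move=> x _; rewrite lee_fin normr_Re_le.
Qed.

Lemma Cintegrable_Im f : Cintegrable f -> mu.-integrable setT (EFin \o (fun x => complex.Im (f x))).
Proof.
move=> [[mf1 mf2] f1]; apply/integrableP; split; first exact/measurable_EFinP.
apply: le_lt_trans f1; apply: ge0_le_integral => //.
- by apply: measurableT_comp => //; exact/measurable_EFinP.
- exact: measurable_enormc.
- by move=> x _; rewrite lee_fin normr_Im_le.
Qed.

Lemma Rintegral_lin2 (a b : R) (f g : T -> R) :
  mu.-integrable setT (EFin \o f) -> mu.-integrable setT (EFin \o g) ->
  Rintegral mu setT (fun x => a * f x + b * g x) =
  a * Rintegral mu setT f + b * Rintegral mu setT g.
Proof.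
move=> fi gi; rewrite RintegralD//; last 2 first.
- by have := integrableZl measurableT a fi; apply: eq_integrable.
- by have := integrableZl measurableT b gi; apply: eq_integrable.
by rewrite !RintegralZl.
Qed.

Lemma CintegralD f g : Cintegrable f -> Cintegrable g ->
  Cintegral mu (fun x => f x + g x) = Cintegral mu f + Cintegral mu g.
Proof.
move=> f1 g1; apply: eq_complexP; rewrite !ReImE/=.
  under eq_Rintegral do rewrite ReImE.
  by rewrite RintegralD//; exact: Cintegrable_Re.
under eq_Rintegral do rewrite ReImE.
by rewrite RintegralD//; exact: Cintegrable_Im.
Qed.

Lemma CintegralZ (a : R[i]) f : Cintegrable f ->
  Cintegral mu (fun x => a * f x) = a * Cintegral mu f.
Proof.
move=> f1; have fR := Cintegrable_Re f1; have fI := Cintegrable_Im f1.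
apply: eq_complexP; rewrite !ReImE/=.
  under eq_Rintegral do rewrite ReImE -mulNr.
  by rewrite Rintegral_lin2// mulNr.
under eq_Rintegral do rewrite ReImE.
by rewrite Rintegral_lin2.
Qed.

Lemma CintegralB f g : Cintegrable f -> Cintegrable g ->
  Cintegral mu (fun x => f x - g x) = Cintegral mu f - Cintegral mu g.
Proof.
move=> f1 g1; rewrite (CintegralD f1 (CintegrableN g1)); congr (_ + _).
under [in LHS]eq_fun do rewrite -mulN1r.
by rewrite CintegralZ// mulN1r.
Qed.

Lemma eq_Cintegral f g : f =1 g -> Cintegral mu f = Cintegral mu g.
Proof. by move=> /funext ->. Qed.

Lemma Cintegral_sum I (s : seq I) (F : I -> T -> R[i]) :
  (forall i, Cintegrable (F i)) ->
  Cintegrable (fun x => \sum_(i <- s) F i x) /\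
  Cintegral mu (fun x => \sum_(i <- s) F i x) = \sum_(i <- s) Cintegral mu (F i).
Proof.
move=> F1; elim: s => [|i s [ih1 ih2]].
  under eq_fun do rewrite big_nil; rewrite big_nil; split.
    split; first exact: Cmeasurable_cst.
    by rewrite /nrm1 integral0_eq// => x _; rewrite normcE sqc0 sqrtr0.
  by rewrite /Cintegral/= Rintegral_cst// mul0r.
under eq_fun do rewrite big_cons; rewrite big_cons; split; first exact: CintegrableD.
by rewrite CintegralD// ih2.
Qed.

(** Real and imaginary parts are bounded separately, hence the factor 2. The bound serves only for
    continuity in L^1, where the constant is irrelevant. *)
Lemma normc_Cintegral f : Cintegrable f ->
  ((Normc.normc (Cintegral mu f))%:E <= 2%:E * nrm1 f)%E.
Proof.
move=> f1.
have fin : nrm1 f \is a fin_num by rewrite ge0_fin_numE ?nrm1_ge0//; case: f1.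
have i1 := Cintegrable_Re f1; have i2 := Cintegrable_Im f1.
have A (h : T -> R) : mu.-integrable setT (EFin \o h) -> (forall x, `|h x| <= Normc.normc (f x)) ->
    `|Rintegral mu setT h| <= fine (nrm1 f).
  move=> ih hf; apply: le_trans (le_normr_Rintegral measurableT ih) _.
  apply: fine_le => //.
    by apply: integrable_fin_num => //; exact: integrable_norm.
  apply: ge0_le_integral => //.
  - by have /integrable_norm/integrableP[] := ih.
  - by apply: measurable_enormc; case: f1.
  - by move=> x _; rewrite lee_fin.
have a1 := A _ i1 (fun x => normr_Re_le _); have a2 := A _ i2 (fun x => normr_Im_le _).
rewrite -(fineK fin) -EFinM lee_fin.
have -> : Cintegral mu f = Complex (complex.Re (Cintegral mu f)) 0 + Complex 0 (complex.Im (Cintegral mu f)).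
  by apply: eq_complexP; rewrite !ReImE/= ?addr0 ?add0r.
apply: le_trans (normcD_le _ _) _; rewrite /= expr0n/= addr0 add0r !sqrtr_sqr.
lra.
Qed.

Lemma Re_conjc (z : R[i]) : complex.Re (conjc z) = complex.Re z.
Proof. by case: z. Qed.

Lemma Im_conjc (z : R[i]) : complex.Im (conjc z) = - complex.Im z.
Proof. by case: z. Qed.

Lemma Cmeasurable_conj f : Cmeasurable f -> Cmeasurable (fun x => conjc (f x)).
Proof.
move=> [m1 m2]; split; first by under eq_fun do rewrite Re_conjc.
by under eq_fun do rewrite Im_conjc; exact: measurable_funN.
Qed.

Lemma Cintegrable_sq f : Cmeasurable f -> (qn mu f < +oo)%E ->
  Cintegrable (fun x => f x * conjc (f x)).
Proof.
move=> mf qf.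
have mc := Cmeasurable_conj mf.
split; first exact: CmeasurableM.
rewrite (_ : nrm1 _ = qn mu f)//; apply: eq_integral => x _; congr EFin.
rewrite Normc.normcM -sqcE expr2; congr (_ * _).
by rewrite !normcE /sqc; case: (f x) => a b /=; rewrite sqrrN.
Qed.

Lemma Re_Cintegral_sq f : Cmeasurable f -> (qn mu f < +oo)%E ->
  Cintegral mu (fun x => f x * conjc (f x)) = Complex (fine (qn mu f)) 0.
Proof.
move=> mf qf; apply: eq_complexP => /=.
  congr fine; apply: eq_integral => x _; congr EFin.
  by case: (f x) => a b /=; rewrite /sqc/=; ring.
rewrite (_ : (fun x => _) = cst 0).
  by rewrite Rintegral_cst// mul0r.
by apply/funext => x; case: (f x) => a b /=; ring.
Qed.

End Cintegral.

(** * Integrals of characters over the unit cube *)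

Section cos_integral.
Context {R : realType}.
Local Notation leb1 := (@lebesgue_measure R).

(** Adding 1 makes the integrand nonnegative, so that iterated integrals can be handled without
    integrability conditions. The phase [t] will carry the other coordinates, and also the shift
    that turns a cosine into a sine. *)
Lemma integral_cos1 (k : int) (t : R) :
  (\int[leb1]_(x in `[0%R, 1%R[) (1 + cos (2 * pi * k%:~R * x + t))%:E =
   (1 + (k == 0)%:R * cos t)%:E)%E.
Proof.
have [->|k0] := eqVneq k 0.
  under eq_integral do rewrite mulr0 mul0r add0r.
  rewrite mul1r integral_cst//= lebesgue_measure_itv/= lte_fin ltr01.
  by rewrite oppr0 adde0 mule1.
set w := 2 * pi * k%:~R.
have w0 : w != 0 by rewrite mulf_neq0 ?intr_eq0// mulf_neq0// gt_eqF ?pi_gt0.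
pose f x := 1 + cos (w * x + t); pose F x := x + w^-1 * sin (w * x + t).
have dF (x : R) : is_derive x 1 F (f x).
  have d1 : is_derive x 1 (fun x : R => w * x + t) w.
    by apply: is_derive_eq; rewrite /GRing.scale/= mulr1 addr0.
  have d2 : is_derive x 1 (fun x : R => sin (w * x + t)) (w * cos (w * x + t)).
    by have := @is_derive1_comp _ sin (fun x : R => w * x + t) x _ _ (is_derive_sin _) d1; rewrite mulrC.
  apply: is_derive_eq; rewrite /GRing.scale/= /f; congr (_ + _).
  by rewrite mulrA mulVf// mul1r.
have cF (x : R) : {for x, continuous F}.
  by apply: differentiable_continuous; apply/derivable1_diffP; have [] := dF x.
have cf : continuous f.
  move=> x; apply: cvgD; first exact: cvg_cst.
  apply: (@continuous_comp _ _ _ (fun x => w * x + t) cos); last exact: continuous_cos.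
  by apply: cvgD; [apply: cvgM; [exact: cvg_cst|exact: cvg_id]|exact: cvg_cst].
rewrite (@integral_itv_bndo_bndc R); last first.
  by apply/measurable_EFinP; apply: measurable_funTS; exact: continuous_measurable_fun.
rewrite (@continuous_FTC2 _ f F)//.
- rewrite -EFinB /F mulr0 !add0r mul0r addr0 !mulr1; congr EFin.
  have -> : sin (w + t) = sin t.
    have E : expi w = 1 by exact: expi2piz.
    have c : cos w = 1 by have := congr1 (@complex.Re R) E.
    have s : sin w = 0 by have := congr1 (@complex.Im R) E.
    by rewrite sinD c s mul0r mul1r add0r.
  by rewrite addrK.
- exact: continuous_subspaceT.
- split.
  + by move=> x _; have [] := dF x.
  + by apply: cvg_at_right_filter; exact: cF.
  + by apply: cvg_at_left_filter; exact: cF.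
- by move=> x _; rewrite derive1E; have [_] := dF x.
Qed.

Lemma integral_torusS n (f : n.+1.-tuple R -> \bar R) :
  measurable_fun setT f -> (forall x, 0 <= f x)%E ->
  (\int[torus n.+1]_x f x =
   \int[leb1]_(a in `[0%R, 1%R[) \int[torus n]_x f (cons_pair (a, x)))%E.
Proof.
move=> mf f0; rewrite integral_torus// integral_mkcond.
have mc := @measurable_cube R n.+1; have mc' := @measurable_cube R n.
have mfc : measurable_fun setT (f \_ (cube n.+1)).
  by have [h _] := measurable_restrictT f mc; apply: h; exact: measurable_funTS.
rewrite integral_lebS//; last by move=> x; rewrite patchE; case: ifP.
rewrite [RHS]integral_mkcond; apply: eq_integral => a _.
have mfa : measurable_fun setT (fun x => f (cons_pair (a, x))).
  apply: (measurable_pairl a (f := f \o @cons_pair R n)).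
  by apply: (measurableT_comp mf); exact: measurable_cons_pair.
have cubeS (x : n.-tuple R) : cube n.+1 (cons_pair (a, x)) <-> 0 <= a < 1 /\ cube n x.
  split=> [h|[ha hx] i].
    split; first by have := h ord0; rewrite tnth0.
    by move=> i; have := h (lift ord0 i); rewrite tnthS; congr (_ <= tnth _ _ < _); exact: val_inj.
  by case: (unliftP ord0 i) => [j ->|->]; rewrite ?tnthS ?tnth0//=.
rewrite patchE; case: ifPn => [/set_mem/=|]; rewrite ?in_itv/= => a01.
  rewrite integral_torus// [RHS]integral_mkcond; apply: eq_integral => x _.
  rewrite !patchE; congr (if _ then _ else _).
  by apply/idP/idP => /set_mem h; apply/mem_set; [have [] := (cubeS x).1 h|apply/cubeS].
rewrite integral0_eq// => x _; rewrite patchE memNset// => /cubeS[a01' _].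
by move/negP: a01; apply; apply/mem_set; rewrite /= in_itv.
Qed.

Lemma integral_cos n (m : n.-tuple int) (t : R) :
  (\int[torus n]_x (1 + cos (2 * pi * dot (intv m) x + t))%:E =
   (1 + (m == [tuple 0 | _ < n])%:R * cos t)%:E)%E.
Proof.
have pos (s : R) : (0 <= (1 + cos s)%:E)%E by rewrite lee_fin; have := cos_geN1 s; lra.
have meas k (m' : k.-tuple int) s : measurable_fun setT
    (fun x : k.-tuple R => (1 + cos (2 * pi * dot (intv m') x + s))%:E).
  apply/measurable_EFinP; apply: measurable_funD; first exact: measurable_cst.
  apply: (measurableT_comp (f := cos)).
    by apply: continuous_measurable_fun; exact: continuous_cos.
  apply: measurable_funD; last exact: measurable_cst.
  apply: measurable_funM; first exact: measurable_cst.
  by apply: measurable_dot => //; exact: measurable_cst.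
elim: n m t => [m t|n ih m t].
  rewrite integral_torus// integral_mkcond integral_leb0//; last first.
    by have [h _] := measurable_restrictT (fun x => (1 + cos (2 * pi * dot (intv m) x + t))%:E) (@measurable_cube R 0); apply: h; apply: measurable_funTS; exact: meas.
  rewrite patchE mem_set; last by case.
  rewrite /dot big_ord0 mulr0 add0r (_ : m == _) ?mul1r//.
  by apply/eqP; apply: eq_from_tnth => -[].
rewrite integral_torusS//.
pose m' : n.-tuple int := [tuple of behead m].
have dotS a x : dot (intv m) (cons_pair (a, x)) = (thead m)%:~R * a + dot (intv m') x.
  rewrite /dot big_ord_recl !tnth_mktuple tnth0; congr (_ + _).
  apply: eq_bigr => i _; rewrite !tnth_mktuple tnthS tnth_behead; congr ((tnth _ _)%:~R * _).
  by apply: val_inj; rewrite /= inordK// ltnS.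
(* The first coordinate is absorbed into the phase, to which the induction hypothesis is general
   enough to apply. *)
have cosE a x : 1 + cos (2 * pi * dot (intv m) (cons_pair (a, x)) + t) =
    1 + cos (2 * pi * dot (intv m') x + (2 * pi * (thead m)%:~R * a + t)).
  by rewrite dotS; congr (1 + cos _); ring.
under eq_integral => a _.
  under eq_integral do rewrite cosE.
  rewrite ih; over.
have [m'0|m'0] := eqVneq m' [tuple 0 | _ < n].
  under eq_integral do rewrite mul1r.
  rewrite integral_cos1; congr (1 + (_ : bool)%:R * _)%:E.
  apply/eqP/eqP => [m0|->]; last by rewrite /thead tnth_mktuple.
  apply: eq_from_tnth => i; rewrite tnth_mktuple.
  case: (unliftP ord0 i) => [j ->|->//].
  have := congr1 (fun u => tnth u j) m'0; rewrite tnth_mktuple tnth_behead => <-.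
  by congr tnth; apply: val_inj; rewrite /= inordK// ltnS.
under eq_integral do rewrite mul0r addr0.
rewrite integral_cst//= lebesgue_measure_itv/= lte_fin ltr01 oppr0 adde0 mule1.
rewrite (_ : m == _ = false) ?mul0r ?addr0//; apply: contraNF m'0 => /eqP m0.
by apply/eqP; apply: eq_from_tnth => i; rewrite tnth_behead m0 !tnth_mktuple.
Qed.

End cos_integral.

Section L2_density.
Import HBNNSimple.
Context {R : realType} d (T : measurableType d) (mu : {measure set T -> \bar R}).
Context (kap : T -> R) (mkap : measurable_fun setT kap).
Hypothesis kap_fin : (\int[mu]_x (kap x ^+ 2)%:E < +oo)%E.
Context (A : set (T -> R)).
Hypothesis A_meas : forall f, A f -> measurable_fun setT f.
Hypothesis A_bd : forall f, A f -> exists M : R, forall x, `|f x| <= M.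
Hypothesis A_cst : forall c, A (fun=> c).
Hypothesis A_lin : forall a f g, A f -> A g -> A (fun x => a * f x + g x).
Hypothesis A_all : forall E, measurable E -> wsets mu kap A E.

Lemma wclosure_sum I (s : seq I) (F : I -> T -> R) :
  (forall i, wclosure mu kap A (F i)) -> wclosure mu kap A (fun x => \sum_(i <- s) F i x).
Proof.
move=> WF; elim: s => [|i s ih].
  by under eq_fun do rewrite big_nil; apply: wclosure_sub.
under eq_fun do rewrite big_cons -[F i _]mul1r.
exact: (wclosure_lin mkap A_meas A_lin).
Qed.

Lemma wclosure_sfun (s : {nnsfun T >-> R}) : wclosure mu kap A s.
Proof.
rewrite (_ : (s : T -> R) = (fun x => \sum_(y <- fset_set (range s)) y * \1_(s @^-1` [set y]) x)).
  apply: wclosure_sum => y.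
  have [_ W1] := A_all (measurable_sfunP s (measurable_set1 y)).
  rewrite (_ : (fun x => _) = (fun x => y * \1_(s @^-1` [set y]) x + 0)); last first.
    by apply/funext => x; rewrite addr0.
  by apply: (wclosure_lin mkap A_meas A_lin) => //; exact: wclosure_sub.
apply/funext => x; rewrite {1}fimfunE fsbig_finite//.
Qed.

(** Increasing simple functions converge to [h] by domination, and each one is a finite combination
    of indicators, which the closure contains. *)
Lemma wn_density_ge0 (h : T -> R) : measurable_fun setT h -> (forall x, 0 <= h x) ->
  (wn mu kap h < +oo)%E -> forall e : R, 0 < e ->
  exists2 p, A p & (wn mu kap (fun x => h x - p x)%R < e%:E)%E.
Proof.
move=> mh h0 hfin e e0.
have mH : measurable_fun setT (EFin \o h) by exact/measurable_EFinP.
pose s := nnsfun_approx measurableT mH.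
have sh x : s n x @[n --> \oo] --> h x.
  have := @cvg_nnsfun_approx _ _ _ setT measurableT _ mH (fun x _ => h0 x) x I.
  by move=> /fine_cvgP[].
have sle n x : s n x <= h x.
  have nd : nondecreasing_seq (s^~ x).
    by move=> a b ab; have /lefP := nd_nnsfun_approx measurableT mH ab; apply.
  rewrite -(cvg_lim _ (sh x))//; apply: nondecreasing_cvgn_le => //.
  by apply/cvg_ex; eexists; exact: sh.
have s0 n x : 0 <= s n x by [].
have mB n : measurable_fun setT (fun x => h x - s n x) by exact: measurable_funB.
have mF n : measurable_fun setT (fun x => (kap x ^+ 2 * (h x - s n x) ^+ 2)%:E).
  by apply/measurable_EFinP; apply: measurable_funM; exact: measurable_funX.
have c0 : (wn mu kap (fun x => h x - s n x)%R)%E @[n --> \oo] --> (\int[mu]_x (cst 0%E x))%E.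
  apply: (@dominated_cvg _ _ _ mu setT measurableT _ _
    (fun x => (kap x ^+ 2 * h x ^+ 2)%:E)%E) => //.
  - move=> x _; apply/fine_cvgP; split; first exact: nearW.
    rewrite -[X in _ --> X](mulr0 (kap x ^+ 2)); apply: cvgM; first exact: cvg_cst.
    rewrite -[X in _ --> X](expr0n _ 2) -(subrr (h x)) !expr2 /=.
    by apply: cvgM; apply: cvgB => //; exact: cvg_cst.
  - apply/integrableP; split.
      by apply/measurable_EFinP; apply: measurable_funM; exact: measurable_funX.
    by under eq_integral do rewrite gee0_abs ?lee_fin ?(mulr_ge0 (sqr_ge0 _) (sqr_ge0 _))//.
  - move=> n x _; rewrite gee0_abs ?lee_fin ?(mulr_ge0 (sqr_ge0 _) (sqr_ge0 _))//.
    rewrite ler_wpM2l ?sqr_ge0// lerXn2r ?nnegrE ?subr_ge0//.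
    by rewrite lerBlDr lerDl.
rewrite integral0 in c0.
have [N hN] := cvge0_lt c0 (divr_gt0 e0 (ltr0Sn _ 3)).
have [msN _ /(_ _ (divr_gt0 e0 (ltr0Sn _ 3)))[p Ap sp]] := wclosure_sfun (s N).
exists p => //; have mp := A_meas Ap.
rewrite (_ : (fun x => _) = (fun x => (h x - s N x) + (s N x - p x))); last first.
  by apply/funext => x; ring.
have msp : measurable_fun setT (fun x => s N x - p x) by exact: measurable_funB.
exact: (lte_quarters (wn_ge0 _ _ _) (wn_ge0 _ _ _) (wnD mu mkap (mB N) msp) (hN N (leqnn N))).
Qed.

Lemma wn_density (h : T -> R) : measurable_fun setT h ->
  (wn mu kap h < +oo)%E -> forall e : R, 0 < e ->
  exists2 p, A p & (wn mu kap (fun x => h x - p x)%R < e%:E)%E.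
Proof.
move=> mh hfin e e0.
have part (g : T -> R) : measurable_fun setT g -> (forall x, g x ^+ 2 <= h x ^+ 2) -> (wn mu kap g < +oo)%E.
  move=> mg gh; apply: le_lt_trans hfin; apply: ge0_le_integral => //.
  - by move=> x _; rewrite lee_fin (mulr_ge0 (sqr_ge0 _) (sqr_ge0 _)).
  - by apply/measurable_EFinP; apply: measurable_funM; exact: measurable_funX.
  - by apply/measurable_EFinP; apply: measurable_funM; exact: measurable_funX.
  - by move=> x _; rewrite lee_fin ler_wpM2l ?sqr_ge0.
have mp1 : measurable_fun setT (fun x => Num.max (h x) 0).
  by apply: measurable_maxr => //; exact: measurable_cst.
have mp2 : measurable_fun setT (fun x => Num.max (- h x) 0).
  by apply: measurable_maxr; [exact: measurable_funN|exact: measurable_cst].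
have g1 x : 0 <= Num.max (h x) 0 by rewrite le_max lexx orbT.
have g2 x : 0 <= Num.max (- h x) 0 by rewrite le_max lexx orbT.
have f1 : (wn mu kap (fun x => Num.max (h x) 0)%R < +oo)%E.
  by apply: part => // x; rewrite maxEle; case: ifP => // _; rewrite expr0n/= sqr_ge0.
have f2 : (wn mu kap (fun x => Num.max (- h x) 0)%R < +oo)%E.
  apply: part => // x; rewrite maxEle; case: ifP => // _; last by rewrite sqrrN.
  by rewrite expr0n/= sqr_ge0.
have [p Ap hp] := wn_density_ge0 mp1 g1 f1 (divr_gt0 e0 (ltr0Sn _ 3)).
have [q Aq hq] := wn_density_ge0 mp2 g2 f2 (divr_gt0 e0 (ltr0Sn _ 3)).
have mp := A_meas Ap; have mq := A_meas Aq.
exists (fun x => (-1) * q x + p x); first exact: A_lin.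
rewrite (_ : (fun x => _) = (fun x => (Num.max (h x) 0 - p x) + (-1) * (Num.max (- h x) 0 - q x))); last first.
  apply/funext => x; have : Num.max (h x) 0 - Num.max (- h x) 0 = h x.
    by rewrite !maxEle oppr_le0; have [|] := leP (h x) 0; have [|] := leP 0 (h x); lra.
  by move=> {1}<-; ring.
have m1 := measurable_funB mp1 mp; have m2 := measurable_funB mp2 mq.
have m3 := measurable_funM (measurable_cst (-1 : R)) m2.
apply: (lte_quarters (wn_ge0 _ _ _) (wn_ge0 _ _ _) (wnD mu mkap m1 m3) hp).
by rewrite (_ : wn _ _ _ = wn mu kap (fun x => Num.max (- h x) 0 - q x))//; apply: eq_integral => x _; rewrite /= mulN1r sqrrN.
Qed.

End L2_density.

(** * Fourier series on the torus *)

Section torus_fourier.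
Context {R : realType} {n : nat}.
Local Notation Rn := (n.-tuple R).
Local Notation Zn := (n.-tuple int).
Local Notation mu := (@torus R n).
Implicit Types (m k l : Zn) (x : Rn) (g : Rn -> R[i]).

Definition ez m x : R[i] := expi (2 * pi * dot (intv m) x).

Definition zerov : Zn := [tuple 0 | _ < n].
Definition addz m k : Zn := [tuple tnth m i + tnth k i | i < n].
Definition oppz m : Zn := [tuple - tnth m i | i < n].

Lemma dot_addz m k x : dot (intv (addz m k)) x = dot (intv m) x + dot (intv k) x.
Proof.
rewrite /dot -big_split/=; apply: eq_bigr => i _.
by rewrite !tnth_mktuple intrD mulrDl.
Qed.

Lemma dot_oppz m x : dot (intv (oppz m)) x = - dot (intv m) x.
Proof.
rewrite /dot -sumrN; apply: eq_bigr => i _.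
by rewrite !tnth_mktuple intrN mulNr.
Qed.

Lemma dot_zerov x : dot (intv zerov) x = 0.
Proof. by rewrite /dot big1// => i _; rewrite !tnth_mktuple mul0r. Qed.

Lemma oppzK : involutive oppz.
Proof. by move=> m; apply: eq_from_tnth => i; rewrite !tnth_mktuple opprK. Qed.

Lemma addz_eq0 m k : (addz m (oppz k) == zerov) = (m == k).
Proof.
apply/eqP/eqP => [h|->]; apply: eq_from_tnth => i; last by rewrite !tnth_mktuple subrr.
by have := congr1 (fun u => tnth u i) h; rewrite !tnth_mktuple => /eqP; rewrite subr_eq0 => /eqP.
Qed.

Lemma ezD m k x : ez (addz m k) x = ez m x * ez k x.
Proof. by rewrite /ez dot_addz mulrDr expiD. Qed.

Lemma conj_expi (t : R) : conjc (expi t) = expi (- t).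
Proof. by rewrite /expi cosN sinN. Qed.

Lemma conj_ez m x : conjc (ez m x) = ez (oppz m) x.
Proof. by rewrite /ez dot_oppz mulrN conj_expi. Qed.

Lemma measurable_dotl (a : Rn) : measurable_fun setT (fun x => dot a x).
Proof. by apply: measurable_dot => //; exact: measurable_cst. Qed.

Lemma Cmeasurable_ez m : Cmeasurable (ez m).
Proof.
apply: Cmeasurable_expi; apply: measurable_funM; first exact: measurable_cst.
exact: measurable_dotl.
Qed.

Lemma torus_mass : (mu : {measure set Rn -> \bar R}) setT = 1%E.
Proof.
(* With frequency 0 and phase [pi / 2] the cosine vanishes, so the formula reads: the integral of 1
   is 1. *)
have := integral_cos zerov (pi / 2 : R).
rewrite cos_pihalf mulr0 addr0 => <-.
under eq_integral do rewrite dot_zerov mulr0 add0r cos_pihalf addr0.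
by rewrite integral_cst// mul1e.
Qed.

Lemma ae_cube : {ae mu, forall x, cube n x}.
Proof.
exists (~` cube n); split; last by [].
  by apply: measurableC; exact: measurable_cube.
by rewrite -[LHS]/(leb n (~` cube n `&` cube n)) setIC setICr measure0.
Qed.

Lemma Cintegrable_bounded g (M : R) : Cmeasurable g -> (forall x, Normc.normc (g x) <= M) ->
  Cintegrable mu g.
Proof.
move=> mg gM; split => //; apply: (@le_lt_trans _ _ (\int[mu]_x M%:E)%E).
  apply: ge0_le_integral => //.
  - by move=> x _; rewrite lee_fin normc_ge0.
  - exact: measurable_enormc.
  - by move=> x _; rewrite lee_fin.
by rewrite integral_cst// torus_mass mule1 ltry.
Qed.

Lemma normc_expi (t : R) : Normc.normc (expi t) = 1.
Proof. by rewrite normcE sqc_expi sqrtr1. Qed.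

Lemma Cintegrable_ez m : Cintegrable mu (ez m).
Proof.
apply: (@Cintegrable_bounded _ 1); first exact: Cmeasurable_ez.
by move=> x; rewrite normc_expi.
Qed.

Lemma Rintegral_cos m (t : R) :
  Rintegral mu setT (fun x => cos (2 * pi * dot (intv m) x + t)) = (m == zerov)%:R * cos t.
Proof.
have i1 : mu.-integrable setT (EFin \o (fun=> 1 : R)).
  apply/integrableP; split; first by apply/measurable_EFinP; exact: measurable_cst.
  by under eq_integral do rewrite /= normr1; rewrite integral_cst// torus_mass mule1 ltry.
have mc : measurable_fun setT (fun x : Rn => cos (2 * pi * dot (intv m) x + t)).
  apply: (measurableT_comp (f := cos)).
    by apply: continuous_measurable_fun; exact: continuous_cos.
  apply: measurable_funD; last exact: measurable_cst.
  by apply: measurable_funM; [exact: measurable_cst|exact: measurable_dotl].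
have i2 : mu.-integrable setT (EFin \o (fun x => cos (2 * pi * dot (intv m) x + t))).
  apply: le_integrable i1 => //; first exact/measurable_EFinP.
  by move=> x _ /=; rewrite lee_fin normr1 ler_norml cos_geN1 cos_le1.
have := RintegralD measurableT i1 i2.
rewrite {1}/Rintegral integral_cos/= Rintegral_cst//=.
by rewrite torus_mass mulr1 => /addrI ->.
Qed.

Lemma Cintegral_ez m : Cintegral mu (ez m) = (m == zerov)%:R.
Proof.
have rC (b : bool) : (b%:R : R[i]) = Complex b%:R 0 by case: b.
rewrite rC; apply: eq_complexP => /=.
  by have := Rintegral_cos m 0; rewrite cos0 mulr1 => <-; apply: eq_Rintegral => x _; rewrite addr0.
have := Rintegral_cos m (- (pi / 2)); rewrite cosN cos_pihalf mulr0 => <-.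
by apply: eq_Rintegral => x _; rewrite cosBpihalf.
Qed.

(** In the usual convention this is the Fourier coefficient of index -m. The sign follows that of
    the Weyl kernel, and [tpoly] accordingly uses the conjugate characters. *)
Definition gh g m : R[i] := Cintegral mu (fun x => g x * ez m x).

Definition tpoly (s : seq Zn) (b : Zn -> R[i]) x : R[i] := \sum_(m <- s) b m * conjc (ez m x).

Lemma conjcM (z w : R[i]) : conjc (z * w) = conjc z * conjc w.
Proof. exact: rmorphM. Qed.

Lemma conjc_sum I (s : seq I) (F : I -> R[i]) :
  conjc (\sum_(i <- s) F i) = \sum_(i <- s) conjc (F i).
Proof. exact: rmorph_sum. Qed.

Lemma mul_conj (z : R[i]) : z * conjc z = Complex (sqc z) 0.
Proof. by case: z => a b; apply: eq_complexP; rewrite /sqc/=; ring. Qed.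

Lemma sum_Complex I (s : seq I) (F : I -> R) :
  \sum_(i <- s) Complex (F i) 0 = Complex (\sum_(i <- s) F i) 0 :> R[i].
Proof.
elim: s => [|i s ih]; first by rewrite !big_nil.
by rewrite !big_cons ih; apply: eq_complexP; rewrite ReImE/= ?addr0.
Qed.

Lemma Cmeasurable_tpoly s b : Cmeasurable (tpoly s b).
Proof.
apply: Cmeasurable_sum => m; apply: CmeasurableM; first exact: Cmeasurable_cst.
by apply: Cmeasurable_conj; exact: Cmeasurable_ez.
Qed.

Lemma Cintegrable_L2 g : Cmeasurable g -> (qn mu g < +oo)%E -> Cintegrable mu g.
Proof.
move=> mg qg; split => //; apply: (@le_lt_trans _ _ (\int[mu]_x (1 + (sqc (g x))%:E))%E).
  apply: ge0_le_integral => //.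
  - by move=> x _; rewrite lee_fin normc_ge0.
  - exact: measurable_enormc.
  - by apply: emeasurable_funD; [exact: measurable_cst|exact: measurable_esqc].
  - move=> x _; rewrite -EFinD lee_fin -sqcE; have := sqr_ge0 (Normc.normc (g x) - 1).
    by rewrite sqrrB1; have := normc_ge0 (g x); lra.
rewrite ge0_integralD//; last 2 first.
- by move=> x _; rewrite lee_fin sqc_ge0.
- exact: measurable_esqc.
by rewrite integral_cst// torus_mass mule1 lte_add_pinfty// ltry.
Qed.

Lemma Cintegral_tpoly2 s b : uniq s ->
  Cintegral mu (fun x => tpoly s b x * conjc (tpoly s b x)) = Complex (\sum_(m <- s) sqc (b m)) 0.
Proof.
move=> us.
rewrite (@eq_Cintegral _ _ _ _ _ (fun x => \sum_(m <- s) \sum_(k <- s)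
   (b m * conjc (b k)) * ez (addz k (oppz m)) x)); last first.
  move=> x; rewrite /tpoly conjc_sum mulr_suml; apply: eq_bigr => m _.
  rewrite mulr_sumr; apply: eq_bigr => k _.
  by rewrite conjcM conjcK ezD -conj_ez; ring.
have i1 m k : Cintegrable mu (fun x => (b m * conjc (b k)) * ez (addz k (oppz m)) x).
  by apply: CintegrableZ; exact: Cintegrable_ez.
have i2 m := Cintegral_sum s (i1 m).
rewrite (Cintegral_sum s (fun m => (i2 m).1)).2.
under eq_bigr => m _.
  rewrite (i2 m).2; under eq_bigr do rewrite (CintegralZ _ (Cintegrable_ez _)) Cintegral_ez addz_eq0.
  over.
rewrite big_seq.
under eq_bigr => m ms.
  rewrite (bigD1_seq m)//= eqxx mulr1 big1 ?addr0; last first.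
    by move=> k /negbTE ->; rewrite mulr0.
  rewrite mul_conj; over.
by rewrite -big_seq sum_Complex.
Qed.

Lemma conj_Cintegral d (T : measurableType d) (nu : {measure set T -> \bar R}) (f : T -> R[i]) :
  Cintegrable nu f ->
  Cintegral nu (fun t => conjc (f t)) = conjc (Cintegral nu f).
Proof.
move=> f1; apply: eq_complexP.
  rewrite Re_conjc -[LHS]/(Rintegral nu setT (fun t => complex.Re (conjc (f t)))).
  by under eq_Rintegral do rewrite Re_conjc.
rewrite Im_conjc -[LHS]/(Rintegral nu setT (fun t => complex.Im (conjc (f t)))).
under eq_Rintegral do rewrite Im_conjc -mulN1r.
by rewrite RintegralZl ?mulN1r//; exact: Cintegrable_Im.
Qed.

Lemma Cintegral_gtpoly g s b : Cmeasurable g -> (qn mu g < +oo)%E ->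
  Cintegrable mu (fun x => g x * conjc (tpoly s b x)) /\
  Cintegral mu (fun x => g x * conjc (tpoly s b x)) = \sum_(m <- s) conjc (b m) * gh g m.
Proof.
move=> mg qg; have ig := Cintegrable_L2 mg qg.
have i1 m : Cintegrable mu (fun x => conjc (b m) * (g x * ez m x)).
  apply: CintegrableZ; apply: (CintegrableMb (M := 1)) => //; first exact: Cmeasurable_ez.
  by move=> x; rewrite normc_expi.
have E : (fun x => g x * conjc (tpoly s b x)) = (fun x => \sum_(m <- s) conjc (b m) * (g x * ez m x)).
  apply/funext => x; rewrite /tpoly conjc_sum mulr_sumr; apply: eq_bigr => m _.
  by rewrite conjcM conjcK; ring.
rewrite E; have [h1 h2] := Cintegral_sum s i1; split => //.
rewrite h2; apply: eq_bigr => m _; rewrite CintegralZ//.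
apply: (CintegrableMb (M := 1)) => //; first exact: Cmeasurable_ez.
by move=> x; rewrite normc_expi.
Qed.

Lemma tpoly_bounded s b : exists M : R, forall x, Normc.normc (tpoly s b x) <= M.
Proof.
exists (\sum_(m <- s) Normc.normc (b m)) => x; rewrite /tpoly.
elim: s => [|m s ih]; first by rewrite !big_nil Normc.normc0.
rewrite !big_cons; apply: le_trans (normcD_le _ _) _; apply: lerD => //.
by rewrite Normc.normcM conj_ez normc_expi mulr1.
Qed.

Lemma Cintegrable_tpoly2 s b : Cintegrable mu (fun x => tpoly s b x * conjc (tpoly s b x)).
Proof.
have [M hM] := tpoly_bounded s b; have mt := Cmeasurable_tpoly s b.
apply: (@CintegrableMb _ _ _ _ M); last 2 first.
- exact: Cmeasurable_conj.
- by move=> x; rewrite normcE /sqc Re_conjc Im_conjc sqrrN -/(sqc _) -normcE.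
exact: Cintegrable_bounded hM.
Qed.

Lemma qn_tpoly s b : uniq s -> qn mu (tpoly s b) = (\sum_(m <- s) sqc (b m))%:E.
Proof.
move=> us; have mt := Cmeasurable_tpoly s b.
have [M hM] := tpoly_bounded s b.
have fin : (qn mu (tpoly s b) < +oo)%E.
  have [_] := Cintegrable_tpoly2 s b; rewrite (_ : nrm1 _ _ = qn mu (tpoly s b))//.
  apply: eq_integral => x _; rewrite mul_conj normcE sqc_real.
  by rewrite sqrtr_sqr ger0_norm ?sqc_ge0.
have := Re_Cintegral_sq mt fin; rewrite (Cintegral_tpoly2 b us) => -[->].
by rewrite fineK// ge0_fin_numE// qn_ge0.
Qed.

(** Completing the square, by orthonormality of the characters. The last sum vanishes for the
    coefficients of [g] itself, which gives Bessel's inequality; its nonnegativity bounds the error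
    from below for any other choice. *)
Lemma qn_sub_tpoly g s b : Cmeasurable g -> (qn mu g < +oo)%E -> uniq s ->
  qn mu (fun x => g x - tpoly s b x) = (fine (qn mu g) - \sum_(m <- s) sqc (gh g m)
    + \sum_(m <- s) sqc (gh g m - b m))%:E.
Proof.
move=> mg qg us; have mt := Cmeasurable_tpoly s b.
have mgt : Cmeasurable (fun x => g x - tpoly s b x) by exact: CmeasurableB.
have fin : (qn mu (fun x => (g x - tpoly s b x)%R) < +oo)%E.
  by apply: qnB_lty => //; rewrite qn_tpoly// ltry.
have := Re_Cintegral_sq mgt fin.
have [i1 e1] := Cintegral_gtpoly s b mg qg.
have i2 := Cintegrable_tpoly2 s b; have i3 := Cintegrable_sq mg qg.
have i4 : Cintegrable mu (fun x => conjc (g x * conjc (tpoly s b x))).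
  case: i1 => m1 n1; split; first exact: Cmeasurable_conj.
  rewrite (_ : nrm1 _ _ = nrm1 mu (fun x => g x * conjc (tpoly s b x)))//.
  apply: eq_integral => x _; congr EFin.
  by rewrite !normcE; congr Num.sqrt; rewrite /sqc Re_conjc Im_conjc sqrrN.
rewrite (@eq_Cintegral _ _ _ _ _ (fun x => (g x * conjc (g x) - g x * conjc (tpoly s b x))
   + (tpoly s b x * conjc (tpoly s b x) - conjc (g x * conjc (tpoly s b x))))); last first.
  move=> x; rewrite conjcM conjcK.
  have -> : conjc (g x - tpoly s b x) = conjc (g x) - conjc (tpoly s b x).
    by case: (g x) => ? ?; case: (tpoly s b x) => ? ?; apply: eq_complexP => /=; ring.
  by ring.
rewrite CintegralD; last 2 first.
- by apply: CintegrableD => //; exact: CintegrableN.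
- by apply: CintegrableD => //; exact: CintegrableN.
rewrite !CintegralB// (Cintegral_tpoly2 b us) (Re_Cintegral_sq mg qg) conj_Cintegral// e1.
move=> /(congr1 (@complex.Re R)); rewrite !ReImE Re_conjc/= raddf_sum => E.
rewrite -[LHS]fineK ?ge0_fin_numE ?qn_ge0//; congr EFin.
rewrite -[LHS]E.
have -> : \sum_(m <- s) sqc (gh g m - b m) = \sum_(m <- s) sqc (gh g m)
   - 2 * \sum_(m <- s) complex.Re (conjc (b m) * gh g m) + \sum_(m <- s) sqc (b m).
  rewrite mulr_sumr -sumrB -big_split/=; apply: eq_bigr => m _.
  by case: (b m) => ? ?; case: (gh g m) => ? ?; rewrite /sqc/=; ring.
by ring.
Qed.

Definition cphase : set (Rn -> R) := [set p | exists m, p = fun x => 2 * pi * dot (intv m) x].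

Lemma cphase0 : cphase (fun=> 0).
Proof. by exists zerov; apply/funext => x; rewrite dot_zerov mulr0. Qed.

Lemma cphaseD p q : cphase p -> cphase q -> cphase (fun x => p x + q x).
Proof.
move=> [m ->] [k ->]; exists (addz m k); apply/funext => x.
by rewrite dot_addz; ring.
Qed.

Lemma cphaseN p : cphase p -> cphase (fun x => - p x).
Proof. by move=> [m ->]; exists (oppz m); apply/funext => x; rewrite dot_oppz mulrN. Qed.

Lemma measurable_cphase p : cphase p -> measurable_fun setT p.
Proof.
by move=> [m ->]; apply: measurable_funM; [exact: measurable_cst|exact: measurable_dotl].
Qed.

Lemma sum_widen (s t : seq Zn) (F : Zn -> R[i]) : uniq s -> uniq t -> {subset s <= t} ->
  \sum_(m <- s) F m = \sum_(m <- t) (if m \in s then F m else 0).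
Proof.
move=> us ut st.
have P : perm_eq s [seq m <- t | m \in s].
  apply: uniq_perm; rewrite ?filter_uniq// => x.
  by rewrite mem_filter andb_idr//; exact: st.
by rewrite (perm_big _ P)/= big_filter big_mkcond.
Qed.

(** Normal form with distinct frequencies, as orthogonality requires: combinations are merged over
    the union of the supports. *)
Lemma trig_tpoly f : trig cphase f -> exists s b, uniq s /\ f = tpoly s b.
Proof.
elim=> [p [m ->]| |a f1 f2 _ [s1 [b1 [u1 ->]]] _ [s2 [b2 [u2 ->]]]].
- exists [:: oppz m], (fun=> 1); split => //; apply/funext => x.
  by rewrite /tpoly big_seq1 mul1r conj_ez oppzK.
- by exists [::], (fun=> 0); split => //; apply/funext => x; rewrite /tpoly big_nil.
pose t := undup (s1 ++ s2); have ut : uniq t by exact: undup_uniq.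
exists t, (fun m => a * (if m \in s1 then b1 m else 0) + (if m \in s2 then b2 m else 0)).
split => //; apply/funext => x; rewrite /tpoly.
rewrite (@sum_widen s1 t)//; last by move=> m ms; rewrite mem_undup mem_cat ms.
rewrite (@sum_widen s2 t)//; last by move=> m ms; rewrite mem_undup mem_cat ms orbT.
rewrite mulr_sumr -big_split/=; apply: eq_bigr => m _.
by case: ifP => _; case: ifP => _; ring.
Qed.

Lemma torus_wsets E : measurable E -> wsets mu (fun=> 1) (rtrig cphase) E.
Proof.
move=> mE; apply: (@wsets_trig_coord R _ _ cphase cphase0 cphaseD cphaseN measurable_cphase mu (fun=> 1) _ _ n id) => //.
- by rewrite expr1n integral_cst// torus_mass mule1 ltry.
- exact: ae_cube.
- move=> i; exists [tuple ((i == j)%:R : int) | j < n]; apply/funext => x; congr (_ * _).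
  rewrite /dot (bigD1 i)//= !tnth_mktuple eqxx mul1r big1 ?addr0// => j ji.
  by rewrite !tnth_mktuple eq_sym (negbTE ji) mul0r.
Qed.

Lemma tpoly_density g : Cmeasurable g -> (qn mu g < +oo)%E -> forall e : R, 0 < e ->
  exists s b, uniq s /\ (qn mu (fun x => (g x - tpoly s b x)%R) < e%:E)%E.
Proof.
move=> mg qg e e0.
have den := wn_density (@measurable_cst _ _ _ _ _ (1 : R))
  (rtrig_measurable measurable_cphase) (@rtrig_bounded _ _ _ cphase)
  (rtrig_cst cphase0) (@rtrig_lin _ _ _ cphase) torus_wsets.
have part (h : Rn -> R) : measurable_fun setT h -> (forall x, h x ^+ 2 <= sqc (g x)) ->
    exists2 p, rtrig cphase p & (wn mu (cst 1%R) (fun x => h x - p x)%R < (e / 2)%:E)%E.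
  move=> mh hg; apply: den => //; last by rewrite divr_gt0.
  apply: le_lt_trans qg; apply: ge0_le_integral => //.
  - by move=> x _; rewrite lee_fin (mulr_ge0 (sqr_ge0 _) (sqr_ge0 _)).
  - by apply/measurable_EFinP; apply: measurable_funM; exact: measurable_funX.
  - exact: measurable_esqc.
  - by move=> x _; rewrite lee_fin expr1n mul1r.
case: (mg) => m1 m2.
have le1 x : complex.Re (g x) ^+ 2 <= sqc (g x) by rewrite lerDl sqr_ge0.
have le2 x : complex.Im (g x) ^+ 2 <= sqc (g x) by rewrite lerDr sqr_ge0.
have [p tp hp] := part _ m1 le1; have [q tq hq] := part _ m2 le2.
have tpq : trig cphase (fun x => Complex 0 1 * Complex (q x) 0 + Complex (p x) 0).
  exact: trig_lin.
have [s [b [us sb]]] := trig_tpoly tpq; exists s, b; split => //.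
rewrite -sb.
have [mp1 mp2] := trig_measurable measurable_cphase tp.
have [mq1 mq2] := trig_measurable measurable_cphase tq.
rewrite (_ : qn _ _ = wn mu (cst 1%R) (fun x => complex.Re (g x) - p x)%R
    + wn mu (cst 1%R) (fun x => complex.Im (g x) - q x)%R)%E.
  move: hp hq; set X := wn _ _ _; set Y := wn _ _ _ => hp hq.
  have X0 : (0 <= X)%E by exact: wn_ge0.
  have Y0 : (0 <= Y)%E by exact: wn_ge0.
  move: X Y hp hq X0 Y0 => [x| |] [y| |]//.
  by rewrite -EFinD !lte_fin; lra.
rewrite /wn -ge0_integralD//.
- apply: eq_integral => x _; rewrite -EFinD /sqc !ReImE/=; congr EFin; ring.
- by move=> x _; rewrite lee_fin (mulr_ge0 (sqr_ge0 _) (sqr_ge0 _)).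
- apply/measurable_EFinP; apply: measurable_funM; first exact: measurable_funX.
  by apply: measurable_funX; exact: measurable_funB.
- by move=> x _; rewrite lee_fin (mulr_ge0 (sqr_ge0 _) (sqr_ge0 _)).
- apply/measurable_EFinP; apply: measurable_funM; first exact: measurable_funX.
  by apply: measurable_funX; exact: measurable_funB.
Qed.

(** One inequality is Bessel's. For the other, a polynomial within [e] of [g] shows that already the
    coefficients on its support account for all but [e] of the squared norm. *)
Lemma parseval g : Cmeasurable g -> (qn mu g < +oo)%E ->
  zsum (fun m => (sqc (gh g m))%:E) = qn mu g.
Proof.
move=> mg qg.
have fin : qn mu g \is a fin_num by rewrite ge0_fin_numE// qn_ge0.
have z0 m : (0 <= (sqc (gh g m))%:E)%E by rewrite lee_fin sqc_ge0.
apply/eqP; rewrite eq_le; apply/andP; split.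
  apply: zsum_le => // s us; rewrite sumEFin -(fineK fin) lee_fin.
  have := qn_ge0 mu (fun x => g x - tpoly s (gh g) x).
  rewrite qn_sub_tpoly// lee_fin [X in _ + X]big1 ?addr0 ?subr_ge0// => m _.
  by rewrite subrr sqc0.
apply/lee_addgt0Pr => e e0; have [s [b [us]]] := tpoly_density mg qg e0.
rewrite qn_sub_tpoly// lte_fin => h.
apply: (@le_trans _ _ (\sum_(m <- s) (sqc (gh g m))%:E + e%:E)%E); last first.
  by apply: leeD => //; exact: le_zsum.
rewrite sumEFin -(fineK fin) -EFinD lee_fin.
have : 0 <= \sum_(m <- s) sqc (gh g m - b m) by apply: sumr_ge0 => m _; exact: sqc_ge0.
by move: h; lra.
Qed.

End torus_fourier.

(** * Plancherel's theorem on R^n *)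

Section plancherel.
Context {R : realType} {n : nat}.
Local Notation Rn := (n.-tuple R).
Local Notation Zn := (n.-tuple int).
Local Notation mu := (@torus R n).
Local Notation lb := (@leb R n).
Implicit Types (m k l : Zn) (x t : Rn) (g : Rn -> R[i]).

Definition chi k x : R := (zfloor x == k)%:R.

Lemma chi_addv k x : chi k (addv (intv k) x) = \1_(cube n) x.
Proof.
rewrite /chi indicE; congr ((_ : bool)%:R).
have := cube_zfloor (addv (intv k) x) k; rewrite subvK => -[h1 h2].
by apply/eqP/idP => [/esym/h2/mem_set//|/set_mem/h1/esym].
Qed.

Lemma measurable_addvl (a : Rn) : measurable_fun setT (fun x => addv a x).
Proof. by apply: measurable_addvE => //; exact: measurable_cst. Qed.

Lemma measurable_chi k : measurable_fun setT (chi k).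
Proof.
rewrite (_ : chi k = (\1_(cube n) : Rn -> R) \o (fun x => subv x (intv k))).
  apply: measurableT_comp; first by apply: measurable_indic; exact: measurable_cube.
  by apply: measurable_subvE => //; exact: measurable_cst.
by apply/funext => x; rewrite /= -(chi_addv k) addvK.
Qed.

Lemma Cmeasurable_comp d1 d2 (T1 : measurableType d1) (T2 : measurableType d2)
    (f : T2 -> R[i]) (h : T1 -> T2) :
  Cmeasurable f -> measurable_fun setT h -> Cmeasurable (fun z => f (h z)).
Proof. by move=> [m1 m2] mh; split; [exact: (measurableT_comp m1)|exact: (measurableT_comp m2)]. Qed.

Lemma Rintegral_cube (h : Rn -> R) : measurable_fun setT h ->
  Rintegral lb setT (fun x => \1_(cube n) x * h x) = Rintegral mu setT h.
Proof.
move=> /measurable_EFinP mh; rewrite /Rintegral; congr fine.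
have mc := @measurable_cube R n.
rewrite integralE [RHS]integralE; congr (_ - _)%E.
  rewrite integral_torus ?funepos_ge0//; last exact: measurable_funepos.
  rewrite [RHS]integral_mkcond; apply: eq_integral => x _.
  rewrite patchE funeposE indicE; case: (x \in cube n).
    by rewrite mul1r funeposE.
  by rewrite mul0r maxxx.
rewrite integral_torus ?funeneg_ge0//; last exact: measurable_funeneg.
rewrite [RHS]integral_mkcond; apply: eq_integral => x _.
rewrite patchE funenegE indicE; case: (x \in cube n).
  by rewrite mul1r funenegE.
by rewrite mul0r oppe0 maxxx.
Qed.

Lemma Cintegral_chi k (f : Rn -> R[i]) : Cmeasurable f ->
  Cintegral lb (fun x => Complex (chi k x) 0 * f x) = Cintegral mu (fun x => f (addv (intv k) x)).
Proof.
have tr := @integral_translate R n (intv k).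
have key (h : Rn -> R) : measurable_fun setT h ->
    Rintegral lb setT (fun x => chi k x * h x) = Rintegral mu setT (fun x => h (addv (intv k) x)).
  move=> mh.
  rewrite -(@Rintegral_transfer _ _ _ _ _ lb lb (addv (intv k)) tr); last first.
    by apply: measurable_funM => //; exact: measurable_chi.
  rewrite -Rintegral_cube; last by apply: (measurableT_comp mh); exact: measurable_addvl.
  by apply: eq_Rintegral => x _ /=; rewrite chi_addv.
move=> [m1 m2]; apply: eq_complexP => /=.
  rewrite -(key (fun x => complex.Re (f x)))//.
  by apply: eq_Rintegral => x _; rewrite ReImE/= mul0r subr0.
rewrite -(key (fun x => complex.Im (f x)))//.
by apply: eq_Rintegral => x _; rewrite ReImE/= mul0r addr0.
Qed.

Definition fsupp (s : seq Zn) g := forall x, zfloor x \notin s -> g x = 0.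

Lemma fsupp_sum s g : uniq s -> fsupp s g ->
  forall x, g x = \sum_(k <- s) Complex (chi k x) 0 * g x.
Proof.
move=> us gs x; have [xs|xs] := boolP (zfloor x \in s).
  rewrite (bigD1_seq (zfloor x))//= big1 ?addr0; last first.
    move=> k /negbTE kx; rewrite /chi eq_sym kx -[RHS](mul0r (g x)); congr (_ * _).
  rewrite /chi eqxx -[LHS]mul1r; congr (_ * _).
by rewrite gs// big1// => k _; rewrite mulr0.
Qed.

Lemma CintegrableM_chi k (f : Rn -> R[i]) : Cintegrable lb f ->
  Cintegrable lb (fun x => Complex (chi k x) 0 * f x).
Proof.
move=> f1; rewrite (_ : (fun x => _) = (fun x => f x * Complex (chi k x) 0)); last first.
  by apply/funext => x; rewrite mulrC.
apply: (CintegrableMb (M := 1)) => //.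
  by split => /=; [exact: measurable_chi|exact: measurable_cst].
move=> x; rewrite normcE sqc_real sqrtr_sqr /chi; case: (_ == _) => /=.
  by rewrite normr1.
by rewrite normr0.
Qed.

Lemma Cintegral_fsupp s (f : Rn -> R[i]) : uniq s -> fsupp s f -> Cintegrable lb f ->
  Cintegral lb f = \sum_(k <- s) Cintegral mu (fun x => f (addv (intv k) x)).
Proof.
move=> us fs f1; rewrite (@eq_Cintegral _ _ _ _ _ _ (fsupp_sum us fs)).
rewrite (Cintegral_sum s (fun k => CintegrableM_chi k f1)).2.
by apply: eq_bigr => k _; rewrite Cintegral_chi//; case: f1.
Qed.

Lemma dotC x t : dot x t = dot t x.
Proof. by apply: eq_bigr => i _; rewrite mulrC. Qed.

Lemma dotDl x y t : dot (addv x y) t = dot x t + dot y t.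
Proof. by rewrite /dot -big_split; apply: eq_bigr => i _; rewrite tnth_mktuple mulrDl. Qed.

Lemma dotDr x y t : dot t (addv x y) = dot t x + dot t y.
Proof. by rewrite dotC dotDl !(dotC t). Qed.

Lemma expi_dot_int k m : expi (2 * pi * dot (intv k) (intv m) : R) = 1.
Proof.
rewrite (_ : dot _ _ = (\sum_(i < n) tnth k i * tnth m i)%:~R); first exact: expi2piz.
rewrite /dot rmorph_sum/=; apply: eq_bigr => i _.
by rewrite !tnth_mktuple intrM.
Qed.

(* The sign of the exponent is that of the Weyl kernel. *)
Definition fhat g t : R[i] := Cintegral lb (fun x => g x * expi (2 * pi * dot x t)).

Lemma Cmeasurable_fhat_integrand g : Cmeasurable g ->
  Cmeasurable (fun z : Rn * Rn => g z.2 * expi (2 * pi * dot z.2 z.1)).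
Proof.
move=> mg; apply: CmeasurableM; first exact: (Cmeasurable_comp mg measurable_snd).
apply: Cmeasurable_expi; apply: measurable_funM; first exact: measurable_cst.
exact: measurable_dot measurable_snd measurable_fst.
Qed.

Lemma Cmeasurable_Cintegral2 d1 d2 (T1 : measurableType d1) (T2 : measurableType d2)
    (nu : {sigma_finite_measure set T2 -> \bar R}) (f : T1 * T2 -> R[i]) :
  Cmeasurable f -> Cmeasurable (fun z => Cintegral nu (fun w => f (z, w))).
Proof.
move=> [m1 m2]; split => /=.
  exact: (@measurable_Rintegral2 _ _ _ _ _ nu (fun z => complex.Re (f z)) m1).
exact: (@measurable_Rintegral2 _ _ _ _ _ nu (fun z => complex.Im (f z)) m2).
Qed.

Lemma Cmeasurable_fhat g : Cmeasurable g -> Cmeasurable (fhat g).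
Proof. by move=> mg; exact: (Cmeasurable_Cintegral2 lb (Cmeasurable_fhat_integrand mg)). Qed.

Lemma Cintegrable_fhat g t : Cintegrable lb g ->
  Cintegrable lb (fun x => g x * expi (2 * pi * dot x t)).
Proof.
move=> g1; apply: (CintegrableMb (M := 1)) => //; last by move=> x; rewrite normc_expi.
apply: Cmeasurable_expi; apply: measurable_funM; first exact: measurable_cst.
by apply: measurable_dot => //; exact: measurable_cst.
Qed.

(* The Zak transform of [g], when [g] is supported in the cubes indexed by [s]. *)
Definition gzak s g t x : R[i] :=
  \sum_(k <- s) g (addv (intv k) x) * expi (2 * pi * dot (addv (intv k) x) t).

(** The values of the Fourier transform on the coset t + Z^n are Fourier coefficients on the torus,
    because exp(2 pi i k.m) = 1 for integer k and m. *)
Lemma fhat_gzak s g m t : uniq s -> fsupp s g -> Cintegrable lb g ->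
  fhat g (addv (intv m) t) = gh (gzak s g t) m.
Proof.
move=> us gs g1; rewrite /fhat (Cintegral_fsupp us); last 2 first.
- by move=> x xs; rewrite gs// mul0r.
- exact: Cintegrable_fhat.
have torus_int k (f : Rn -> R[i]) : Cintegrable lb f -> Cintegrable mu (fun x => f (addv (intv k) x)).
  move=> [mf f1]; have mfk : Cmeasurable (fun x => f (addv (intv k) x)).
    by apply: (Cmeasurable_comp mf); exact: measurable_addvl.
  split => //; apply: le_lt_trans f1.
  rewrite /nrm1 integral_torus; last 2 first.
  - exact: measurable_enormc.
  - by move=> x; rewrite lee_fin normc_ge0.
  rewrite -(@integral_translate _ _ (intv k) (fun x => (Normc.normc (f x))%:E)); last 2 first.
  - exact: measurable_enormc.
  - by move=> x; rewrite lee_fin normc_ge0.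
  apply: ge0_subset_integral => //.
  - exact: measurable_cube.
  - by apply: measurable_enormc.
  - by move=> x _; rewrite lee_fin normc_ge0.
have i1 k := torus_int k _ (Cintegrable_fhat (addv (intv m) t) g1).
rewrite -(Cintegral_sum s i1).2; apply: eq_Cintegral => x.
rewrite /gzak mulr_suml; apply: eq_bigr => k _.
rewrite -(mulrA (g _)); congr (_ * _); rewrite /ez.
set kx := addv (intv k) x.
have -> : 2 * pi * dot kx (addv (intv m) t) =
    2 * pi * dot kx t + (2 * pi * dot (intv k) (intv m) + 2 * pi * dot (intv m) x).
  by rewrite dotDr {1}/kx dotDl (dotC x); ring.
by rewrite !expiD expi_dot_int mul1r.
Qed.

Lemma Cmeasurable_gzak s g : Cmeasurable g ->
  Cmeasurable (fun z : Rn * Rn => gzak s g z.1 z.2).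
Proof.
move=> mg; apply: Cmeasurable_sum => k.
have mk : measurable_fun setT (fun z : Rn * Rn => addv (intv k) z.2).
  by apply: measurable_addvE => //; exact: measurable_cst.
apply: CmeasurableM; first exact: (Cmeasurable_comp mg mk).
apply: Cmeasurable_expi; apply: measurable_funM; first exact: measurable_cst.
exact: measurable_dot.
Qed.

Lemma qn_torus_addv k g : Cmeasurable g ->
  (qn mu (fun x => g (addv (intv k) x)) <= qn lb g)%E.
Proof.
move=> mg; have mgk : Cmeasurable (fun x => g (addv (intv k) x)).
  by apply: (Cmeasurable_comp mg); exact: measurable_addvl.
rewrite /qn integral_torus; last 2 first.
- exact: measurable_esqc.
- by move=> x; rewrite lee_fin sqc_ge0.
rewrite -[leRHS](@integral_translate _ _ (intv k) (fun x => (sqc (g x))%:E)); last 2 first.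
- exact: measurable_esqc.
- by move=> x; rewrite lee_fin sqc_ge0.
apply: ge0_subset_integral => //.
- exact: measurable_cube.
- exact: measurable_esqc.
- by move=> x _; rewrite lee_fin sqc_ge0.
Qed.

Lemma qn_gzak s g t : Cmeasurable g -> (qn lb g < +oo)%E -> (qn mu (gzak s g t) < +oo)%E.
Proof.
move=> mg qg; rewrite /gzak.
have mt k : Cmeasurable (fun x => g (addv (intv k) x) * expi (2 * pi * dot (addv (intv k) x) t)).
  have mk := @measurable_addvl (intv k).
  apply: CmeasurableM; first exact: (Cmeasurable_comp mg mk).
  apply: Cmeasurable_expi; apply: measurable_funM; first exact: measurable_cst.
  by apply: measurable_dot => //; exact: measurable_cst.
elim: s => [|k s ih].
  by under eq_fun do rewrite big_nil; rewrite qn0.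
under eq_fun do rewrite big_cons; apply: qnD_lty => //; first exact: Cmeasurable_sum.
rewrite (@eq_qn _ _ _ _ _ (fun x => g (addv (intv k) x))).
  exact: le_lt_trans (qn_torus_addv _ mg) qg.
by move=> x; rewrite sqcM sqc_expi mulr1.
Qed.

Lemma sqc_conj (z : R[i]) : sqc (conjc z) = sqc z.
Proof. by case: z => a b; rewrite /sqc/= sqrrN. Qed.

(** For fixed [x], and up to conjugation and the unimodular factor exp(2 pi i x.t), the Zak
    transform is a trigonometric polynomial in [t] whose coefficients are the values of [g] on x +
    Z^n. *)
Lemma sqc_gzak s g t x : sqc (gzak s g t x) =
  sqc (tpoly s (fun k => conjc (g (addv (intv k) x))) t).
Proof.
rewrite -[LHS]mul1r -(sqc_expi (- (2 * pi * dot x t))) -sqcM -sqc_conj; congr sqc.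
rewrite /gzak mulr_sumr conjc_sum; apply: eq_bigr => k _.
rewrite -conjcM; congr conjc; rewrite mulrCA; congr (_ * _).
by rewrite -expiD dotDl /ez; congr expi; ring.
Qed.

(** The squared norm of the Zak transform over T^n x T^n is computed in two ways. Parseval in [x]
    for fixed [t] gives the norm of [fhat g]; orthogonality in [t] for fixed [x] gives the norm of
    [g]. *)
Lemma plancherel_fsupp s g : uniq s -> fsupp s g -> Cintegrable lb g -> (qn lb g < +oo)%E ->
  qn lb (fhat g) = qn lb g.
Proof.
move=> us gs g1 qg; have [mg _] := g1.
have mf := Cmeasurable_fhat mg.
rewrite /qn cube_decomp; last 2 first.
- exact: measurable_esqc.
- by move=> x; rewrite lee_fin sqc_ge0.
rewrite [RHS]cube_decomp; last 2 first.
- exact: measurable_esqc.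
- by move=> x; rewrite lee_fin sqc_ge0.
rewrite -integral_zsum; last 2 first.
- move=> m; apply: measurable_esqc; apply: (Cmeasurable_comp mf); exact: measurable_addvl.
- by move=> m x; rewrite lee_fin sqc_ge0.
rewrite (zsum_fin us); last 2 first.
- by move=> m; apply: integral_ge0 => x _; rewrite lee_fin sqc_ge0.
- move=> m ms; rewrite integral_torus; last 2 first.
  + apply: measurable_esqc; apply: (Cmeasurable_comp mg); exact: measurable_addvl.
  + by move=> x; rewrite lee_fin sqc_ge0.
  apply: integral0_eq => x cx; rewrite gs ?sqc0//.
  rewrite -(_ : m = zfloor (addv (intv m) x))//.
  by apply/cube_zfloor; rewrite subvK.
have mz := Cmeasurable_gzak s mg.
transitivity (\int[mu]_t \int[mu]_x (sqc (gzak s g t x))%:E)%E.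
  apply: eq_integral => t _.
  under eq_zsum do rewrite (fhat_gzak _ _ us gs g1).
  rewrite parseval//; last exact: qn_gzak.
  by case: mz => m1 m2; split; [exact: (measurable_pairl t m1)|exact: (measurable_pairl t m2)].
rewrite -(@tonelli1 _ _ _ _ _ mu mu (fun z => (sqc (gzak s g z.1 z.2))%:E)); last 2 first.
- exact: measurable_esqc.
- by move=> x; rewrite lee_fin sqc_ge0.
rewrite tonelli2; last 2 first.
- exact: measurable_esqc.
- by move=> x; rewrite lee_fin sqc_ge0.
rewrite -ge0_integral_sum//; last 2 first.
- move=> m; apply: measurable_esqc; apply: (Cmeasurable_comp mg); exact: measurable_addvl.
- by move=> m x _; rewrite lee_fin sqc_ge0.
apply: eq_integral => x _ /=.
under eq_integral do rewrite sqc_gzak.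
rewrite -/(qn _ _) qn_tpoly// sumEFin; congr EFin.
by apply: eq_bigr => k _; rewrite sqc_conj.
Qed.

Lemma tail_cvg0 (h : Rn -> R) : measurable_fun setT h -> (forall x, 0 <= h x) ->
  (\int[lb]_x (h x)%:E < +oo)%E ->
  (\int[lb]_x (h x * (zfloor x \notin zfirst N)%:R)%:E)%E @[N --> \oo] --> 0%E.
Proof.
move=> mh h0 hfin.
have E (N : nat) x : (zfloor x \notin zfirst N)%:R = 1 - \sum_(k <- zfirst N) chi k x :> R.
  have [xs|xs] := boolP (zfloor x \in zfirst N).
    rewrite (bigD1_seq (zfloor x))//= ?zfirst_uniq// big1; last first.
      by move=> k /negbTE kx; rewrite /chi eq_sym kx.
    by rewrite /chi eqxx addr0 subrr.
  rewrite big1_seq ?subr0// => k /andP[_ ks]; rewrite /chi; case: eqP => // xk.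
  by rewrite xk ks in xs.
have mN N : measurable_fun setT (fun x => (h x * (zfloor x \notin zfirst N)%:R)%:E).
  apply/measurable_EFinP; apply: measurable_funM => //.
  under eq_fun do rewrite E.
  apply: measurable_funB; first exact: measurable_cst.
  by apply: measurable_sum => k; exact: measurable_chi.
rewrite -(@integral0 _ _ _ lb setT).
apply: (@dominated_cvg _ _ _ lb setT measurableT _ _ (fun x => (h x)%:E)) => //.
- move=> x _; apply: cvg_near_cst; exists (choice.pickle (zfloor x)).+1 => // N /= hN.
  by rewrite mem_zfirst (leq_trans _ hN)//= mulr0.
- apply/integrableP; split; first exact/measurable_EFinP.
  by under eq_integral do rewrite gee0_abs ?lee_fin//.
- move=> N x _; rewrite gee0_abs ?lee_fin ?mulr_ge0//.
  by rewrite ler_piMr//; case: (_ \notin _).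
Qed.

Definition cut N g x : R[i] := if zfloor x \in zfirst N then g x else 0.

Lemma cut_sum N g x : cut N g x = \sum_(k <- zfirst N) Complex (chi k x) 0 * g x.
Proof.
rewrite /cut -mulr_suml sum_Complex; have [xs|xs] := boolP (zfloor x \in zfirst N).
  rewrite (bigD1_seq (zfloor x))//= ?zfirst_uniq// big1; last first.
    by move=> k /negbTE kx; rewrite /chi eq_sym kx.
  by rewrite /chi eqxx addr0 mul1r.
rewrite big1_seq ?mul0r// => k /andP[_ ks]; rewrite /chi; case: eqP => // xk.
by rewrite xk ks in xs.
Qed.

Lemma Cintegrable_cut N g : Cintegrable lb g -> Cintegrable lb (cut N g).
Proof.
move=> g1; rewrite (_ : cut N g = (fun x => \sum_(k <- zfirst N) Complex (chi k x) 0 * g x)).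
  exact: (Cintegral_sum (zfirst N) (fun k => CintegrableM_chi k g1)).1.
by apply/funext => x; exact: cut_sum.
Qed.

Lemma fsupp_cut N g : fsupp (zfirst N) (cut N g).
Proof. by move=> x xs; rewrite /cut (negbTE xs). Qed.

Lemma fhatB g h t : Cintegrable lb g -> Cintegrable lb h ->
  fhat (fun x => g x - h x) t = fhat g t - fhat h t.
Proof.
move=> g1 h1; rewrite /fhat; under eq_Cintegral do rewrite mulrBl.
by rewrite CintegralB//; exact: Cintegrable_fhat.
Qed.

Lemma cut_cvg1 g : Cintegrable lb g -> forall e : R, 0 < e -> exists N0, forall N, (N0 <= N)%N ->
  (nrm1 lb (fun x => (g x - cut N g x)%R) < e%:E)%E.
Proof.
move=> [mg g1] e e0.
have [N0 hN] := cvge0_lt (tail_cvg0 (measurable_normc mg) (fun x => normc_ge0 _) g1) e0.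
exists N0 => N /hN; congr (_ < _)%E; apply: eq_integral => x _; congr EFin.
by rewrite /cut; case: ifP => _; rewrite ?subrr ?subr0 ?mulr0 ?mulr1// Normc.normc0.
Qed.

Lemma cut_cvg2 g : Cmeasurable g -> (qn lb g < +oo)%E ->
  forall e : R, 0 < e -> exists N0, forall N, (N0 <= N)%N ->
  (qn lb (fun x => (g x - cut N g x)%R) < e%:E)%E.
Proof.
move=> mg qg e e0.
have [N0 hN] := cvge0_lt (tail_cvg0 (measurable_sqc mg) (fun x => sqc_ge0 _) qg) e0.
exists N0 => N /hN; congr (_ < _)%E; apply: eq_integral => x _; congr EFin.
by rewrite /cut; case: ifP => _; rewrite ?subrr ?subr0 ?mulr0 ?mulr1// sqc0.
Qed.

Lemma qn_cut_le N g : Cmeasurable g -> Cmeasurable (cut N g) -> (qn lb (cut N g) <= qn lb g)%E.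
Proof.
move=> mg mc; apply: ge0_le_integral => //.
- by move=> x _; rewrite lee_fin sqc_ge0.
- exact: measurable_esqc.
- exact: measurable_esqc.
- by move=> x _; rewrite lee_fin /cut; case: ifP => // _; rewrite sqc0 sqc_ge0.
Qed.

Lemma fhat_bound g t : Cintegrable lb g ->
  ((Normc.normc (fhat g t))%:E <= 2%:E * nrm1 lb g)%E.
Proof.
move=> g1; apply: le_trans (normc_Cintegral (Cintegrable_fhat t g1)) _.
rewrite (_ : nrm1 _ _ = nrm1 lb g)//; apply: eq_integral => x _.
by rewrite Normc.normcM normc_expi mulr1.
Qed.

(** The truncations converge in L^1, hence their transforms converge at every point, and Fatou's
    lemma applies. It yields an inequality only. *)
Lemma plancherel_le g : Cintegrable lb g -> (qn lb g < +oo)%E -> (qn lb (fhat g) <= qn lb g)%E.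
Proof.
move=> g1 qg; have [mg _] := g1.
have g1N N := Cintegrable_cut N g1.
apply: (@fatou_qn _ _ _ _ (fun N => fhat (cut N g))).
- by move=> N; apply: Cmeasurable_fhat; case: (g1N N).
- exact: Cmeasurable_fhat.
- apply: aeW => t.
  have c : Normc.normc (fhat (cut N g) t - fhat g t) @[N --> \oo] --> (0 : R).
    apply/cvgrPdist_lt => e e0; have [N0 hN] := cut_cvg1 g1 (divr_gt0 e0 (ltr0Sn _ 1)).
    exists N0 => // N N0N; have h := hN N N0N.
    suff H : Normc.normc (fhat (cut N g) t - fhat g t) < e.
      by rewrite /mkset sub0r normrN (ger0_norm (normc_ge0 _)).
    rewrite -fhatB//.
    have := fhat_bound t (CintegrableD (g1N N) (CintegrableN g1)).
    rewrite -lte_fin => /le_lt_trans; apply.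
    rewrite (_ : nrm1 _ _ = nrm1 lb (fun x => g x - cut N g x)); last first.
      apply: eq_integral => x _; congr EFin; rewrite !normcE; congr Num.sqrt.
      by rewrite sqcB.
    move: h (nrm1_ge0 lb (fun x => g x - cut N g x)); case: (nrm1 _ _) => [r| |]//.
    by rewrite -EFinM !lte_fin; lra.
  have cR : complex.Re (fhat (cut N g) t) @[N --> \oo] --> complex.Re (fhat g t).
    apply/cvgrPdist_lt => e e0; move/cvgrPdist_lt/(_ e e0): c; apply: filterS => N.
    rewrite sub0r normrN ger0_norm ?normc_ge0//; apply: le_lt_trans.
    by apply: le_trans (normr_Re_le _); rewrite !ReImE distrC.
  have cI : complex.Im (fhat (cut N g) t) @[N --> \oo] --> complex.Im (fhat g t).
    apply/cvgrPdist_lt => e e0; move/cvgrPdist_lt/(_ e e0): c; apply: filterS => N.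
    rewrite sub0r normrN ger0_norm ?normc_ge0//; apply: le_lt_trans.
    by apply: le_trans (normr_Im_le _); rewrite !ReImE distrC.
  by rewrite /sqc !expr2; apply: cvgD; apply: cvgM.
exists 0%N => N _; rewrite (plancherel_fsupp (zfirst_uniq N) (@fsupp_cut N g))//.
- by apply: qn_cut_le => //; case: (g1N N).
- by apply: le_lt_trans qg; apply: qn_cut_le => //; case: (g1N N).
Qed.

(** The inequality applied to [g] minus its truncation shows that the transforms of the truncations
    converge in L^2 as well, so their equality of norms passes to the limit. *)
Lemma plancherel g : Cintegrable lb g -> (qn lb g < +oo)%E -> qn lb (fhat g) = qn lb g.
Proof.
move=> g1 qg; have [mg _] := g1; have mf := Cmeasurable_fhat mg.
have g1N N := Cintegrable_cut N g1.
have mN N : Cmeasurable (cut N g) by case: (g1N N).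
have qN N : (qn lb (cut N g) < +oo)%E by apply: le_lt_trans qg; exact: qn_cut_le.
apply/eqP; rewrite eq_le plancherel_le//=.
apply: (@qcvg_le _ _ _ _ _ lb lb (fun N => cut N g) g (fun N => fhat (cut N g)) (fhat g)) => //.
- by move=> N; exact: Cmeasurable_fhat.
- move=> e /(cut_cvg2 mg qg)[N0 h]; exists N0 => N /h; rewrite qnB//.
- move=> e /(cut_cvg2 mg qg)[N0 h]; exists N0 => N /h; apply: le_lt_trans.
  rewrite qnB; under eq_qn do rewrite -fhatB//.
  apply: plancherel_le; first by apply: CintegrableD => //; exact: CintegrableN.
  exact: qnB_lty.
- by move=> N; rewrite (plancherel_fsupp (zfirst_uniq N) (@fsupp_cut N g)).
Qed.

End plancherel.

(** * The Weyl kernel *)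

Section qcvg_theory.
Context {R : realType} d (T : measurableType d) (mu : {measure set T -> \bar R}).
Implicit Types (f g : T -> R[i]) (u v : nat -> T -> R[i]).

Lemma qn_triangle f g h : Cmeasurable f -> Cmeasurable g -> Cmeasurable h ->
  (qn mu (fun x => (f x - h x)%R) <=
    2%:E * qn mu (fun x => (f x - g x)%R) + 2%:E * qn mu (fun x => (g x - h x)%R))%E.
Proof.
move=> mf mg mh; have := qnD2 mu (CmeasurableB mf mg) (CmeasurableB mg mh).
by congr (_ <= _)%E; congr qn; apply/funext => x; rewrite addrA subrK.
Qed.

Lemma qn_triangle_lt (e : R) f g h : Cmeasurable f -> Cmeasurable g -> Cmeasurable h ->
  (qn mu (fun x => (f x - g x)%R) < (e / 4)%:E)%E ->
  (qn mu (fun x => (g x - h x)%R) < (e / 4)%:E)%E ->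
  (qn mu (fun x => (f x - h x)%R) < e%:E)%E.
Proof.
by move=> mf mg mh; apply: lte_quarters; [exact: qn_ge0|exact: qn_ge0|exact: qn_triangle].
Qed.

Lemma qcvg_unique u f g : (forall n, Cmeasurable (u n)) -> Cmeasurable f -> Cmeasurable g ->
  qcvg mu u f -> qcvg mu u g -> qn mu (fun x => f x - g x) = 0%E.
Proof.
move=> mu_ mf mg uf ug; apply/eqP; rewrite eq_le qn_ge0 andbT.
apply/lee_addgt0Pr => e e0; rewrite add0e.
have [N hN] := uf _ (divr_gt0 e0 (ltr0Sn _ 3)); have [M hM] := ug _ (divr_gt0 e0 (ltr0Sn _ 3)).
apply/ltW; apply: (qn_triangle_lt mf (mu_ (maxn N M)) mg).
  by rewrite qnB; apply: hN; exact: leq_maxl.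
by apply: hM; exact: leq_maxr.
Qed.

Lemma qcvg_lin (a : R[i]) u v f g : (forall n, Cmeasurable (u n)) -> (forall n, Cmeasurable (v n)) ->
  Cmeasurable f -> Cmeasurable g -> qcvg mu u f -> qcvg mu v g ->
  qcvg mu (fun n x => a * u n x + v n x) (fun x => a * f x + g x).
Proof.
move=> mu_ mv mf mg uf vg e e0; pose b := sqc a + 1.
have b0 : 0 < b by rewrite ltr_pwDr ?sqc_ge0.
have [N hN] := uf _ (divr_gt0 e0 (mulr_gt0 (ltr0Sn _ 3) b0)).
have [M hM] := vg _ (divr_gt0 e0 (ltr0Sn _ 3)).
exists (maxn N M) => k; rewrite geq_max => /andP[/hN + /hM].
rewrite (_ : (fun x => a * u k x + v k x - (a * f x + g x)) =
   (fun x => a * (u k x - f x) + (v k x - g x))); last by apply/funext => x; ring.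
have m1 : Cmeasurable (fun x => u k x - f x) by exact: CmeasurableB.
have m2 : Cmeasurable (fun x => v k x - g x) by exact: CmeasurableB.
have m3 : Cmeasurable (fun x => a * (u k x - f x)).
  exact: CmeasurableZ.
move=> h1 h2; apply: le_lt_trans (qnD2 mu m3 m2) _; rewrite qnZ//.
move: h1 h2 (qn_ge0 mu (fun x => u k x - f x)) (qn_ge0 mu (fun x => v k x - g x)).
set X := qn _ _; set Y := qn _ _; move: X Y => [x| |] [y| |]//.
rewrite -!EFinM -EFinD !lte_fin !lee_fin => h1 h2 x0 y0.
have : x * b < e / 4 by move: h1; rewrite invfM mulrA ltr_pdivlMr.
by rewrite /b; lra.
Qed.

Lemma qcvg_ae u u' f f' : (forall n, Cmeasurable (u n)) -> (forall n, Cmeasurable (u' n)) ->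
  Cmeasurable f -> Cmeasurable f' ->
  (forall n, qn mu (fun x => u' n x - u n x) = 0%E) -> qn mu (fun x => f x - f' x) = 0%E ->
  qcvg mu u f -> qcvg mu u' f'.
Proof.
move=> mu_ mu' mf mf' uu' ff' uf e e0.
(* Two triangle inequalities in a row cost a factor 4, which [e / 5] absorbs. *)
have [N hN] := uf _ (divr_gt0 e0 (ltr0Sn _ 4)); exists N => n /hN h.
apply: le_lt_trans (qn_triangle (mu' n) (mu_ n) mf') _; rewrite uu' mule0 add0e.
apply: le_lt_trans (lee_wpmul2l _ (qn_triangle (mu_ n) mf mf')) _ => //.
rewrite ff' mule0 adde0.
move: h (qn_ge0 mu (fun x => u n x - f x)); set X := qn _ _; move: X => [x| |]//.
by rewrite -!EFinM !lte_fin !lee_fin; lra.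
Qed.

Lemma qcvg_lty u f : (forall n, Cmeasurable (u n)) -> Cmeasurable f ->
  (forall n, qn mu (u n) < +oo)%E -> qcvg mu u f -> (qn mu f < +oo)%E.
Proof.
move=> mu_ mf qu /(_ 1 ltr01)[N /(_ N (leqnn N)) h].
rewrite (_ : f = (fun x => u N x - (u N x - f x))); last by apply/funext => x; ring.
apply: qnB_lty => //; first exact: CmeasurableB.
by apply: lt_trans h _; rewrite ltry.
Qed.

Lemma ge0_integral_lty_ae (f : T -> \bar R) : measurable_fun setT f -> (forall x, 0 <= f x)%E ->
  (\int[mu]_x f x < +oo)%E -> {ae mu, forall x, (f x < +oo)%E}.
Proof.
move=> mf f0 fi; have : mu.-integrable setT f.
  by apply/integrableP; split => //; under eq_integral do rewrite gee0_abs//.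
move=> /(integrable_ae measurableT); apply: filterS => x /(_ I).
by rewrite ge0_fin_numE.
Qed.

(* [f] restricted to [|f|^2 > 1/(j+1)] is integrable as well as square integrable. *)
Definition L12_approx f (j : nat) x : R[i] := if j.+1%:R^-1 < sqc (f x) then f x else 0.

Lemma Cmeasurable_L12_approx f j : Cmeasurable f -> Cmeasurable (L12_approx f j).
Proof.
move=> mf; rewrite (_ : L12_approx f j =
    (fun x => f x * Complex (\1_[set x | j.+1%:R^-1 < sqc (f x)] x) 0)).
  apply: CmeasurableM => //; split => /=; last exact: measurable_cst.
  apply: measurable_indic; have := measurable_sqc mf => ms.
  rewrite (_ : [set x | _] = (fun x => sqc (f x)) @^-1` `]j.+1%:R^-1, +oo[%classic).
    by rewrite -[X in measurable X]setTI; exact: ms.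
  by apply/seteqP; split => x /=; rewrite in_itv/= andbT.
apply/funext => x; rewrite /L12_approx indicE; case: ifP => h.
  by rewrite mem_set//= mulr1.
by rewrite memNset ?mulr0//= h.
Qed.

(** Where |f|^2 > 1/(j+1), also |f| >= 1/(j+1), hence |f| <= (j+1) |f|^2. *)
Lemma L12_approx1 f j : Cmeasurable f -> (qn mu f < +oo)%E -> Cintegrable mu (L12_approx f j).
Proof.
move=> mf qf; have mc := Cmeasurable_L12_approx j mf; split => //.
apply: (@le_lt_trans _ _ (j.+1%:R%:E * qn mu f)%E); last by rewrite lte_mul_pinfty.
rewrite -qn_scale//; apply: ge0_le_integral => //.
- by move=> x _; rewrite lee_fin normc_ge0.
- exact: measurable_enormc.
- by apply: measurable_funeM; exact: measurable_esqc.
move=> x _; rewrite -EFinM lee_fin /L12_approx; case: ifP => [h|_]; last first.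
  by rewrite Normc.normc0 mulr_ge0 ?sqc_ge0.
move: h; rewrite -sqcE; set r := Normc.normc _; have r0 : 0 <= r := normc_ge0 _.
have j0 : 0 < j.+1%:R :> R by [].
rewrite -(ltr_pM2l j0) divff ?gt_eqF// => h.
have j1 : 1 <= j.+1%:R :> R by rewrite ler1n.
move: (j.+1%:R) j0 j1 h => J J0 J1 h.
have h2 : 1 <= J * r.
  rewrite -(@ler_sqr R) ?nnegrE ?mulr_ge0 ?(ltW J0)// expr1n exprMn.
  have : 0 <= (J - 1) * (J * r ^+ 2) by rewrite mulr_ge0 ?subr_ge0// mulr_ge0 ?sqr_ge0// ltW.
  by move: h; lra.
have h3 : 0 <= (J * r - 1) * r by rewrite mulr_ge0 ?subr_ge0.
lra.
Qed.

Lemma L12_approx2 f j : Cmeasurable f -> (qn mu f < +oo)%E -> (qn mu (L12_approx f j) < +oo)%E.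
Proof.
move=> mf qf; apply: le_lt_trans qf; apply: ge0_le_integral => //.
- by move=> x _; rewrite lee_fin sqc_ge0.
- by apply: measurable_esqc; exact: Cmeasurable_L12_approx.
- exact: measurable_esqc.
- by move=> x _; rewrite lee_fin /L12_approx; case: ifP => // _; rewrite sqc0 sqc_ge0.
Qed.

Lemma L12_approx_cvg f : Cmeasurable f -> (qn mu f < +oo)%E -> qcvg mu (L12_approx f) f.
Proof.
move=> mf qf; apply: cvge0_lt.
have mB j : Cmeasurable (fun x => L12_approx f j x - f x).
  by apply: CmeasurableB => //; exact: Cmeasurable_L12_approx.
rewrite -(@integral0 _ _ _ mu setT).
apply: (@dominated_cvg _ _ _ mu setT measurableT _ _ (fun x => (sqc (f x))%:E)) => //.
- by move=> j; exact: measurable_esqc.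
- move=> x _; have [f0|f0] := eqVneq (sqc (f x)) 0.
    apply: cvg_near_cst; apply: nearW => j.
    by rewrite /L12_approx (sqc_eq0 f0) if_same subrr sqc0.
  have fp : 0 < sqc (f x) by rewrite lt_neqAle eq_sym f0 sqc_ge0.
  apply: cvg_near_cst; have := near_infty_natSinv_lt (PosNum fp); apply: filterS => j /= hj.
  by rewrite /L12_approx hj subrr sqc0.
- apply/integrableP; split; first exact: measurable_esqc.
  by under eq_integral do rewrite gee0_abs ?lee_fin ?sqc_ge0//.
- move=> j x _; rewrite gee0_abs ?lee_fin ?sqc_ge0// /L12_approx; case: ifP => _.
    by rewrite subrr sqc0 sqc_ge0.
  by rewrite sub0r sqcN.
Qed.

End qcvg_theory.

Section weyl_kernel.
Context {R : realType} {n : nat}.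
Local Notation Rn := (n.-tuple R).
Local Notation R2n := (Rn * Rn)%type.
Local Notation Zn := (n.-tuple int).
Local Notation lb := (@leb R n).
Local Notation lb2 := (@leb2 R n).
Implicit Types (phi psi u v K L F : R2n -> R[i]) (x y : Rn) (k l : Zn).

Lemma measurable_shear : measurable_fun setT (fun z : R2n => (z.1, addv z.1 z.2)).
Proof. by apply/measurable_fun_pair => //=; exact: measurable_addvE. Qed.

(* The substitution [(xi, eta) = (xi, xi + y)]. *)
Lemma qn_shear F : Cmeasurable F -> qn lb2 F = (\int[lb]_y qn lb (fun x => F (x, addv x y)))%E.
Proof.
move=> mF; have mS := measurable_esqc mF.
have F0 z : (0 <= (sqc (F z))%:E)%E by rewrite lee_fin sqc_ge0.
have mS' : measurable_fun setT (fun z : R2n => (sqc (F (z.1, addv z.1 z.2)))%:E).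
  exact: (measurableT_comp mS measurable_shear).
rewrite /qn /leb2 (tonelli1 lb lb mS F0).
transitivity (\int[lb]_x \int[lb]_y (sqc (F (x, addv x y)))%:E)%E.
  apply: eq_integral => x _.
  by rewrite (@integral_translate _ _ x (fun y => (sqc (F (x, y)))%:E))//; exact: (measurable_pairl x mS).
rewrite -(@tonelli1 _ _ _ _ _ lb lb (fun z => (sqc (F (z.1, addv z.1 z.2)))%:E))//.
by rewrite tonelli2.
Qed.

Lemma nrm1_slices u : Cintegrable lb2 u ->
  {ae lb, forall y, Cintegrable lb (fun x => u (x, y))}.
Proof.
move=> [mu_ u1]; have mn := measurable_enormc mu_.
have n0 z : (0 <= (Normc.normc (u z))%:E)%E by rewrite lee_fin normc_ge0.
move: u1; rewrite /nrm1 /leb2 tonelli2// => u1.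
have := ge0_integral_lty_ae (measurable_integral2 lb mn n0) (fun y => integral_ge0 _ (fun x _ => n0 (x, y))) u1.
apply: filterS => y h; split => //.
by case: mu_ => m1 m2; split; [exact: (measurable_pairr y m1)|exact: (measurable_pairr y m2)].
Qed.

Lemma qn_slices u : Cmeasurable u -> (qn lb2 u < +oo)%E ->
  {ae lb, forall y, (qn lb (fun x => u (x, y)) < +oo)%E}.
Proof.
move=> mu_ u1; have mn := measurable_esqc mu_.
have n0 z : (0 <= (sqc (u z))%:E)%E by rewrite lee_fin sqc_ge0.
move: u1; rewrite /qn /leb2 tonelli2// => u1.
exact: (ge0_integral_lty_ae (measurable_integral2 lb mn n0) (fun y => integral_ge0 _ (fun x _ => n0 (x, y))) u1).
Qed.

Local Notation wki := (@weyl_kernel_int R n).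

Lemma Cmeasurable_wki u : Cmeasurable u -> Cmeasurable (wki u).
Proof.
move=> mu_.
apply: (Cmeasurable_Cintegral2 lb (f := fun w : R2n * Rn =>
   u (w.2, subv w.1.2 w.1.1) * expi (pi * dot w.2 (addv w.1.1 w.1.2)))).
have m11 : measurable_fun setT (fun w : R2n * Rn => w.1.1) by exact: measurableT_comp.
have m12 : measurable_fun setT (fun w : R2n * Rn => w.1.2) by exact: measurableT_comp.
apply: CmeasurableM.
  apply: (Cmeasurable_comp mu_ (h := fun w : R2n * Rn => (w.2, subv w.1.2 w.1.1))).
  by apply/measurable_fun_pair => //=; exact: measurable_subvE.
apply: Cmeasurable_expi; apply: measurable_funM; first exact: measurable_cst.
by apply: measurable_dot => //; exact: measurable_addvE.
Qed.

(** In sheared coordinates the phase pi t.(2x + y) splits into 2 pi t.x, the Fourier phase, and pi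
    t.y, a unimodular twist of the slice at [y]. This is what reduces the Weyl kernel to Plancherel
    in one variable. *)
Lemma wki_shear u x y : wki u (x, addv x y) = fhat (fun t => u (t, y) * expi (pi * dot t y)) x.
Proof.
rewrite /weyl_kernel_int /fhat; apply: eq_Cintegral => t /=.
rewrite subvK -mulrA -expiD; congr (_ * expi _).
by rewrite !dotDr; ring.
Qed.

Lemma twist_slice u y (e : Rn -> R) : measurable_fun setT e ->
  Cintegrable lb (fun x => u (x, y)) -> Cintegrable lb (fun t => u (t, y) * expi (e t)).
Proof.
move=> me u1; apply: (CintegrableMb (M := 1)) => //; first exact: Cmeasurable_expi.
by move=> t; rewrite normc_expi.
Qed.

Lemma measurable_phase y : measurable_fun setT (fun t : Rn => pi * dot t y).
Proof.
apply: measurable_funM; first exact: measurable_cst.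
by apply: measurable_dot => //; exact: measurable_cst.
Qed.

Lemma qn_wki u : Cintegrable lb2 u -> (qn lb2 u < +oo)%E -> qn lb2 (wki u) = qn lb2 u.
Proof.
move=> u1 u2; have [mu_ _] := u1; have mw := Cmeasurable_wki mu_.
have mS := measurable_esqc mw.
rewrite qn_shear// /qn /leb2 tonelli2; last 2 first.
- exact: measurable_esqc.
- by move=> z; rewrite lee_fin sqc_ge0.
apply: ge0_ae_eq_integral => //.
- apply: (measurable_integral2 lb (f := fun z => (sqc (wki u (z.1, addv z.1 z.2)))%:E)).
    exact: (measurableT_comp mS measurable_shear).
  by move=> z; rewrite lee_fin sqc_ge0.
- apply: (measurable_integral2 lb (f := fun z => (sqc (u z))%:E)).
    exact: measurable_esqc.
  by move=> z; rewrite lee_fin sqc_ge0.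
- by move=> y _; exact: qn_ge0.
- by move=> y _; exact: qn_ge0.
apply: filterS2 (nrm1_slices u1) (qn_slices mu_ u2) => y h1 h2 _.
have q2 : qn lb (fun t => u (t, y) * expi (pi * dot t y)) = qn lb (fun t => u (t, y)).
  by apply: eq_qn => t; rewrite sqcM sqc_expi mulr1.
under eq_integral do rewrite wki_shear.
rewrite -/(qn lb _) plancherel ?q2//.
exact: twist_slice (measurable_phase y) h1.
Qed.

(** Linearity is stated up to a null set because it is derived slice by slice, and the slices are
    known to be integrable only for almost every [y]. *)
Lemma wki_lin (a : R[i]) u v : Cintegrable lb2 u -> Cintegrable lb2 v ->
  qn lb2 (fun z => wki (fun w => a * u w + v w) z - (a * wki u z + wki v z)) = 0%E.
Proof.
move=> u1 v1; have [mu_ _] := u1; have [mv _] := v1.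
have muv : Cmeasurable (fun w => a * u w + v w).
  exact: Cmeasurable_lin.
have mm : Cmeasurable (fun z => wki (fun w => a * u w + v w) z - (a * wki u z + wki v z)).
  by apply: CmeasurableB; [|apply: Cmeasurable_lin]; exact: Cmeasurable_wki.
rewrite qn_shear//.
transitivity (\int[lb]_y (cst 0%E y))%E; last by rewrite integral0.
apply: ge0_ae_eq_integral => //.
- apply: (measurable_integral2 lb (f := fun z => (sqc (wki (fun w => a * u w + v w) (z.1, addv z.1 z.2)
      - (a * wki u (z.1, addv z.1 z.2) + wki v (z.1, addv z.1 z.2))))%:E)).
    exact: (measurableT_comp (measurable_esqc mm) measurable_shear).
  by move=> z; rewrite lee_fin sqc_ge0.
- by move=> y _; exact: qn_ge0.
apply: filterS2 (nrm1_slices u1) (nrm1_slices v1) => y h1 h2 _.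
rewrite -[RHS](qn0 lb); apply: eq_qn => x; congr sqc.
rewrite !wki_shear /fhat -CintegralZ; last first.
  exact: Cintegrable_fhat (twist_slice (measurable_phase y) h1).
rewrite -CintegralD; last 2 first.
- by apply: CintegrableZ; exact: Cintegrable_fhat (twist_slice (measurable_phase y) h1).
- exact: Cintegrable_fhat (twist_slice (measurable_phase y) h2).
by apply/eqP; rewrite subr_eq0; apply/eqP; apply: eq_Cintegral => t; ring.
Qed.

(* The predicate from which [weyl_kernel phi] is chosen. *)
Definition isWK phi K := LpC lb2 2%:E K /\ exists u : nat -> R2n -> R[i],
  [/\ (forall j, LpC lb2 1%:E (u j) /\ LpC lb2 2%:E (u j)),
      L2norm lb2 (fun z => u j z - phi z) @[j --> \oo] --> 0%E &
      L2norm lb2 (fun z => wki (u j) z - K z) @[j --> \oo] --> 0%E].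

Lemma isWKP phi K : isWK phi K <-> [/\ Cmeasurable K, (qn lb2 K < +oo)%E & exists u : nat -> R2n -> R[i],
  [/\ (forall j, Cintegrable lb2 (u j)), (forall j, (qn lb2 (u j) < +oo)%E),
      qcvg lb2 u phi & qcvg lb2 (fun j => wki (u j)) K]].
Proof.
split.
  move=> [/LpC2P[mK qK]] [u [u12 /L2norm_cvgP c1 /L2norm_cvgP c2]]; split => //.
  exists u; split => // j; have [/LpC1P h1 /LpC2P[h2 h3]] := u12 j => //.
move=> [mK qK [u [u1 u2 c1 c2]]]; split; first exact/LpC2P.
exists u; split; [|exact/L2norm_cvgP|exact/L2norm_cvgP].
by move=> j; split; [exact/LpC1P|apply/LpC2P; split => //; case: (u1 j)].
Qed.

(** By linearity and isometry, the kernels of the truncations are at the same distance from one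
    another as the truncations themselves; completeness provides the limit. *)
Lemma isWK_exists phi : Cmeasurable phi -> (qn lb2 phi < +oo)%E -> exists K, isWK phi K.
Proof.
move=> mphi qphi; pose u := L12_approx phi.
have u1 j : Cintegrable lb2 (u j) by exact: L12_approx1.
have u2 j : (qn lb2 (u j) < +oo)%E by exact: L12_approx2.
have mu_ j : Cmeasurable (u j) by case: (u1 j).
have cu : qcvg lb2 u phi by exact: L12_approx_cvg.
have mw j : Cmeasurable (wki (u j)) by exact: Cmeasurable_wki.
have qw i j : qn lb2 (fun z => wki (u i) z - wki (u j) z) = qn lb2 (fun z => u i z - u j z).
  have i1 : Cintegrable lb2 (fun w => (-1) * u j w + u i w).
    by apply: CintegrableD => //; exact: CintegrableZ.
  have E : (fun z => u i z - u j z) = (fun w => (-1) * u j w + u i w).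
    by apply/funext => z; ring.
  have q1 : (qn lb2 (fun w => ((-1) * u j w + u i w)%R) < +oo)%E by rewrite -E; exact: qnB_lty.
  rewrite E -(qn_wki i1 q1); apply: ae_eq_qn.
  - exact: CmeasurableB.
  - by apply: Cmeasurable_wki; case: i1.
  have mL : Cmeasurable (fun z => (-1) * wki (u j) z + wki (u i) z).
    exact: Cmeasurable_lin.
  have := (qn_ae_eq lb2 (Cmeasurable_wki (proj1 i1)) mL).1 (wki_lin (-1) (u1 j) (u1 i)).
  by apply: filterS => z h _; rewrite h//; ring.
have [|K mK cK] := @riesz_fischer _ _ _ lb2 (fun j => wki (u j)) mw.
  move=> e e0; have [N hN] := cu _ (divr_gt0 e0 (ltr0Sn _ 3)).
  exists N => i j /hN h1 /hN h2; rewrite qw.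
  by apply: (qn_triangle_lt (mu_ i) mphi (mu_ j)) => //; rewrite qnB.
exists K; apply/isWKP; split => //; last by exists u.
by apply: qcvg_lty cK => // j; rewrite qn_wki.
Qed.

Lemma isWK_qn phi K : Cmeasurable phi -> isWK phi K -> qn lb2 K = qn lb2 phi.
Proof.
move=> mphi /isWKP[mK qK [u [u1 u2 c1 c2]]].
have mu_ j : Cmeasurable (u j) by case: (u1 j).
have mw j : Cmeasurable (wki (u j)) by exact: Cmeasurable_wki.
apply/eqP; rewrite eq_le; apply/andP; split.
  by apply: (qcvg_le mw mu_ mK mphi c2 c1) => j; rewrite qn_wki.
by apply: (qcvg_le mu_ mw mphi mK c1 c2) => j; rewrite qn_wki.
Qed.

Lemma isWK_lin (a : R[i]) phi psi K L : Cmeasurable phi -> Cmeasurable psi ->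
  isWK phi K -> isWK psi L ->
  isWK (fun z => a * phi z + psi z) (fun z => a * K z + L z).
Proof.
move=> mphi mpsi /isWKP[mK qK [u [u1 u2 cu cK]]] /isWKP[mL qL [v [v1 v2 cv cL]]].
have mu_ j : Cmeasurable (u j) by case: (u1 j).
have mv j : Cmeasurable (v j) by case: (v1 j).
have mw j : Cmeasurable (wki (u j)) by exact: Cmeasurable_wki.
have mw' j : Cmeasurable (wki (v j)) by exact: Cmeasurable_wki.
have ql (f g : R2n -> R[i]) : Cmeasurable f -> Cmeasurable g -> (qn lb2 f < +oo)%E -> (qn lb2 g < +oo)%E ->
    (qn lb2 (fun z => (a * f z + g z)%R) < +oo)%E.
  move=> mf mg qf qg; apply: qnD_lty => //.
    exact: CmeasurableZ.
  by rewrite qnZ// lte_mul_pinfty// lee_fin sqc_ge0.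
apply/isWKP; split; [exact: Cmeasurable_lin|exact: ql|].
exists (fun j z => a * u j z + v j z); split.
- by move=> j; apply: CintegrableD => //; exact: CintegrableZ.
- by move=> j; exact: ql.
- exact: qcvg_lin.
apply: (qcvg_ae (u := fun j z => a * wki (u j) z + wki (v j) z) (f := fun z => a * K z + L z)).
- by move=> j; exact: Cmeasurable_lin.
- by move=> j; apply: Cmeasurable_wki; exact: Cmeasurable_lin.
- exact: Cmeasurable_lin.
- exact: Cmeasurable_lin.
- by move=> j; exact: wki_lin.
- by rewrite -[RHS](qn0 lb2); apply: eq_qn => z; rewrite subrr.
- exact: qcvg_lin.
Qed.

Lemma isWK_ae phi psi K L : Cmeasurable phi -> Cmeasurable psi ->
  qn lb2 (fun z => phi z - psi z) = 0%E -> isWK phi K -> isWK psi L ->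
  qn lb2 (fun z => K z - L z) = 0%E.
Proof.
move=> mphi mpsi e hK hL.
have := isWK_qn _ (isWK_lin (-1) mphi mpsi hK hL).
have E (f g : R2n -> R[i]) : qn lb2 (fun z => (-1) * f z + g z) = qn lb2 (fun z => f z - g z).
  by rewrite qnB; congr qn; apply/funext => z; ring.
rewrite !E e; apply.
exact: Cmeasurable_lin.
Qed.

End weyl_kernel.

Lemma ge0_ae0_integral {R : realType} d (T : measurableType d)
    (mu : {measure set T -> \bar R}) (f : T -> \bar R) :
  measurable_fun setT f -> (forall x, 0 <= f x)%E -> {ae mu, forall x, f x = 0%E} ->
  (\int[mu]_x f x = 0)%E.
Proof.
move=> mf f0 fae; transitivity (\int[mu]_x (cst 0%E x))%E; last by rewrite integral0.
by apply: ge0_ae_eq_integral => //; apply: filterS fae => x h _.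
Qed.

(** * Twisted translations and Weyl kernels *)

Section twisted_kernel.
Context {R : realType} {n : nat}.
Local Notation Rn := (n.-tuple R).
Local Notation R2n := (Rn * Rn)%type.
Local Notation Zn := (n.-tuple int).
Local Notation lb := (@leb R n).
Local Notation lb2 := (@leb2 R n).
Local Notation wki := (@weyl_kernel_int R n).
Implicit Types (phi psi u v K L F : R2n -> R[i]) (x y : Rn) (k l : Zn).

Lemma integral_leb2_addv (a b : Rn) (f : R2n -> \bar R) :
  measurable_fun setT f -> (forall z, 0 <= f z)%E ->
  (\int[lb2]_z f (addv a z.1, addv b z.2) = \int[lb2]_z f z)%E.
Proof.
move=> mf f0.
have mS : measurable_fun setT (fun z : R2n => (addv a z.1, addv b z.2)).
  by apply/measurable_fun_pair => /=; apply: measurable_addvE => //; exact: measurable_cst.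
rewrite /leb2 tonelli1//; last exact: (measurableT_comp mf mS).
rewrite [RHS](tonelli1 lb lb mf f0).
transitivity (\int[lb]_x \int[lb]_y f (addv a x, y))%E.
  apply: eq_integral => x _.
  by rewrite (@integral_translate _ _ b (fun y => f (addv a x, y)))//; exact: (measurable_pairl _ mf).
rewrite (@integral_translate _ _ a (fun x => \int[lb]_y f (x, y))%E)//.
  exact: measurable_integral1.
by move=> x; exact: integral_ge0.
Qed.

Local Notation TT := (@twisted_translation R n).

Lemma Cmeasurable_shift2 (a b : Rn) phi : Cmeasurable phi ->
  Cmeasurable (fun z : R2n => phi (addv a z.1, addv b z.2)).
Proof.
move=> mphi; apply: (Cmeasurable_comp mphi (h := fun z : R2n => (addv a z.1, addv b z.2))).
by apply/measurable_fun_pair => /=; apply: measurable_addvE => //; exact: measurable_cst.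
Qed.

Lemma qn_shift2 (a b : Rn) phi : Cmeasurable phi ->
  qn lb2 (fun z : R2n => phi (addv a z.1, addv b z.2)) = qn lb2 phi.
Proof.
move=> mphi; apply: (integral_leb2_addv a b (measurable_esqc mphi)) => z.
by rewrite lee_fin sqc_ge0.
Qed.

Lemma Cmeasurable_TT k l phi : Cmeasurable phi -> Cmeasurable (TT k l phi).
Proof.
move=> mphi; apply: CmeasurableM.
  apply: Cmeasurable_expi; apply: measurable_funM; first exact: measurable_cst.
  by apply: measurable_funB; apply: measurable_dot => //; exact: measurable_cst.
rewrite (_ : (fun _ => _) = (fun z : R2n => phi (addv (oppv (intv k)) z.1, addv (oppv (intv l)) z.2))).
  exact: Cmeasurable_shift2.
by apply/funext => z; rewrite !addv_oppv.
Qed.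

Lemma qn_TT k l phi : Cmeasurable phi -> qn lb2 (TT k l phi) = qn lb2 phi.
Proof.
move=> mphi; rewrite -(qn_shift2 (oppv (intv k)) (oppv (intv l)) mphi).
by apply: eq_qn => z; rewrite sqcM sqc_expi mul1r !addv_oppv.
Qed.

Lemma Cintegrable_TT k l phi : Cintegrable lb2 phi -> Cintegrable lb2 (TT k l phi).
Proof.
move=> [mphi p1]; split; first exact: Cmeasurable_TT.
rewrite (_ : nrm1 _ _ = nrm1 lb2 phi)//.
rewrite /nrm1 -[RHS](integral_leb2_addv (oppv (intv k)) (oppv (intv l))).
- by apply: eq_integral => z _; rewrite Normc.normcM normc_expi mul1r !addv_oppv.
- exact: measurable_enormc.
- by move=> z; rewrite lee_fin normc_ge0.
Qed.

Lemma TTB k l phi psi : (fun z => TT k l phi z - TT k l psi z) = TT k l (fun z => phi z - psi z).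
Proof. by apply/funext => z; rewrite -mulrBr. Qed.

(* The action of the twisted translation by (k, l) on Weyl kernels. *)
Definition kshift k l K (z : R2n) : R[i] :=
  expi (pi * (dot (intv k) (intv l) + 2 * dot z.1 (intv k))) * K (addv (intv l) z.1, z.2).

(** A shift in the first variable alone becomes an instance of the shift in both variables. *)
Definition zeroR : Rn := [tuple 0 | _ < n].

Lemma add0v x : addv zeroR x = x.
Proof. by apply: eq_from_tnth => i; rewrite !tnth_mktuple add0r. Qed.

Lemma Cmeasurable_kshift k l K : Cmeasurable K -> Cmeasurable (kshift k l K).
Proof.
move=> mK; apply: CmeasurableM.
  apply: Cmeasurable_expi; apply: measurable_funM; first exact: measurable_cst.
  apply: measurable_funD; first exact: measurable_cst.
  apply: measurable_funM; first exact: measurable_cst.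
  by apply: measurable_dot => //; exact: measurable_cst.
rewrite (_ : (fun _ => _) = (fun z : R2n => K (addv (intv l) z.1, addv zeroR z.2))).
  exact: Cmeasurable_shift2.
by apply/funext => z; rewrite add0v.
Qed.

Lemma qn_kshift k l K : Cmeasurable K -> qn lb2 (kshift k l K) = qn lb2 K.
Proof.
move=> mK; rewrite -(qn_shift2 (intv l) zeroR mK).
by apply: eq_qn => z; rewrite sqcM sqc_expi mul1r add0v.
Qed.

Lemma kshiftB k l K L : (fun z => kshift k l K z - kshift k l L z) = kshift k l (fun z => K z - L z).
Proof. by apply/funext => z; rewrite -mulrBr. Qed.

Lemma Cintegral_subv x (f : Rn -> R[i]) : Cmeasurable f ->
  Cintegral lb (fun t => f (subv t x)) = Cintegral lb f.
Proof.
move=> [m1 m2]; have tr := @integral_subv R n x.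
apply: eq_complexP => /=.
  exact: (@Rintegral_transfer _ _ _ _ _ lb lb (fun t => subv t x) tr).
exact: (@Rintegral_transfer _ _ _ _ _ lb lb (fun t => subv t x) tr).
Qed.

Lemma dotBl x y (t : Rn) : dot (subv x y) t = dot x t - dot y t.
Proof. by rewrite /dot -sumrB; apply: eq_bigr => i _; rewrite tnth_mktuple mulrBl. Qed.

(** The point is written so that both sides involve the slice of [u] at the same [y]. The
    substitution of t - k for t then identifies the integrals, and what remains is an identity
    between phases. *)
Lemma wki_TT_shear k l u x y : Cintegrable lb (fun t => u (t, y)) ->
  wki (TT k l u) (x, addv x (addv (intv l) y)) = kshift k l (wki u) (x, addv x (addv (intv l) y)).
Proof.
move=> u1; rewrite /kshift /weyl_kernel_int /=.
have E : subv (addv x (addv (intv l) y)) (addv (intv l) x) = y.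
  by apply: eq_from_tnth => i; rewrite !tnth_mktuple; ring.
rewrite -CintegralZ; last first.
  rewrite E; apply: (CintegrableMb (M := 1)) => //; last by move=> t; rewrite normc_expi.
  apply: Cmeasurable_expi; apply: measurable_funM; first exact: measurable_cst.
  by apply: measurable_dot => //; exact: measurable_cst.
rewrite -[RHS](Cintegral_subv (intv k)); last first.
  rewrite E; apply: CmeasurableM; first exact: Cmeasurable_cst.
  apply: CmeasurableM; first by case: u1.
  apply: Cmeasurable_expi; apply: measurable_funM; first exact: measurable_cst.
  by apply: measurable_dot => //; exact: measurable_cst.
apply: eq_Cintegral => t; rewrite /twisted_translation /= E subvK.
have -> : subv (addv (intv l) y) (intv l) = y by rewrite subvK.
have e (p q r s : R) (w : R[i]) : p + q = r + s -> expi p * w * expi q = expi r * (w * expi s).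
  by move=> pq; rewrite mulrAC -expiD pq expiD; ring.
apply: e; rewrite !(dotDl, dotDr, dotBl) (dotC y) (dotC (intv l)) (dotC x (intv k)).
by ring.
Qed.

Lemma wki_TT k l u : Cintegrable lb2 u ->
  qn lb2 (fun z => wki (TT k l u) z - kshift k l (wki u) z) = 0%E.
Proof.
move=> u1; have [mu_ _] := u1.
have mm : Cmeasurable (fun z => wki (TT k l u) z - kshift k l (wki u) z).
  apply: CmeasurableB; first by apply: Cmeasurable_wki; exact: Cmeasurable_TT.
  by apply: Cmeasurable_kshift; exact: Cmeasurable_wki.
pose Q y := qn lb (fun x =>
    wki (TT k l u) (x, addv x y) - kshift k l (wki u) (x, addv x y)).
have mI : measurable_fun setT Q.
  apply: (measurable_integral2 lb (f := fun z => (sqc (wki (TT k l u) (z.1, addv z.1 z.2) -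
      kshift k l (wki u) (z.1, addv z.1 z.2)))%:E)).
    exact: (measurableT_comp (measurable_esqc mm) measurable_shear).
  by move=> z; rewrite lee_fin sqc_ge0.
(* The slice of the translated function at l + y is governed by the slice of [u] at [y], so the
   exceptional set is shifted by [l]; translation invariance of the integral removes the shift. *)
have Q0 : {ae lb, forall y, Q (addv (intv l) y) = 0%E}.
  apply: filterS (nrm1_slices u1) => y h.
  rewrite -(qn0 lb); apply: eq_qn => x; congr sqc.
  by rewrite wki_TT_shear// subrr.
have Qp y : (0 <= Q y)%E by exact: qn_ge0.
rewrite (qn_shear mm); change (\int[lb]_y Q y = 0)%E.
move: (Q) mI Q0 Qp => {mm}P mP P0 Pp.
rewrite -(integral_translate (intv l) mP Pp).
by apply: ge0_ae0_integral => //; exact: (measurableT_comp mP (measurable_addvl _)).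
Qed.

Lemma isWK_TT k l phi K : Cmeasurable phi -> isWK phi K -> isWK (TT k l phi) (kshift k l K).
Proof.
move=> mphi /isWKP[mK qK [u [u1 u2 cu cK]]].
have mu_ j : Cmeasurable (u j) by case: (u1 j).
have mw j : Cmeasurable (wki (u j)) by exact: Cmeasurable_wki.
apply/isWKP; split; [exact: Cmeasurable_kshift|by rewrite qn_kshift|].
exists (fun j => TT k l (u j)); split.
- by move=> j; exact: Cintegrable_TT.
- by move=> j; rewrite qn_TT.
- move=> e /cu[N hN]; exists N => j /hN; rewrite TTB qn_TT//; exact: CmeasurableB.
apply: (qcvg_ae (u := fun j => kshift k l (wki (u j))) (f := kshift k l K)).
- by move=> j; exact: Cmeasurable_kshift.
- by move=> j; apply: Cmeasurable_wki; exact: Cmeasurable_TT.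
- exact: Cmeasurable_kshift.
- exact: Cmeasurable_kshift.
- by move=> j; exact: wki_TT.
- by rewrite -[RHS](qn0 lb2); apply: eq_qn => z; rewrite subrr.
- by move=> e /cK[N hN]; exists N => j /hN; rewrite kshiftB qn_kshift//; exact: CmeasurableB.
Qed.

End twisted_kernel.

(** * The Weyl-Zak transform *)

Section zak.
Context {R : realType} {n : nat}.
Local Notation Rn := (n.-tuple R).
Local Notation R2n := (Rn * Rn)%type.
Local Notation R3n := (R2n * Rn)%type.
Local Notation Zn := (n.-tuple int).
Local Notation lb := (@leb R n).
Local Notation lb2 := (@leb2 R n).
Local Notation tor := (@torus R n).
Local Notation zm := (@zak_measure R n).
Implicit Types (K L : R2n -> R[i]) (Z : R3n -> R[i]) (k l m : Zn).

Definition zterm K m (w : R3n) : R[i] :=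
  K (addv (intv m) w.1.1, w.2) * expi (- (2 * pi * dot (intv m) w.1.2)).

Definition zs K (s : seq Zn) (w : R3n) : R[i] := \sum_(m <- s) zterm K m w.

Lemma Cmeasurable_zterm K m : Cmeasurable K -> Cmeasurable (zterm K m).
Proof.
move=> mK.
have m11 : measurable_fun setT (fun w : R3n => w.1.1) by exact: measurableT_comp.
have m12 : measurable_fun setT (fun w : R3n => w.1.2) by exact: measurableT_comp.
apply: CmeasurableM.
  apply: (Cmeasurable_comp mK (h := fun w : R3n => (addv (intv m) w.1.1, w.2))).
  by apply/measurable_fun_pair => //=; apply: measurable_addvE => //; exact: measurable_cst.
apply: Cmeasurable_expi; apply: measurable_funN; apply: measurable_funM; first exact: measurable_cst.
by apply: measurable_dot => //; exact: measurable_cst.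
Qed.

Lemma Cmeasurable_zs K s : Cmeasurable K -> Cmeasurable (zs K s).
Proof. by move=> mK; apply: Cmeasurable_sum => m; exact: Cmeasurable_zterm. Qed.

(** The squared norm of [K] over the strip whose first variable lies in the cube at [m]. The strips
    tile the space, so these masses sum to the squared norm of [K]. *)
Definition zmass K m : \bar R := (\int[lb]_y \int[tor]_x (sqc (K (addv (intv m) x, y)))%:E)%E.

Lemma zmass_ge0 K m : (0 <= zmass K m)%E.
Proof. by apply: integral_ge0 => y _; apply: integral_ge0 => x _; rewrite lee_fin sqc_ge0. Qed.

Lemma measurable_zmass_integrand K m : Cmeasurable K ->
  measurable_fun setT (fun z : R2n => (sqc (K (addv (intv m) z.1, z.2)))%:E).
Proof.
move=> mK; apply: (measurableT_comp (measurable_esqc mK) (g := fun z : R2n => (addv (intv m) z.1, z.2))).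
by apply/measurable_fun_pair => //=; apply: measurable_addvE => //; exact: measurable_cst.
Qed.

Lemma zsum_zmass K : Cmeasurable K -> zsum (zmass K) = qn lb2 K.
Proof.
move=> mK; have mS := measurable_esqc mK.
rewrite /qn /leb2 tonelli2//; last by move=> z; rewrite lee_fin sqc_ge0.
rewrite /zmass -integral_zsum; last 2 first.
- move=> m; apply: (measurable_integral2 tor (measurable_zmass_integrand m mK)) => z.
  by rewrite lee_fin sqc_ge0.
- by move=> m y; apply: integral_ge0 => x _; rewrite lee_fin sqc_ge0.
apply: eq_integral => y _; rewrite cube_decomp//.
  exact: (measurable_pairr y mS).
by move=> x; rewrite lee_fin sqc_ge0.
Qed.

(** For fixed first and last variables, the partial sum is a trigonometric polynomial in the middle
    one, so its terms are orthogonal. *)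
Lemma qn_zs K s : Cmeasurable K -> uniq s -> qn zm (zs K s) = (\sum_(m <- s) zmass K m)%E.
Proof.
move=> mK us; have mz := measurable_esqc (Cmeasurable_zs s mK).
have p0 w : (0 <= (sqc (zs K s w))%:E)%E by rewrite lee_fin sqc_ge0.
rewrite /qn /zak_measure tonelli2//.
rewrite /zmass -ge0_integral_sum//; last 2 first.
- move=> m; apply: (measurable_integral2 tor (measurable_zmass_integrand m mK)) => z.
  by rewrite lee_fin sqc_ge0.
- by move=> m y _; apply: integral_ge0 => x _; rewrite lee_fin sqc_ge0.
apply: eq_integral => y _.
rewrite /torus2 tonelli1//; last exact: (measurable_pairr y mz).
rewrite -ge0_integral_sum//; last 2 first.
- move=> m; exact: (measurable_pairr y (measurable_zmass_integrand m mK)).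
- by move=> m x _; rewrite lee_fin sqc_ge0.
apply: eq_integral => x _; rewrite sumEFin -(qn_tpoly (fun m => K (addv (intv m) x, y)) us).
apply: eq_integral => t _; congr (sqc _)%:E; apply: eq_bigr => m _.
by rewrite /zterm /ez conj_expi.
Qed.

(* The predicate from which [weyl_zak phi] is chosen, for [K] the Weyl kernel of
   [phi]. *)
Definition isWZ K Z := LpC zm 2%:E Z /\
    forall e : R, 0 < e -> exists F0 : {fset Zn}, forall F : {fset Zn},
      fsubset F0 F -> (L2norm zm (fun w => zak_sum K F w - Z w)%R < e%:E)%E.

Lemma isWZP K Z : isWZ K Z <-> [/\ Cmeasurable Z, (qn zm Z < +oo)%E &
  forall e : R, 0 < e -> exists F0 : {fset Zn}, forall F : {fset Zn},
      fsubset F0 F -> (qn zm (fun w => zs K F w - Z w)%R < e%:E)%E].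
Proof.
split.
  move=> [/LpC2P[mZ qZ] h]; split => // e e0.
  have s0 : 0 < Num.sqrt e by rewrite sqrtr_gt0.
  have [F0 hF] := h _ s0; exists F0 => F /hF.
  by rewrite L2norm_lt// sqr_sqrtr// ltW.
move=> [mZ qZ h]; split; first exact/LpC2P.
move=> e e0; have [|F0 hF] := h (e ^+ 2); first by rewrite exprn_gt0.
by exists F0 => F /hF; rewrite L2norm_lt.
Qed.

Lemma zs_perm K s t w : perm_eq s t -> zs K s w = zs K t w.
Proof. by move=> st; rewrite /zs; exact: perm_big. Qed.

Lemma isWZ_qcvg K Z : isWZ K Z -> qcvg zm (fun N => zs K (zfirst N)) Z.
Proof.
move=> /isWZP[mZ qZ h] e /h[F0 hF]; have [N hN] := zfirst_sub F0.
exists N => M NM.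
pose F : {fset Zn} := [fset m in (zfirst M : seq Zn)]%fset.
have P : perm_eq (zfirst M) F.
  apply: uniq_perm; rewrite ?zfirst_uniq ?fset_uniq// => m.
  by rewrite in_fset.
rewrite (@eq_qn _ _ _ _ _ (fun w => zs K F w - Z w)); last by move=> w; rewrite (zs_perm _ _ P).
apply: hF; apply/fsubsetP => m /hN; rewrite in_fset !mem_zfirst => /leq_trans; exact.
Qed.

(** By orthogonality, the distance between two nested partial sums is a tail of the convergent
    series of masses. This gives a Cauchy sequence along [zfirst], then convergence along all finite
    sets that contain some [zfirst N]. *)
Lemma isWZ_exists K : Cmeasurable K -> (qn lb2 K < +oo)%E -> exists Z, isWZ K Z.
Proof.
move=> mK qK; have fin : (zsum (zmass K) < +oo)%E by rewrite zsum_zmass.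
have diff N s : uniq s -> {subset zfirst N <= s} ->
    qn zm (fun w => zs K s w - zs K (zfirst N) w) = (\sum_(m <- s | m \notin zfirst N) zmass K m)%E.
  move=> us Ns; rewrite -big_filter -qn_zs ?filter_uniq//; congr qn; apply/funext => w.
  have P : perm_eq [seq i <- s | i \in zfirst N] (zfirst N).
    apply: uniq_perm; rewrite ?filter_uniq ?zfirst_uniq// => x.
    by rewrite mem_filter andb_idr//; exact: Ns.
  have -> : zs K s w = zs K (zfirst N) w + zs K [seq i <- s | i \notin zfirst N] w.
    by rewrite -(zs_perm K w P) /zs [LHS](bigID [in zfirst N])/= !big_filter.
  by rewrite addrAC subrr add0r.
have sub N M : (N <= M)%N -> {subset (zfirst N : seq Zn) <= zfirst M}.
  by move=> NM m; rewrite !mem_zfirst => /leq_trans; apply.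
have mz s := Cmeasurable_zs s mK.
have [|Z mZ cZ] := @riesz_fischer _ _ _ zm (fun N => zs K (zfirst N)) (fun N => mz _).
  move=> e e0; have [N hN] := zsum_tail (zmass_ge0 K) fin (divr_gt0 e0 (ltr0Sn _ 3)).
  exists N => i j Ni Nj; apply: (qn_triangle_lt (mz _) (mz (zfirst N)) (mz _)).
    by rewrite diff ?zfirst_uniq//; [apply: hN; [exact: zfirst_uniq|exact: sub]|exact: sub].
  by rewrite qnB diff ?zfirst_uniq//; [apply: hN; [exact: zfirst_uniq|exact: sub]|exact: sub].
exists Z; apply/isWZP; split => //.
  apply: qcvg_lty cZ => // N; rewrite qn_zs ?zfirst_uniq//.
  by apply: le_lt_trans fin; apply: le_zsum; [exact: zmass_ge0|exact: zfirst_uniq].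
move=> e e0; have [N1 hN1] := zsum_tail (zmass_ge0 K) fin (divr_gt0 e0 (ltr0Sn _ 3)).
have [N2 hN2] := cZ _ (divr_gt0 e0 (ltr0Sn _ 3)); pose N := maxn N1 N2.
exists [fset m in (zfirst N : seq Zn)]%fset => F /fsubsetP NF.
have sF M : (M <= N)%N -> {subset zfirst M <= F}.
  by move=> MN m mM; apply: NF; rewrite in_fset; exact: (sub _ _ MN).
apply: (qn_triangle_lt (mz _) (mz (zfirst N)) mZ); last exact: hN2 (leq_maxr _ _).
rewrite diff ?fset_uniq//; last exact: sF.
apply: le_lt_trans (hN1 F (fset_uniq F) (sF _ (leq_maxl _ _))).
apply: lee_sum_nneg_subset; last by move=> m *; exact: zmass_ge0.
move=> m; rewrite !unfold_in/=; apply: contraNN; exact: sub (leq_maxl _ _) _.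
Qed.

Lemma isWZ_qn K Z : Cmeasurable K -> isWZ K Z -> qn zm Z = qn lb2 K.
Proof.
move=> mK hZ; have cZ := isWZ_qcvg hZ; have /isWZP[mZ qZ _] := hZ.
have mz s := Cmeasurable_zs s mK.
apply/eqP; rewrite eq_le; apply/andP; split.
  apply: (@qcvg_le _ _ _ _ _ zm lb2 (fun N => zs K (zfirst N)) Z (fun=> K) K) => //.
  - move=> e e0; exists 0%N => _ _; rewrite (@eq_qn _ _ _ _ _ (fun=> 0)) ?qn0 ?lte_fin//.
    by move=> z; rewrite subrr.
  - move=> N; rewrite qn_zs ?zfirst_uniq// -zsum_zmass//.
    by apply: le_zsum; [exact: zmass_ge0|exact: zfirst_uniq].
rewrite -zsum_zmass//; apply: zsum_le; first exact: zmass_ge0.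
move=> s us; have [N hN] := zfirst_sub s.
rewrite -qn_zs//.
apply: (@qcvg_le _ _ _ _ _ zm zm (fun=> zs K s) (zs K s) (fun M => zs K (zfirst (maxn N M))) Z) => //.
- move=> e e0; exists 0%N => _ _; rewrite (@eq_qn _ _ _ _ _ (fun=> 0)) ?qn0 ?lte_fin//.
  by move=> z; rewrite subrr.
- by move=> e /cZ[M hM]; exists M => i Mi; apply: hM; rewrite leq_max Mi orbT.
move=> M; rewrite !qn_zs ?zfirst_uniq//; apply: le_sum_sub => //.
- exact: zmass_ge0.
- exact: zfirst_uniq.
- by move=> m /hN; rewrite !mem_zfirst leq_max => ->.
Qed.

Lemma zs_lin (a : R[i]) K L s w : zs (fun z => a * K z + L z) s w = a * zs K s w + zs L s w.
Proof.
rewrite /zs mulr_sumr -big_split/=; apply: eq_bigr => m _.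
by rewrite /zterm mulrDl mulrA.
Qed.

(** Linearity and insensitivity to null sets in a single statement, since the kernel of a
    combination is a combination of kernels only almost everywhere. The case [a = 0] gives the
    insensitivity alone. *)
Lemma isWZ_lin_ae (a : R[i]) K L M Z Y X : Cmeasurable K -> Cmeasurable L -> Cmeasurable M ->
  qn lb2 (fun z => M z - (a * K z + L z)) = 0%E ->
  isWZ K Z -> isWZ L Y -> isWZ M X ->
  qn zm (fun w => X w - (a * Z w + Y w)) = 0%E.
Proof.
move=> mK mL mM M0 hZ hY hX.
have /isWZP[mZ _ _] := hZ; have /isWZP[mY _ _] := hY; have /isWZP[mX _ _] := hX.
have mzK s := Cmeasurable_zs s mK; have mzL s := Cmeasurable_zs s mL.
have mzM s := Cmeasurable_zs s mM.
have mKL := Cmeasurable_lin a mK mL.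
have cl := qcvg_lin a (fun N => mzK _) (fun N => mzL _) mZ mY (isWZ_qcvg hZ) (isWZ_qcvg hY).
apply: (qcvg_unique (fun N => mzM _) mX (Cmeasurable_lin a mZ mY) (isWZ_qcvg hX)).
apply: (qcvg_ae _ _ _ _ _ _ cl).
- by move=> N; exact: Cmeasurable_lin.
- by move=> N; exact: mzM.
- exact: Cmeasurable_lin.
- exact: Cmeasurable_lin.
- move=> N; apply/eqP; rewrite eq_le qn_ge0 andbT -M0.
  rewrite (@eq_qn _ _ _ _ _ (zs (fun z => M z - (a * K z + L z)) (zfirst N))); last first.
    move=> w; congr sqc; rewrite -zs_lin /zs -sumrB; apply: eq_bigr => m _.
    by rewrite /zterm mulrBl.
  rewrite qn_zs ?zfirst_uniq//; last exact: CmeasurableB.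
  rewrite -zsum_zmass; last exact: CmeasurableB.
  by apply: le_zsum; [exact: zmass_ge0|exact: zfirst_uniq].
- by rewrite -[RHS](qn0 zm); apply: eq_qn => z; rewrite subrr.
Qed.

(** The phase of the character of frequency (k, l), preceded by the constant pi k.l inherited from
    the phase of [kshift]. *)
Definition zchar k l (w : R2n) : R :=
  pi * dot (intv k) (intv l) + 2 * pi * (dot (intv k) w.1 + dot (intv l) w.2).

(** Shifting the first variable by [l] reindexes the sum and produces the factor in the second torus
    variable; the modulation by [k] gives the factor in the first one, since exp(2 pi i m.k) = 1. *)
Lemma zs_kshift k l K s w :
  zs (kshift k l K) s w = expi (zchar k l w.1) * zs K [seq addz l m | m <- s] w.
Proof.
rewrite /zs big_map mulr_sumr; apply: eq_bigr => m _.
rewrite /zterm /kshift /=.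
have -> : addv (intv l) (addv (intv m) w.1.1) = addv (intv (addz l m)) w.1.1.
  by apply: eq_from_tnth => i; rewrite !tnth_mktuple intrD addrA.
rewrite [RHS]mulrCA mulrAC mulrC; congr (_ * _); rewrite -!expiD.
rewrite /zchar dot_addz dotDl.
have -> : pi * (dot (intv k) (intv l) + 2 * (dot (intv m) (intv k) + dot w.1.1 (intv k))) +
    - (2 * pi * dot (intv m) w.1.2) =
  2 * pi * dot (intv m) (intv k) + (pi * dot (intv k) (intv l) +
    2 * pi * (dot (intv k) w.1.1 + dot (intv l) w.1.2) +
    - (2 * pi * (dot (intv l) w.1.2 + dot (intv m) w.1.2))).
  by rewrite (dotC w.1.1); ring.
by rewrite [LHS]expiD expi_dot_int mul1r.
Qed.

Lemma Cmeasurable_zchar k l : Cmeasurable (fun w : R3n => expi (zchar k l w.1)).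
Proof.
have m11 : measurable_fun setT (fun w : R3n => w.1.1) by exact: measurableT_comp.
have m12 : measurable_fun setT (fun w : R3n => w.1.2) by exact: measurableT_comp.
apply: Cmeasurable_expi; apply: measurable_funD; first exact: measurable_cst.
apply: measurable_funM; first exact: measurable_cst.
by apply: measurable_funD; apply: measurable_dot => //; exact: measurable_cst.
Qed.

Lemma isWZ_kshift k l K Z : Cmeasurable K -> isWZ K Z ->
  isWZ (kshift k l K) (fun w => expi (zchar k l w.1) * Z w).
Proof.
move=> mK /isWZP[mZ qZ h]; have mc := Cmeasurable_zchar k l.
apply/isWZP; split; first exact: CmeasurableM.
  by rewrite (@eq_qn _ _ _ _ _ Z)// => w; rewrite sqcM sqc_expi mul1r.
move=> e /h[F0 hF]; pose tr (j : Zn) (F : {fset Zn}) := [fset addz j m | m in F]%fset.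
have addK j : cancel (@addz n j) (@addz n (oppz j)).
  by move=> m; apply: eq_from_tnth => i; rewrite !tnth_mktuple; ring.
(* The reindexing replaces [F] by its translate by [l], which contains [F0] as soon as [F] contains
   the translate of [F0] by -l. *)
exists (tr (oppz l) F0) => F /fsubsetP sF.
have P : perm_eq [seq addz l m | m <- F] (tr l F).
  apply: uniq_perm; rewrite ?fset_uniq//.
    by rewrite map_inj_uniq ?fset_uniq//; exact: (can_inj (addK l)).
  by move=> m; apply/mapP/imfsetP => -[m' m'F ->]; exists m'.
rewrite (@eq_qn _ _ _ _ _ (fun w => zs K (tr l F) w - Z w)); last first.
  by move=> w; rewrite zs_kshift -mulrBr sqcM sqc_expi mul1r (zs_perm _ _ P).
apply: hF; apply/fsubsetP => m mF0; apply/imfsetP; exists (addz (oppz l) m) => /=.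
  by apply: sF; apply/imfsetP; exists m.
by apply: eq_from_tnth => i; rewrite !tnth_mktuple; ring.
Qed.

End zak.

(** * The Weyl-Zak isometry and its fibers *)

Section fibers.
Context {R : realType} {n : nat}.
Local Notation Rn := (n.-tuple R).
Local Notation R2n := (Rn * Rn)%type.
Local Notation R3n := (R2n * Rn)%type.
Local Notation lb := (@leb R n).
Local Notation lb2 := (@leb2 R n).
Local Notation t2 := (@torus2 R n).
Local Notation zm := (@zak_measure R n).
Local Notation TT := (@twisted_translation R n).
Local Notation wz := (@weyl_zak R n).
Implicit Types (phi psi chi f g : R2n -> R[i]) (Z : R3n -> R[i]).

Lemma weyl_kernelP phi : LpC lb2 2%:E phi -> isWK phi (weyl_kernel phi).
Proof. by move=> /LpC2P[mphi qphi]; have [K hK] := isWK_exists mphi qphi; exact: (xgetPex (cst 0) (ex_intro _ K hK)). Qed.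

Lemma weyl_zakP phi : LpC lb2 2%:E phi -> isWZ (weyl_kernel phi) (wz phi).
Proof.
move=> /weyl_kernelP/isWKP[mK qK _]; have [Z hZ] := isWZ_exists mK qK.
exact: (xgetPex (cst 0) (ex_intro _ Z hZ)).
Qed.

Lemma Cmeasurable_wz phi : LpC lb2 2%:E phi -> Cmeasurable (wz phi).
Proof. by move=> /weyl_zakP/isWZP[]. Qed.

Lemma qn_wz phi : LpC lb2 2%:E phi -> qn zm (wz phi) = qn lb2 phi.
Proof.
move=> h; have hK := weyl_kernelP h; have /isWKP[mK _ _] := hK.
have /LpC2P[mphi _] := h.
by rewrite (isWZ_qn mK (weyl_zakP h)) (isWK_qn mphi hK).
Qed.

Lemma wz_lin (a : R[i]) phi psi chi : LpC lb2 2%:E phi -> LpC lb2 2%:E psi -> LpC lb2 2%:E chi ->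
  qn lb2 (fun z => chi z - (a * phi z + psi z)) = 0%E ->
  qn zm (fun w => wz chi w - (a * wz phi w + wz psi w)) = 0%E.
Proof.
move=> h1 h2 h3 e; have /LpC2P[m1 _] := h1; have /LpC2P[m2 _] := h2; have /LpC2P[m3 _] := h3.
have k1 := weyl_kernelP h1; have k2 := weyl_kernelP h2; have k3 := weyl_kernelP h3.
have /isWKP[mk1 _ _] := k1; have /isWKP[mk2 _ _] := k2; have /isWKP[mk3 _ _] := k3.
apply: (isWZ_lin_ae mk1 mk2 mk3 _ (weyl_zakP h1) (weyl_zakP h2) (weyl_zakP h3)).
apply: (isWK_ae m3 _ e k3 (isWK_lin a m1 m2 k1 k2)).
exact: Cmeasurable_lin.
Qed.

Lemma wz_TT k l phi psi : LpC lb2 2%:E phi -> LpC lb2 2%:E psi ->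
  qn lb2 (fun z => psi z - TT k l phi z) = 0%E ->
  qn zm (fun w => wz psi w - expi (zchar k l w.1) * wz phi w) = 0%E.
Proof.
move=> h1 h2 e; have /LpC2P[m1 _] := h1; have /LpC2P[m2 _] := h2.
have k1 := weyl_kernelP h1; have k2 := weyl_kernelP h2.
have /isWKP[mk1 _ _] := k1; have /isWKP[mk2 _ _] := k2.
have mks := Cmeasurable_kshift k l mk1.
have hs := isWZ_kshift k l mk1 (weyl_zakP h1).
(* With [a := 0] only the second kernel counts: the chosen kernel of [psi] is compared with the
   shifted kernel of [phi]. *)
rewrite -(isWZ_lin_ae (a := 0) mk1 mks mk2 _ (weyl_zakP h1) hs (weyl_zakP h2)).
  by apply: eq_qn => w; rewrite mul0r add0r.
rewrite -(isWK_ae m2 (Cmeasurable_TT k l m1) e k2 (isWK_TT k l m1 k1)).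
by apply: eq_qn => w; rewrite mul0r add0r.
Qed.

Lemma qn_fibers Z : Cmeasurable Z -> qn zm Z = (\int[t2]_w qn lb (fun y => Z (w, y)))%E.
Proof.
move=> mZ; rewrite /qn /zak_measure tonelli1//; first exact: measurable_esqc.
by move=> z; rewrite lee_fin sqc_ge0.
Qed.

Lemma measurable_qn_fibers Z : Cmeasurable Z ->
  measurable_fun setT (fun w => qn lb (fun y => Z (w, y))).
Proof.
move=> mZ; apply: (measurable_integral1 lb (measurable_esqc mZ)) => z.
by rewrite lee_fin sqc_ge0.
Qed.

Lemma Cmeasurable_fiber Z w : Cmeasurable Z -> Cmeasurable (fun y => Z (w, y)).
Proof.
by move=> [m1 m2]; split; [exact: (measurable_pairl w m1)|exact: (measurable_pairl w m2)].
Qed.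

Lemma qn_fibers_lty Z : Cmeasurable Z -> (qn zm Z < +oo)%E ->
  {ae t2, forall w, (qn lb (fun y => Z (w, y)) < +oo)%E}.
Proof.
move=> mZ; rewrite qn_fibers// => h.
by apply: (ge0_integral_lty_ae (measurable_qn_fibers mZ) _ h) => w; exact: qn_ge0.
Qed.

Lemma qn_fibers_eq0 Z : Cmeasurable Z -> qn zm Z = 0%E ->
  {ae t2, forall w, qn lb (fun y => Z (w, y)) = 0%E}.
Proof.
move=> mZ; rewrite qn_fibers// => h; have mQ := measurable_qn_fibers mZ.
have : (\int[t2]_w `|qn lb (fun y => Z (w, y))| = 0)%E.
  by under eq_integral do rewrite gee0_abs ?qn_ge0//.
move/(ae_eq_integral_abs t2 measurableT mQ).1.
by apply: filterS => w /(_ I).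
Qed.

Lemma calJ_fiber phi : LpC lb2 2%:E phi -> {ae t2, forall w, LpC lb 2%:E (calJ phi w)}.
Proof.
move=> h; have mZ := Cmeasurable_wz h; have /LpC2P[_ q] := h.
have := qn_fibers_lty mZ; rewrite qn_wz// => /(_ q).
by apply: filterS => w qw; apply/LpC2P; split => //; exact: Cmeasurable_fiber.
Qed.

Lemma Cmeasurable_calJ phi w : LpC lb2 2%:E phi -> Cmeasurable (calJ phi w).
Proof. by move=> h; exact: (Cmeasurable_fiber w (Cmeasurable_wz h)). Qed.

Lemma qn_calJ phi : LpC lb2 2%:E phi -> qn lb2 phi = (\int[t2]_w qn lb (calJ phi w))%E.
Proof. by move=> h; rewrite -qn_wz// qn_fibers//; exact: Cmeasurable_wz. Qed.

Lemma measurable_qn_calJ phi : LpC lb2 2%:E phi -> measurable_fun setT (fun w => qn lb (calJ phi w)).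
Proof. by move=> h; exact: (measurable_qn_fibers (Cmeasurable_wz h)). Qed.

Lemma calJ_lin (a : R[i]) phi psi chi : LpC lb2 2%:E phi -> LpC lb2 2%:E psi -> LpC lb2 2%:E chi ->
  qn lb2 (fun z => chi z - (a * phi z + psi z)) = 0%E ->
  {ae t2, forall w, qn lb (fun y => calJ chi w y - (a * calJ phi w y + calJ psi w y)) = 0%E}.
Proof.
move=> h1 h2 h3 e; apply: (qn_fibers_eq0 (Z := fun w => wz chi w - (a * wz phi w + wz psi w))).
  by apply: CmeasurableB; [|apply: Cmeasurable_lin]; exact: Cmeasurable_wz.
exact: wz_lin.
Qed.

Lemma calJ_TT k l phi psi : LpC lb2 2%:E phi -> LpC lb2 2%:E psi ->
  qn lb2 (fun z => psi z - TT k l phi z) = 0%E ->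
  {ae t2, forall w, qn lb (fun y => calJ psi w y - expi (zchar k l w) * calJ phi w y) = 0%E}.
Proof.
move=> h1 h2 e; apply: (qn_fibers_eq0 (Z := fun w => wz psi w - expi (zchar k l w.1) * wz phi w)).
  apply: CmeasurableB; first exact: Cmeasurable_wz.
  by apply: CmeasurableM; [exact: Cmeasurable_zchar|exact: Cmeasurable_wz].
exact: wz_TT.
Qed.

End fibers.

(** * Fiberwise inequalities and the range operator *)

Section norm_comparison.
Context {R : realType} d d' (T : measurableType d) (T' : measurableType d').
Context (mu : {measure set T -> \bar R}) (nu : {measure set T' -> \bar R}).

Lemma le_cL2norm (c : R) (f : T -> R[i]) (g : T' -> R[i]) : 0 < c ->
  (c%:E * L2norm nu g <= L2norm mu f)%E = ((c ^+ 2)%:E * qn nu g <= qn mu f)%E.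
Proof.
move=> c0; rewrite !L2normE; have := qn_ge0 mu f; have := qn_ge0 nu g.
case: (qn nu g) => [a| |]//; case: (qn mu f) => [b| |]//=.
- rewrite !lee_fin => a0 b0.
  rewrite -(@ler_sqr R (c * _)) ?nnegrE ?mulr_ge0 ?sqrtr_ge0 ?(ltW c0)//.
  by rewrite exprMn !sqr_sqrtr.
- by rewrite !leey.
- by rewrite !gt0_muley ?lte_fin ?exprn_gt0.
- by rewrite !leey.
Qed.

(** The constant of a bounded operator may be zero or negative; [|M| + 1] is positive, which also
    settles the case of an infinite norm. *)
Lemma L2norm_le_c (M : R) (f : T -> R[i]) (g : T' -> R[i]) :
  (L2norm mu f <= M%:E * L2norm nu g)%E -> (qn mu f <= ((`|M| + 1) ^+ 2)%:E * qn nu g)%E.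
Proof.
have M0 : 0 < `|M| + 1 by rewrite ltr_wpDl.
rewrite !L2normE; have := qn_ge0 mu f; have := qn_ge0 nu g.
case: (qn nu g) => [a| |]//; last by move=> _ _ _; rewrite gt0_muley ?lte_fin ?exprn_gt0// leey.
case: (qn mu f) => [b| |]//=.
rewrite !lee_fin => a0 b0 h.
rewrite -[b]sqr_sqrtr// -[X in _ * X]sqr_sqrtr// -exprMn ler_sqr ?nnegrE ?mulr_ge0 ?sqrtr_ge0 ?(ltW M0)//.
apply: le_trans h _; rewrite ler_wpM2r ?sqrtr_ge0//.
by apply: le_trans (ler_norm M) _; rewrite lerDl.
Qed.

End norm_comparison.

Section ae_comparison.
Context {R : realType} d (T : measurableType d) (mu : {measure set T -> \bar R}).

Lemma ae_forall_count (C : countType) (P : C -> T -> Prop) :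
  (forall c, {ae mu, forall x, P c x}) -> {ae mu, forall x, forall c, P c x}.
Proof.
move=> h.
have : {ae mu, forall x, forall k : nat, if @pickle_inv C k is Some c then P c x else True}.
  by apply: ae_foralln => k; case: (pickle_inv k) => [c|//]; [exact: h|exact: aeW].
by apply: filterS => x hx c; have := hx (choice.pickle c); rewrite pickleK_inv.
Qed.

(* The indicator of the set where [H1 < H2] is a limit of elements of [A] in
   L^2((H1 + H2) mu), so the inequality between integrals passes to it. *)
Lemma ae_le_of_algebra (A : set (T -> R)) (H1 H2 : T -> R) :
  (forall f, A f -> measurable_fun setT f) ->
  measurable_fun setT H1 -> measurable_fun setT H2 ->
  (forall x, 0 <= H1 x) -> (forall x, 0 <= H2 x) ->
  (\int[mu]_x (H1 x)%:E < +oo)%E -> (\int[mu]_x (H2 x)%:E < +oo)%E ->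
  (forall E, measurable E -> wsets mu (fun x => Num.sqrt (H1 x + H2 x)) A E) ->
  (forall p, A p -> (\int[mu]_x (p x ^+ 2 * H2 x)%:E <= \int[mu]_x (p x ^+ 2 * H1 x)%:E)%E) ->
  {ae mu, forall x, H2 x <= H1 x}.
Proof.
move=> Am m1 m2 p1 p2 i1 i2 AE Ale; pose E := [set x | H1 x < H2 x].
have mE : measurable E.
  rewrite (_ : E = (fun x => H2 x - H1 x) @^-1` `]0, +oo[%classic).
    by rewrite -[X in measurable X]setTI; apply: measurable_funB.
  by apply/seteqP; split => x /=; rewrite in_itv/= andbT subr_gt0.
have msqrt (H : T -> R) : measurable_fun setT H -> measurable_fun setT (fun x => Num.sqrt (H x)).
  move=> mH; apply: (measurableT_comp (f := @Num.sqrt R)) => //.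
  by apply: continuous_measurable_fun; exact: sqrt_continuous.
pose em (H : T -> R) (p : T -> R) x : R[i] := Complex (Num.sqrt (H x) * p x) 0.
have emE (H p : T -> R) x : 0 <= H x -> sqc (em H p x) = p x ^+ 2 * H x.
  by move=> H0; rewrite sqc_real exprMn sqr_sqrtr// mulrC.
have mem (H p : T -> R) : measurable_fun setT H -> measurable_fun setT p -> Cmeasurable (em H p).
  by move=> mH mp; split => /=; [apply: measurable_funM => //; exact: msqrt|exact: measurable_cst].
have [_ [mI _ Iap]] := AE _ mE.
have /choice[p hp] (j : nat) : exists p, A p /\
    (wn mu (fun x => Num.sqrt (H1 x + H2 x)) (fun x => \1_E x - p x)%R < (j.+1%:R^-1)%:E)%E.
  by have [|p Ap h] := Iap j.+1%:R^-1; [rewrite invr_gt0|exists p].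
have mp j : measurable_fun setT (p j) by apply: Am; have [] := hp j.
(* Approximation for the weight [H1 + H2] implies approximation for any smaller weight, in
   particular for [H1] and [H2] with the same polynomials. *)
have cvgem (H : T -> R) : measurable_fun setT H -> (forall x, 0 <= H x) ->
    (forall x, H x <= H1 x + H2 x) -> qcvg mu (fun j => em H (p j)) (em H (\1_E)).
  move=> mH H0 Hle e e0.
  have [N _ hN] := near_infty_natSinv_lt (PosNum e0); exists N => j /hN /= hj.
  have [_ hpj] := hp j; apply: le_lt_trans (lt_trans hpj _); last by rewrite lte_fin.
  apply: ge0_le_integral => //.
  - by move=> x _; rewrite lee_fin sqc_ge0.
  - by apply: measurable_esqc; apply: CmeasurableB; exact: mem.
  - apply/measurable_EFinP; apply: measurable_funM; apply: measurable_funX.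
      by apply: msqrt; exact: measurable_funD.
    exact: measurable_funB.
  move=> x _; rewrite lee_fin.
  have -> : em H (p j) x - em H (\1_E) x = em H (fun x => \1_E x - p j x) x * (-1).
    by apply: eq_complexP; rewrite !ReImE /=; ring.
  rewrite sqcM sqcN (_ : sqc 1 = 1) ?mulr1; last by rewrite /sqc/=; ring.
  rewrite emE// sqr_sqrtr ?addr_ge0// mulrC ler_wpM2r ?sqr_ge0//.
have := @qcvg_le _ _ _ _ _ mu mu (fun j => em H2 (p j)) (em H2 \1_E) (fun j => em H1 (p j)) (em H1 \1_E).
move=> /(_ (fun j => mem _ _ m2 (mp j)) (fun j => mem _ _ m1 (mp j)) (mem _ _ m2 mI) (mem _ _ m1 mI)).
have c2 := cvgem H2 m2 p2 (fun x => ler_wpDl (p1 x) (lexx _)).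
have c1 := cvgem H1 m1 p1 (fun x => ler_wpDr (p2 x) (lexx _)).
move=> /(_ c2 c1) le12.
have {}le12 : (qn mu (em H2 \1_E) <= qn mu (em H1 \1_E))%E.
  apply: le12 => j; rewrite /qn.
  under eq_integral do rewrite emE//; under [leRHS]eq_integral do rewrite emE//.
  by apply: Ale; have [] := hp j.
(* [D] is the positive part of [H2 - H1]. The inequality obtained for the indicator of [E] forces
   its integral to be 0; the integral of [H1] over [E] is finite and can be cancelled. *)
pose D x := \1_E x * (H2 x - H1 x).
have D0 x : 0 <= D x.
  rewrite /D indicE; case: (boolP (x \in E)) => [/set_mem/= h|_]; last by rewrite mul0r.
  by rewrite mul1r subr_ge0 ltW.
have mD : measurable_fun setT (fun x => (D x)%:E).
  by apply/measurable_EFinP; apply: measurable_funM => //; exact: measurable_funB.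
have q1fin : qn mu (em H1 \1_E) \is a fin_num.
  rewrite ge0_fin_numE ?qn_ge0//; apply: le_lt_trans i1; apply: ge0_le_integral => //.
  - by move=> x _; rewrite lee_fin sqc_ge0.
  - by apply: measurable_esqc; exact: mem.
  - exact/measurable_EFinP.
  - move=> x _; rewrite lee_fin emE// indicE; case: (_ \in _).
      by rewrite expr1n mul1r.
    by rewrite expr0n mul0r.
have splitE : (qn mu (em H2 \1_E) = \int[mu]_x (D x)%:E + qn mu (em H1 \1_E))%E.
  rewrite /qn -ge0_integralD//; last 3 first.
  - by move=> x _; rewrite lee_fin.
  - by move=> x _; rewrite lee_fin sqc_ge0.
  - by apply: measurable_esqc; exact: mem.
  apply: eq_integral => x _; rewrite !emE// -EFinD; congr EFin; rewrite /D indicE.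
  by case: (_ \in _); rewrite ?expr1n ?expr0n/=; ring.
have D_0 : (\int[mu]_x (D x)%:E = 0)%E.
  apply/eqP; rewrite eq_le integral_ge0 ?andbT//; last by move=> x _; rewrite lee_fin.
  by move: le12; rewrite splitE -[leRHS]add0e leeD2rE.
have : (\int[mu]_x `|(D x)%:E| = 0)%E.
  by under eq_integral do rewrite gee0_abs ?lee_fin//.
move/(ae_eq_integral_abs mu measurableT mD).1; apply: filterS => x /(_ I) [] Dx.
rewrite leNgt; apply/negP => h; move: Dx; rewrite /D indicE mem_set//= mul1r => /eqP.
by rewrite subr_eq0 gt_eqF.
Qed.

End ae_comparison.

Section torus2_trig.
Context {R : realType} {n : nat}.
Local Notation Rn := (n.-tuple R).
Local Notation R2n := (Rn * Rn)%type.
Local Notation Zn := (n.-tuple int).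
Local Notation t2 := (@torus2 R n).
Implicit Types (k l : Zn).

Definition cphase2 : set (R2n -> R) := [set p | exists k l,
  p = fun w => 2 * pi * (dot (intv k) w.1 + dot (intv l) w.2)].

Lemma cphase20 : cphase2 (fun=> 0).
Proof. by exists zerov, zerov; apply/funext => x; rewrite !dot_zerov addr0 mulr0. Qed.

Lemma cphase2D p q : cphase2 p -> cphase2 q -> cphase2 (fun x => p x + q x).
Proof.
move=> [k [l ->]] [k' [l' ->]]; exists (addz k k'), (addz l l').
by apply/funext => x; rewrite !dot_addz; ring.
Qed.

Lemma cphase2N p : cphase2 p -> cphase2 (fun x => - p x).
Proof.
move=> [k [l ->]]; exists (oppz k), (oppz l); apply/funext => x.
by rewrite !dot_oppz; ring.
Qed.

Lemma measurable_cphase2 p : cphase2 p -> measurable_fun setT p.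
Proof.
move=> [k [l ->]]; apply: measurable_funM; first exact: measurable_cst.
by apply: measurable_funD; apply: measurable_dot => //; exact: measurable_cst.
Qed.

Lemma dot_delta (i : 'I_n) (x : Rn) : dot (intv [tuple ((i == j)%:R : int) | j < n]) x = tnth x i.
Proof.
rewrite /dot (bigD1 i)//= !tnth_mktuple eqxx mul1r big1 ?addr0// => j ji.
by rewrite !tnth_mktuple eq_sym (negbTE ji) mul0r.
Qed.

Lemma ae_cube2 : {ae t2, forall w, cube n w.1 /\ cube n w.2}.
Proof.
have mc : measurable (~` @cube R n) by apply: measurableC; exact: measurable_cube.
have tc : torus n (~` @cube R n) = 0%E.
  by rewrite -[LHS]/(leb n (~` cube n `&` cube n)) setIC setICr measure0.
have h1 : {ae t2, forall w, cube n w.1}.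
  exists (~` cube n `*` setT); split; first exact: measurableX.
    by rewrite /torus2 /= /prodm product_measure1E//= tc mul0e.
  by move=> w /= h.
have h2 : {ae t2, forall w, cube n w.2}.
  exists (setT `*` ~` cube n); split; first exact: measurableX.
    by rewrite /torus2 /= /prodm product_measure1E//= tc mule0.
  by move=> w /= h.
by apply: filterS2 h1 h2.
Qed.

(** The product sigma-algebra is generated by preimages under the two projections, and each
    projection has its coordinates among the admissible phases. *)
Lemma torus2_wsets (kap : R2n -> R) E : measurable_fun setT kap ->
  (\int[t2]_x (kap x ^+ 2)%:E < +oo)%E ->
  measurable E -> wsets t2 kap (rtrig cphase2) E.
Proof.
move=> mk fk.
have W (phi : R2n -> Rn) := @wsets_trig_coord R _ _ cphase2 cphase20 cphase2D cphase2N
  measurable_cphase2 t2 kap mk fk n phi.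
have W1 := W fst measurable_fst _ _; have W2 := W snd measurable_snd _ _.
have sC := wsets_sigma_algebra mk fk (rtrig_measurable measurable_cphase2)
  (@rtrig_bounded _ _ _ cphase2) (rtrig_cst cphase20) (@rtrig_lin _ _ _ cphase2)
  (rtrigM cphase2D).
suff H : g_sigma_preimageU (fst : R2n -> Rn) (snd : R2n -> Rn) `<=` wsets t2 kap (rtrig cphase2) by exact: H.
apply: smallest_sub => // B [[C mC <-]|[C mC <-]]; rewrite setTI.
  apply: W1 => //; first by apply: filterS ae_cube2 => w [].
  move=> i; exists [tuple ((i == j)%:R : int) | j < n], zerov; apply/funext => x.
  by rewrite dot_delta dot_zerov addr0.
apply: W2 => //; first by apply: filterS ae_cube2 => w [].
move=> i; exists zerov, [tuple ((i == j)%:R : int) | j < n]; apply/funext => x.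
by rewrite dot_delta dot_zerov add0r.
Qed.

End torus2_trig.

(** * Dense sequences in closed spans *)

Section closed_span_dense.
Context {R : realType} d (T : measurableType d) (mu : {measure set T -> \bar R}).

Lemma LpC_lin (a : R[i]) (g h : T -> R[i]) :
  LpC mu 2%:E g -> LpC mu 2%:E h -> LpC mu 2%:E (fun x => a * g x + h x).
Proof.
move=> /LpC2P[mg qg] /LpC2P[mh qh].
have mag : Cmeasurable (fun x => a * g x) by exact: CmeasurableZ.
apply/LpC2P; split; first exact: CmeasurableD.
by apply: qnD_lty => //; rewrite qnZ// lte_mul_pinfty// lee_fin sqc_ge0.
Qed.

Lemma qn_self0 (g : T -> R[i]) :
  qn mu (fun x => g x - g x) = 0%E.
Proof. by rewrite -[RHS](qn0 mu); apply: eq_qn => x; rewrite subrr. Qed.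

Lemma qn_congr (g h : T -> R[i]) :
  Cmeasurable g -> Cmeasurable h -> qn mu (fun x => g x - h x) = 0%E -> qn mu g = qn mu h.
Proof. by move=> mg mh /(qn_ae_eq mu mg mh).1; exact: ae_eq_qn. Qed.

Lemma ratr_complex_dense (a : R[i]) (e : R) : 0 < e ->
  exists r : rat * rat, sqc (a - Complex (ratr r.1) (ratr r.2)) < e.
Proof.
move=> e0; have s0 : 0 < Num.sqrt (e / 2) by rewrite sqrtr_gt0 divr_gt0.
have ap (x : R) : exists q : rat, (x - ratr q) ^+ 2 < e / 2.
  have [|q] := @rat_in_itvoo R (x - Num.sqrt (e / 2)) (x + Num.sqrt (e / 2)).
    by rewrite ltrD2l; lra.
  rewrite in_itv/= => /andP[h1 h2]; exists q.
  rewrite -[X in _ < X]sqr_sqrtr; last by rewrite ltW// divr_gt0.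
  rewrite -real_normK ?num_real// ltr_sqr ?nnegrE ?normr_ge0 ?(ltW s0)//.
  by rewrite ltr_norml; apply/andP; split; lra.
have [q1 h1] := ap (complex.Re a); have [q2 h2] := ap (complex.Im a).
by exists (q1, q2); rewrite /sqc !ReImE/=; lra.
Qed.

(** The functions approximable by [F] form a closed subspace that contains [F], hence contain the
    closed span. Only scalars in Q(i) occur in the hypothesis, so that it can be secured at almost
    every fiber simultaneously. *)
Lemma closed_span_dense (F : nat -> T -> R[i]) :
  (forall i, LpC mu 2%:E (F i)) ->
  (forall (r : rat * rat) i j (e : R), 0 < e -> exists k,
    (qn mu (fun y => (Complex (ratr r.1) (ratr r.2) * F i y + F j y - F k y)%R) < e%:E)%E) ->
  forall a, closed_span mu (range F) a -> forall e : R, 0 < e ->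
  exists i, (qn mu (fun y => (a y - F i y)%R) < e%:E)%E.
Proof.
move=> h3 comb_approx.
pose cq (c : rat * rat) : R[i] := Complex (ratr c.1) (ratr c.2).
have mF i : Cmeasurable (F i) by have /LpC2P[] := h3 i.
pose D : set (T -> R[i]) := [set a | LpC mu 2%:E a /\ forall e : R, 0 < e ->
  exists i, (qn mu (fun y => (a y - F i y)%R) < e%:E)%E].
suff Dclosed : closed_subspace mu D.
  move=> a ha; have : closed_span mu (range F) `<=` D.
    apply: smallest_sub => // _ [i _ <-]; split => // e e0; exists i.
    by rewrite qn_self0 lte_fin.
  by move=> /(_ a ha)[].
split.
- by move=> a [].
- split; first by apply/LpC2P; split; [exact: Cmeasurable_cst|rewrite qn0].
  (* The zero function is the combination [- F 0 + F 0]. *)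
  move=> e e0; have [k hk] := comb_approx (-1, 0) 0%N 0%N e e0; exists k.
  rewrite (@eq_qn _ _ _ _ _ (fun y => cq (-1, 0) * F 0%N y + F 0%N y - F k y))// => y.
  congr sqc; congr (_ - _); rewrite /cq/= rmorphN1 rmorph0.
  by apply: eq_complexP; rewrite !ReImE/=; ring.
- move=> a g h [Lg hg] [Lh hh]; split; first exact: LpC_lin.
  have /LpC2P[mg qg] := Lg; have /LpC2P[mh qh] := Lh.
  move=> e e0; pose b := fine (qn mu g) + 1.
  have qg0 : 0 <= fine (qn mu g) by rewrite fine_ge0// qn_ge0.
  have b0 : 0 < b by rewrite ltr_pwDr.
  have e4 (x : R) : 0 < x -> 0 < x / 4 by move=> ?; rewrite divr_gt0.
  (* The error is split as (a - r) g + r (g - F i) + (h - F j), after one triangle inequality. The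
     rational scalar [r] is chosen according to the norm of [g], then [i] according to [r]. *)
  have e16 := e4 _ (e4 _ e0); have e64 := e4 _ e16.
  have [r hr] := ratr_complex_dense a (divr_gt0 e16 b0).
  pose c := sqc (cq r) + 1; have c0 : 0 < c by rewrite ltr_pwDr ?sqc_ge0.
  have [i hi] := hg _ (divr_gt0 e64 c0).
  have [j hj] := hh _ e64; have [k hk] := comb_approx r i j _ (e4 _ e0).
  exists k.
  have m1 : Cmeasurable (fun y => a * g y + h y) by exact: Cmeasurable_lin.
  have m2 : Cmeasurable (fun y => cq r * F i y + F j y) by exact: Cmeasurable_lin.
  have m3 : Cmeasurable (fun y => (a - cq r) * g y) by exact: CmeasurableZ.
  have mgi : Cmeasurable (fun y => g y - F i y) by exact: CmeasurableB.
  have m4 : Cmeasurable (fun y => cq r * (g y - F i y)) by exact: CmeasurableZ.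
  have m5 : Cmeasurable (fun y => h y - F j y) by exact: CmeasurableB.
  have scale (z : R[i]) (v : T -> R[i]) (x y : R) : Cmeasurable v -> 0 < y -> sqc z <= y ->
      (qn mu v < (x / y)%:E)%E -> (qn mu (fun t => (z * v t)%R) < x%:E)%E.
    move=> mv y0 zy; rewrite qnZ//; have := qn_ge0 mu v; case: (qn mu v) => [q| |]//.
    rewrite lee_fin -EFinM !lte_fin => q0; rewrite ltr_pdivlMr// => /(le_lt_trans _); apply.
    by rewrite [leRHS]mulrC ler_wpM2r.
  apply: (qn_triangle_lt m1 m2 (mF k)) => //.
  rewrite (_ : (fun y => _) = (fun y => (a - cq r) * g y + (cq r * (g y - F i y) + (h y - F j y)))); last first.
    by apply/funext => y; ring.
  apply: (lte_quarters (qn_ge0 _ _) (qn_ge0 _ _) (qnD2 mu m3 (CmeasurableD m4 m5))).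
    have fg : qn mu g = (fine (qn mu g))%:E by rewrite fineK// ge0_fin_numE// qn_ge0.
    rewrite qnZ// fg -EFinM lte_fin; move: hr; rewrite ltr_pdivlMr//; apply: le_lt_trans.
    by rewrite ler_wpM2l ?sqc_ge0// /b lerDl.
  apply: (lte_quarters (qn_ge0 _ _) (qn_ge0 _ _) (qnD2 mu m4 m5)) => //.
  by apply: (scale _ _ _ c) hi => //; rewrite /c lerDl.
- move=> u a hu La cu; split => // e e0; have /LpC2P[ma _] := La.
  have mu_ k : Cmeasurable (u k) by have [/LpC2P[]] := hu k.
  have [N hN] := (L2norm_cvgP mu u a).1 cu _ (divr_gt0 e0 (ltr0Sn _ 3)).
  have [_ /(_ _ (divr_gt0 e0 (ltr0Sn _ 3)))[i hi]] := hu N; exists i.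
  by apply: (qn_triangle_lt ma (mu_ N) (mF i)) => //; rewrite qnB; exact: hN.
Qed.

End closed_span_dense.

Section range_function.
Context {R : realType} {n : nat}.
Local Notation Rn := (n.-tuple R).
Local Notation R2n := (Rn * Rn)%type.
Local Notation lb := (@leb R n).
Local Notation lb2 := (@leb2 R n).
Local Notation t2 := (@torus2 R n).
Context (V : set (R2n -> R[i])) (Vclosed : closed_subspace lb2 V).

Lemma V_LpC f : V f -> LpC lb2 2%:E f.
Proof. by case: Vclosed => h _ _ _; exact: h. Qed.

Lemma V_lin (a : R[i]) f g : V f -> V g -> V (fun x => a * f x + g x).
Proof. by case: Vclosed => _ _ h _; exact: h. Qed.

Lemma V_0 : V (fun=> 0).
Proof. by case: Vclosed. Qed.

Context (f : nat -> R2n -> R[i]) (Vf : forall i, V (f i)).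
Hypothesis f_dense : forall g (e : R), V g -> 0 < e ->
  exists i, (L2norm lb2 (fun z => g z - f i z)%R < e%:E)%E.

Lemma calJ_sub g h : V g -> V h -> exists chi, [/\ V chi,
  chi = (fun z => (-1) * h z + g z) &
  {ae t2, forall w, qn lb (fun y => calJ g w y - calJ h w y) = qn lb (calJ chi w)}].
Proof.
move=> Vg Vh; have Vc := V_lin (-1) Vh Vg; exists (fun z => (-1) * h z + g z); split => //.
have := calJ_lin (V_LpC Vh) (V_LpC Vg) (V_LpC Vc) (qn_self0 _ _).
apply: filterS => w e.
have m1 := Cmeasurable_calJ w (V_LpC Vg); have m2 := Cmeasurable_calJ w (V_LpC Vh).
have m3 := Cmeasurable_calJ w (V_LpC Vc).
have m4 : Cmeasurable (fun y => -1 * calJ h w y + calJ g w y).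
  exact: Cmeasurable_lin.
by rewrite (qn_congr m3 m4 e); apply: eq_qn => y; rewrite mulN1r addrC.
Qed.

(** The index [i] may depend on the fiber. For fixed [e], the fibers that no [f i] approximates
    within [e] form a set of measure at most the squared norm of [g - f i] divided by [e], for every
    [i]; density makes it null. It then remains to let [e] run through 1/(j+1). *)
Lemma calJ_approx g : V g ->
  {ae t2, forall w, forall e : R, 0 < e ->
    exists i, (qn lb (fun y => (calJ g w y - calJ (f i) w y)%R) < e%:E)%E}.
Proof.
move=> Vg.
have /choice[h hh] i := calJ_sub Vg (Vf i).
have Lh i : LpC lb2 2%:E (h i) by apply: V_LpC; have [] := hh i.
have small (e : R) : 0 < e -> exists i, (qn lb2 (h i) < e%:E)%E.
  move=> e0; have [|i hi] := f_dense Vg (e := Num.sqrt e); first by rewrite sqrtr_gt0.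
  exists i; rewrite L2norm_lt ?sqrtr_gt0// sqr_sqrtr ?(ltW e0)// in hi.
  have [_ -> _] := hh i; rewrite (@eq_qn _ _ _ _ _ (fun z => g z - f i z))// => z.
  by rewrite mulN1r addrC.
have mN i := measurable_qn_calJ (Lh i).
have fixe (e : R) : 0 < e -> {ae t2, forall w, exists i, (qn lb (calJ (h i) w) < e%:E)%E}.
  move=> e0; pose B := \bigcap_i [set w | (e%:E <= qn lb (calJ (h i) w))%E].
  have mB : measurable B.
    apply: bigcap_measurable => // i _; rewrite -[X in measurable X]setTI.
    exact: emeasurable_fun_c_infty.
  exists B; split => //; last first.
    move=> w /= /forallNP hw i _ /=; rewrite leNgt; apply/negP; exact: hw.
  apply/eqP; rewrite eq_le measure_ge0 andbT; apply/lee_addgt0Pr => d d0; rewrite add0e.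
  have [i hi] := small _ (mulr_gt0 e0 d0).
  rewrite -(@lee_pmul2l _ e%:E)// -EFinM; apply: le_trans (ltW hi).
  rewrite -integral_cst// qn_calJ//.
  apply: (@le_trans _ _ (\int[t2]_(w in B) qn lb (calJ (h i) w))%E).
    apply: ge0_le_integral => //.
    - by move=> w _; rewrite lee_fin ltW.
    - exact: measurable_funTS.
    - by move=> w /(_ i I).
  apply: ge0_subset_integral => // w _; exact: qn_ge0.
have all1 : {ae t2, forall w, forall j : nat, exists i, (qn lb (calJ (h i) w) < (j.+1%:R^-1)%:E)%E}.
  by apply: ae_foralln => j; apply: fixe; rewrite invr_gt0.
have all2 : {ae t2, forall w, forall i : nat,
    qn lb (fun y => calJ g w y - calJ (f i) w y) = qn lb (calJ (h i) w)}.
  by apply: ae_foralln => i; have [] := hh i.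
apply: filterS2 all1 all2 => w h1 h2 e e0.
have [N _ hN] := near_infty_natSinv_lt (PosNum e0).
have [i hi] := h1 N; exists i; rewrite h2; apply: lt_trans hi _.
by rewrite lte_fin; exact: (hN N (leqnn N)).
Qed.

Lemma closed_span_sub (S : set (Rn -> R[i])) : S `<=` closed_span lb S.
Proof. exact: sub_gen_smallest. Qed.

(** A closed span is an intersection, closed only if some closed subspace contains the generators;
    the premise under the quantifier will come from the closedness of [J w]. *)
Lemma calJ_mem_span g : V g ->
  {ae t2, forall w, closed_subspace lb (closed_span lb (range (fun i => calJ (f i) w))) ->
    closed_span lb (range (fun i => calJ (f i) w)) (calJ g w)}.
Proof.
move=> Vg; apply: filterS2 (calJ_approx Vg) (calJ_fiber (V_LpC Vg)) => w h Lg.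
move=> [_ _ _ cl].
have /choice[s hs] (k : nat) : exists i, (qn lb (fun y => (calJ g w y - calJ (f i) w y)%R) < (k.+1%:R^-1)%:E)%E.
  by apply: h; rewrite invr_gt0.
apply: (cl (fun k => calJ (f (s k)) w)) => //.
  by move=> k; apply: closed_span_sub; exists (s k).
apply/L2norm_cvgP => e e0.
have [N _ hN] := near_infty_natSinv_lt (PosNum e0); exists N => k /hN /= hk.
by rewrite qnB; apply: lt_trans (hs k) _; rewrite lte_fin.
Qed.

(* Combinations with coefficients in Q(i) of members of the dense sequence [f]
   are again approximated by that sequence. *)
Lemma closed_span_calJ_dense : {ae t2, forall w a,
  closed_span lb (range (fun i => calJ (f i) w)) a -> forall e : R, 0 < e ->
  exists i, (qn lb (fun y => (a y - calJ (f i) w y)%R) < e%:E)%E}.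
Proof.
pose cq (c : rat * rat) : R[i] := Complex (ratr c.1) (ratr c.2).
pose comb (c : (rat * rat) * (nat * nat)) z := cq c.1 * f c.2.1 z + f c.2.2 z.
have Vcomb c : V (comb c) by exact: V_lin.
have a1 : {ae t2, forall w, forall c, forall e : R, 0 < e ->
    exists i, (qn lb (fun y => (calJ (comb c) w y - calJ (f i) w y)%R) < e%:E)%E}.
  by apply: ae_forall_count => c; exact: calJ_approx.
have a2 : {ae t2, forall w, forall c, qn lb (fun y => calJ (comb c) w y -
     (cq c.1 * calJ (f c.2.1) w y + calJ (f c.2.2) w y)) = 0%E}.
  apply: ae_forall_count => c; apply: calJ_lin; rewrite ?qn_self0//; exact: V_LpC.
have a3 : {ae t2, forall w, forall i, LpC lb 2%:E (calJ (f i) w)}.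
  by apply: ae_foralln => i; apply: calJ_fiber; exact: V_LpC.
move: a1 a2 a3; apply: filterS3 => w h1 h2 h3.
have hc c : Cmeasurable (calJ (comb c) w) by apply: Cmeasurable_calJ; exact: V_LpC.
have key (F : nat -> Rn -> R[i]) (G : (rat * rat) * (nat * nat) -> Rn -> R[i]) :
    (forall c, forall e : R, 0 < e ->
      exists i, (qn lb (fun y => (G c y - F i y)%R) < e%:E)%E) ->
    (forall c, qn lb (fun y => G c y - (cq c.1 * F c.2.1 y + F c.2.2 y)) = 0%E) ->
    (forall i, LpC lb 2%:E (F i)) -> (forall c, Cmeasurable (G c)) ->
    forall a, closed_span lb (range F) a -> forall e : R, 0 < e ->
    exists i, (qn lb (fun y => (a y - F i y)%R) < e%:E)%E.
  move=> {}h1 {}h2 {}h3 {}hc; apply: closed_span_dense => // r i j e e0.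
  have [k hk] := h1 (r, (i, j)) e e0; exists k.
  have mF l : Cmeasurable (F l) by have /LpC2P[] := h3 l.
  have ml : Cmeasurable (fun y => cq r * F i y + F j y).
    exact: Cmeasurable_lin.
  rewrite (qn_congr (h := fun y => G (r, (i, j)) y - F k y))//.
  - exact: CmeasurableB.
  - exact: CmeasurableB.
  rewrite -[RHS](h2 (r, (i, j))) qnB; apply: eq_qn => y /=; congr sqc.
  by rewrite opprB addrA subrK.
exact: (key (fun i => calJ (f i) w) (fun c => calJ (comb c) w) h1 h2 h3 hc).
Qed.

End range_function.

Lemma qn_real_multiple {R : realType} d (T : measurableType d)
    (mu : {measure set T -> \bar R}) (a : R) (f g : T -> R[i]) :
  Cmeasurable g -> LpC mu 2%:E f -> g = (fun y => Complex a 0 * f y) %[ae mu] ->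
  qn mu g = (a ^+ 2 * fine (qn mu f))%:E.
Proof.
move=> mg /LpC2P[mf qf] h.
have -> : qn mu g = qn mu (fun y => Complex a 0 * f y).
  apply: ae_eq_qn => //.
  exact: CmeasurableZ.
by rewrite qnZ// sqc_real [in RHS]EFinM fineK// ge0_fin_numE// qn_ge0.
Qed.

(** * Multiplication of fibers by trigonometric polynomials *)

Section fiber_multipliers.
Context {R : realType} {n : nat}.
Local Notation Rn := (n.-tuple R).
Local Notation R2n := (Rn * Rn)%type.
Local Notation lb := (@leb R n).
Local Notation lb2 := (@leb2 R n).
Local Notation t2 := (@torus2 R n).
Local Notation TT := twisted_translation.

Lemma calJ_lin_ae (a : R[i]) (phi psi chi : R2n -> R[i]) :
  LpC lb2 2%:E phi -> LpC lb2 2%:E psi -> LpC lb2 2%:E chi ->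
  chi = (fun z => a * phi z + psi z) %[ae lb2] ->
  {ae t2, forall w, calJ chi w = (fun y => a * calJ phi w y + calJ psi w y) %[ae lb]}.
Proof.
move=> h1 h2 h3; have [/LpC2P[m1 _] /LpC2P[m2 _]] := (h1, h2); have /LpC2P[m3 _] := h3.
move=> /(qn_ae_eq lb2 m3 (Cmeasurable_lin a m1 m2)).2 /(calJ_lin h1 h2 h3).
apply: filterS => w; apply: (qn_ae_eq lb _ _).1; first exact: Cmeasurable_calJ.
by apply: Cmeasurable_lin; exact: Cmeasurable_calJ.
Qed.

Lemma calJ_TT_ae k l (phi psi : R2n -> R[i]) :
  LpC lb2 2%:E phi -> LpC lb2 2%:E psi ->
  psi = TT k l phi %[ae lb2] ->
  {ae t2, forall w, calJ psi w = (fun y => expi (zchar k l w) * calJ phi w y) %[ae lb]}.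
Proof.
move=> h1 h2; have [/LpC2P[m1 _] /LpC2P[m2 _]] := (h1, h2).
move=> /(qn_ae_eq lb2 m2 (Cmeasurable_TT k l m1)).2 /(calJ_TT h1 h2).
apply: filterS => w; apply: (qn_ae_eq lb _ _).1; first exact: Cmeasurable_calJ.
by apply: CmeasurableZ; exact: Cmeasurable_calJ.
Qed.

Lemma calJ_ae0 (phi : R2n -> R[i]) : LpC lb2 2%:E phi -> qn lb2 phi = 0%E ->
  {ae t2, forall w, calJ phi w = (fun=> 0) %[ae lb]}.
Proof.
move=> h /qn_eq0 e; have /LpC2P[m _] := h.
have : phi = (fun z => -1 * phi z + phi z) %[ae lb2].
  by apply: filterS (e m) => z /= + zT => ->//; rewrite mulr0 addr0.
move=> /(calJ_lin_ae h h h); apply: filterS => w; apply: filterS => y + yT => ->//.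
by rewrite mulN1r addNr.
Qed.

Context (V : set (R2n -> R[i])) (U : (R2n -> R[i]) -> R2n -> R[i]).
Hypotheses (Vclosed : closed_subspace lb2 V) (Vinv : twisted_shift_invariant V)
  (Ubounded : bounded_operator lb2 V U) (Upres : twisted_shift_preserving V U).

Lemma U_LpC f : V f -> LpC lb2 2%:E (U f).
Proof. by case: Ubounded => h _ _; exact: h. Qed.

Let V2 f : V f -> LpC lb2 2%:E f.
Proof. exact: V_LpC. Qed.

(** [U] acts on representatives, so [U 0] is known to vanish only almost everywhere, by
    boundedness. *)
Lemma calJ_U0 : {ae t2, forall w, calJ (U (fun=> 0)) w = (fun=> 0) %[ae lb]}.
Proof.
have V0 := V_0 Vclosed; have L0 := U_LpC V0; have /LpC2P[m0 _] := L0.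
have q0 : qn lb2 (U (fun=> 0)) = 0%E.
  case: Ubounded => _ _ [M /(_ _ V0)/L2norm_le_c].
  by rewrite qn0 mule0 => h; apply/eqP; rewrite eq_le h qn_ge0.
exact: calJ_ae0.
Qed.

(* The twisted translation by (k, l) acts on the fibers as the character of
   frequency (k, l) up to a unimodular constant, so V and U are compatible with
   multiplication of the fibers by trigonometric polynomials. *)
Lemma trig_fiber_multiplier (p : R2n -> R[i]) f : trig cphase2 p -> V f ->
  exists2 g, V g &
    {ae t2, forall w, calJ g w = (fun y => p w * calJ f w y) %[ae lb] /\
      calJ (U g) w = (fun y => p w * calJ (U f) w y) %[ae lb]}.
Proof.
have [_ Ulin _] := Ubounded.
move=> tp Vf; elim: tp => [q [k [l ->]]| |a p1 p2 _ [g1 V1 h1] _ [g2 V2' h2]].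
- have V0 := V_0 Vclosed.
  have VT : V (TT k l f) by exact: Vinv.
  (* This scalar cancels the constant pi k.l in [zchar], leaving the pure character. The summand 0
     in the witness gives it the form covered by linearity. *)
  pose a : R[i] := expi (- (pi * dot (intv k) (intv l))).
  have Vg : V (fun z => a * TT k l f z + 0) by exact: (V_lin Vclosed).
  exists (fun z => a * TT k l f z + 0) => //.
  have aE w : expi (2 * pi * (dot (intv k) w.1 + dot (intv l) w.2)) = a * expi (zchar k l w) :> R[i].
    by rewrite /a -expiD; congr expi; rewrite /zchar; ring.
  have e1 : TT k l f = TT k l f %[ae lb2] by apply: aeW.
  have e2 : (fun z => a * TT k l f z + 0) = (fun z => a * TT k l f z + (fun=> 0) z) %[ae lb2] by apply: aeW.
  have c1 := calJ_TT_ae (V2 Vf) (V2 VT) e1.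
  have c2 := calJ_TT_ae (U_LpC Vf) (U_LpC VT) (Upres k l Vf).
  have c3 := calJ_lin_ae (V2 VT) (V2 V0) (V2 Vg) e2.
  have c4 := calJ_lin_ae (U_LpC VT) (U_LpC V0) (U_LpC Vg) (Ulin a _ _ VT V0).
  have c5 := calJ_ae0 (V2 V0) (qn0 lb2).
  have c6 := calJ_U0.
  have j1 : {ae t2, forall w, calJ (fun z => a * TT k l f z + 0) w =
      (fun y => expi (2 * pi * (dot (intv k) w.1 + dot (intv l) w.2)) * calJ f w y) %[ae lb]}.
    apply: filterS3 c1 c3 c5 => w; apply: filterS3 => y d1 d3 d5 yT.
    by rewrite d3// d1// d5// addr0 mulrA aE.
  have j2 : {ae t2, forall w, calJ (U (fun z => a * TT k l f z + 0)) w =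
      (fun y => expi (2 * pi * (dot (intv k) w.1 + dot (intv l) w.2)) * calJ (U f) w y) %[ae lb]}.
    apply: filterS3 c2 c4 c6 => w; apply: filterS3 => y d1 d3 d5 yT.
    by rewrite d3// d1// d5// addr0 mulrA aE.
  by apply: filterS2 j1 j2.
- have V0 := V_0 Vclosed; exists (fun=> 0) => //.
  have c5 := calJ_ae0 (V2 V0) (qn0 lb2); apply: filterS2 c5 calJ_U0 => w c5 c6.
  by split; [move: c5|move: c6]; apply: filterS => y d yT; rewrite d// mul0r.
- have Vg : V (fun z => a * g1 z + g2 z) by exact: (V_lin Vclosed).
  exists (fun z => a * g1 z + g2 z) => //.
  have e2 : (fun z => a * g1 z + g2 z) = (fun z => a * g1 z + g2 z) %[ae lb2] by apply: aeW.
  have c3 := calJ_lin_ae (V2 V1) (V2 V2') (V2 Vg) e2.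
  have c4 := calJ_lin_ae (U_LpC V1) (U_LpC V2') (U_LpC Vg) (Ulin a _ _ V1 V2').
  have j1 : {ae t2, forall w, calJ (fun z => a * g1 z + g2 z) w =
      (fun y => (a * p1 w + p2 w) * calJ f w y) %[ae lb]}.
    apply: filterS3 c3 h1 h2 => w d1 [d2 _] [d3 _]; apply: filterS3 d1 d2 d3 => y d1 d3 d5 yT.
    by rewrite d1// d3// d5// mulrA mulrDl.
  have j2 : {ae t2, forall w, calJ (U (fun z => a * g1 z + g2 z)) w =
      (fun y => (a * p1 w + p2 w) * calJ (U f) w y) %[ae lb]}.
    apply: filterS3 c4 h1 h2 => w d1 [_ d2] [_ d3]; apply: filterS3 d1 d2 d3 => y d1 d3 d5 yT.
    by rewrite d1// d3// d5// mulrA mulrDl.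
  by apply: filterS2 j1 j2.
Qed.

Let qn_multiplier (p : R2n -> R) f g : LpC lb2 2%:E f -> LpC lb2 2%:E g ->
  measurable_fun setT p ->
  {ae t2, forall w, calJ g w = (fun y => Complex (p w) 0 * calJ f w y) %[ae lb]} ->
  (\int[t2]_w (p w ^+ 2 * fine (qn lb (calJ f w)))%:E = qn lb2 g)%E.
Proof.
move=> Lf Lg mp h; rewrite (qn_calJ Lg); apply: ge0_ae_eq_integral => //.
- apply/measurable_EFinP/measurable_funM; first exact: measurable_funX.
  by apply: (measurableT_comp (@fine_measurable R setT measurableT)); exact: measurable_qn_calJ.
- exact: measurable_qn_calJ.
- by move=> w _; rewrite lee_fin mulr_ge0 ?sqr_ge0// fine_ge0// qn_ge0.
- by move=> w _; exact: qn_ge0.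
apply: filterS2 h (calJ_fiber Lf) => w h LJ _.
exact/esym/(qn_real_multiple (Cmeasurable_calJ w Lg) LJ h).
Qed.

Lemma fiber_bounded_below (c : R) f : 0 < c -> bounded_below lb2 V U c -> V f ->
  {ae t2, forall w, ((c ^+ 2)%:E * qn lb (calJ f w) <= qn lb (calJ (U f) w))%E}.
Proof.
move=> c0 Uc Vf; have [Lf LUf] := (V2 Vf, U_LpC Vf).
pose H1 w := fine (qn lb (calJ (U f) w)); pose H2 w := fine (qn lb (calJ f w)).
have c20 : 0 <= c ^+ 2 by exact: sqr_ge0.
have mH g : LpC lb2 2%:E g -> measurable_fun setT (fun w => fine (qn lb (calJ g w))).
  by move=> Lg; apply: (measurableT_comp (@fine_measurable R setT measurableT)); exact: measurable_qn_calJ.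
have H0 g w : 0 <= fine (qn lb (calJ g w)) by rewrite fine_ge0// qn_ge0.
(* The global bound for the function whose fibers are [p] times those of [f], written on the
   torus. *)
have int_le (p : R2n -> R) : rtrig cphase2 p ->
    (\int[t2]_w (p w ^+ 2 * (c ^+ 2 * H2 w))%:E <= \int[t2]_w (p w ^+ 2 * H1 w)%:E)%E.
  move=> tp; have [g Vg h] := trig_fiber_multiplier tp Vf.
  have mp : measurable_fun setT p by exact: (rtrig_measurable measurable_cphase2).
  have hUg : {ae t2, forall w, calJ (U g) w =
      (fun y => Complex (p w) 0 * calJ (U f) w y) %[ae lb]}.
    by apply: filterS h => w [_ hw]; exact: hw.
  have EU := qn_multiplier LUf (U_LpC Vg) mp hUg; rewrite EU.
  have -> : (\int[t2]_w (p w ^+ 2 * (c ^+ 2 * H2 w))%:E = (c ^+ 2)%:E * qn lb2 g)%E.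
    have hg : {ae t2, forall w, calJ g w = (fun y => Complex (p w) 0 * calJ f w y) %[ae lb]}.
      by apply: filterS h => w [hw _]; exact: hw.
    have E := qn_multiplier Lf (V2 Vg) mp hg; rewrite -E.
    have e1 w : (0 <= (p w ^+ 2 * H2 w)%:E)%E.
      by rewrite lee_fin; apply: mulr_ge0; [exact: sqr_ge0|exact: H0].
    have m1 : measurable_fun setT (fun w => (p w ^+ 2 * H2 w)%:E).
      by apply/measurable_EFinP/measurable_funM; [exact: measurable_funX|exact: mH].
    rewrite -(ge0_integralZl_EFin _ _ (fun w _ => e1 w) m1 c20)//.
    by apply: eq_integral => w _; rewrite -EFinM mulrCA.
  by rewrite -le_cL2norm//; exact: Uc.
have int_fin (g : R2n -> R[i]) (b : R) : LpC lb2 2%:E g -> 0 <= b ->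
    (\int[t2]_w (b * fine (qn lb (calJ g w)))%:E < +oo)%E.
  move=> Lg b0; have /LpC2P[mg qg] := Lg.
  under eq_integral do rewrite EFinM.
  have q0 w : setT w -> (0 <= (fine (qn lb (calJ g w)))%:E)%E by rewrite lee_fin.
  have mQ : measurable_fun setT (fun w => (fine (qn lb (calJ g w)))%:E).
    by apply/measurable_EFinP; exact: mH.
  rewrite (ge0_integralZl_EFin _ _ q0 mQ b0)//.
  apply: lte_mul_pinfty => //.
  have E : (\int[t2]_w (1 ^+ 2 * fine (qn lb (calJ g w)))%:E = qn lb2 g)%E.
    apply: (qn_multiplier (p := fun=> 1) Lg Lg (measurable_cst _)).
    by apply: aeW => w; apply: aeW => y _; rewrite [Complex 1 0](_ : _ = 1)// mul1r.
  by under [X in (X < _)%E]eq_integral do rewrite -[X in X%:E]mul1r -(expr1n _ 2); rewrite E.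
have fin1 : (\int[t2]_w (H1 w)%:E < +oo)%E.
  by have := int_fin _ 1 LUf ler01; under eq_integral do rewrite mul1r.
have fin2 := int_fin _ _ Lf c20.
have mH2 : measurable_fun setT (fun w => c ^+ 2 * H2 w).
  by apply: measurable_funM => //; exact: mH.
have := ae_le_of_algebra (rtrig_measurable measurable_cphase2) (mH _ LUf) mH2 (H0 _)
  (fun w => mulr_ge0 c20 (H0 f w)) fin1 fin2 _ int_le.
have wd E : measurable E ->
    wsets t2 (fun w => Num.sqrt (H1 w + c ^+ 2 * H2 w)) (rtrig cphase2) E.
  apply: torus2_wsets.
    apply: (measurableT_comp (f := @Num.sqrt R)).
      by apply: continuous_measurable_fun; exact: sqrt_continuous.
    by apply: measurable_funD => //; exact: mH.
  have nn w : 0 <= H1 w + c ^+ 2 * H2 w.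
    by apply: addr_ge0; [exact: H0|apply: mulr_ge0 => //; exact: H0].
  have e1 w : (0 <= (H1 w)%:E)%E by rewrite lee_fin; exact: H0.
  have e2 w : (0 <= (c ^+ 2 * H2 w)%:E)%E by rewrite lee_fin; exact: mulr_ge0 c20 (H0 f w).
  have mE1 : measurable_fun setT (fun w => (H1 w)%:E) by apply/measurable_EFinP; exact: mH.
  have mE2 : measurable_fun setT (fun w => (c ^+ 2 * H2 w)%:E) by exact/measurable_EFinP.
  under eq_integral do rewrite (sqr_sqrtr (nn _)) EFinD.
  rewrite (ge0_integralD _ _ (fun w _ => e1 w) mE1 (fun w _ => e2 w) mE2)//.
  by rewrite lte_add_pinfty.
move=> /(_ wd); apply: filterS3 (calJ_fiber Lf) (calJ_fiber LUf) => w /LpC2P[_ q1] /LpC2P[_ q2].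
(* [fine] sends infinite values to 0, so the real inequality is meaningful only where both fiber
   norms are finite, which is almost everywhere. *)
have key (q r : \bar R) : (0 <= q)%E -> (q < +oo)%E -> (0 <= r)%E -> (r < +oo)%E ->
    c ^+ 2 * fine q <= fine r -> ((c ^+ 2)%:E * q <= r)%E.
  by case: q => [q| |]//; case: r => [r| |]//=; rewrite -EFinM lee_fin.
exact: (key _ _ (qn_ge0 _ _) q1 (qn_ge0 _ _) q2).
Qed.

End fiber_multipliers.

(** Approximants of [a] in the sequence are mapped by the bounded operator to approximants of [A a],
    so both sides of the bound converge. *)
Lemma bounded_below_dense {R : realType} d (T : measurableType d)
    (mu : {measure set T -> \bar R}) (A : partial_operator mu)
    (F : nat -> T -> R[i]) (c : R) : 0 < c ->
  (forall i, dom A (F i)) ->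
  (forall a, dom A a -> forall e : R, 0 < e ->
    exists i, (qn mu (fun y => (a y - F i y)%R) < e%:E)%E) ->
  (forall i, ((c ^+ 2)%:E * qn mu (F i) <= qn mu (A (F i)))%E) ->
  bounded_below mu (dom A) A c.
Proof.
move=> c0 dF dense hF a da; rewrite le_cL2norm//.
have [domL _ domlin _] := dom_closed A; have [AL Alin [M hM]] := op_bounded A.
have meas g : dom A g -> Cmeasurable g by move=> /domL/LpC2P[].
have measA g : dom A g -> Cmeasurable (A g) by move=> /AL/LpC2P[].
have /choice[s hs] (k : nat) : exists i, (qn mu (fun y => (a y - F i y)%R) < (k.+1%:R^-1)%:E)%E.
  by apply: dense => //; rewrite invr_gt0.
have cv : qcvg mu (fun k => F (s k)) a.
  move=> e e0; have [N _ hN] := near_infty_natSinv_lt (PosNum e0); exists N => k /hN /= hk.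
  by rewrite qnB; apply: lt_trans (hs k) _; rewrite lte_fin.
pose b := (`|M| + 1) ^+ 2; have b0 : 0 < b by rewrite exprn_gt0// ltr_wpDl.
have cvA : qcvg mu (fun k => A (F (s k))) (A a).
  move=> e e0; have [N hN] := cv _ (divr_gt0 e0 b0); exists N => k /hN hk.
  have dk : dom A (fun x => -1 * a x + F (s k) x) by exact: domlin.
  have e1 : qn mu (fun x => A (F (s k)) x - A a x) = qn mu (A (fun x => -1 * a x + F (s k) x)).
    apply: ae_eq_qn; [by apply: CmeasurableB; exact: measA|exact: measA|].
    apply: filterS (Alin (-1) _ _ da (dF (s k))) => x + xT => ->//.
    by rewrite mulN1r addrC.
  rewrite e1; apply: le_lt_trans (L2norm_le_c (hM _ dk)) _.
  have e2 : qn mu (fun x => -1 * a x + F (s k) x) = qn mu (fun x => F (s k) x - a x).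
    by apply: eq_qn => x; rewrite mulN1r addrC.
  rewrite e2 -/b; move: hk; have := qn_ge0 mu (fun x => F (s k) x - a x).
  case: (qn mu _) => [q| |]// _; rewrite -EFinM !lte_fin => hk.
  by rewrite mulrC -ltr_pdivlMr.
(* Multiplying by the scalar [c] turns the left-hand side into a plain squared norm, as required to
   pass to the limit; the added 0 matches the form of linear combinations. *)
pose C : R[i] := Complex c 0.
have qC g : Cmeasurable g -> qn mu (fun x => C * g x + 0) = ((c ^+ 2)%:E * qn mu g)%E.
  move=> mg; rewrite -[c ^+ 2]sqc_real -qnZ//; apply: eq_qn => x; by rewrite addr0.
have mC g : Cmeasurable g -> Cmeasurable (fun x => C * g x + 0).
  move=> mg; apply: CmeasurableD; last exact: Cmeasurable_cst.
  exact: CmeasurableZ.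
rewrite -qC; last exact: meas.
have cvC : qcvg mu (fun k x => C * F (s k) x + 0) (fun x => C * a x + 0).
  apply: (@qcvg_lin _ _ _ mu C (fun k => F (s k)) (fun _ _ => 0) a (fun=> 0)) => //.
  - by move=> k; exact: meas.
  - exact: meas.
  - by move=> e e0; exists 0%N => k _; rewrite qn_self0.
apply: (@qcvg_le _ _ _ _ _ mu mu _ _ _ _ _ _ _ _ cvC cvA).
- by move=> k; apply: mC; exact: meas.
- by move=> k; exact: measA.
- by apply: mC; exact: meas.
- exact: measA.
- by move=> k; rewrite qC; [exact: hF|exact: meas].
Qed.

Theorem theorem4p7 (R : realType) (n : nat)
    (V : set (n.-tuple R * n.-tuple R -> R[i]))
    (J : n.-tuple R * n.-tuple R -> set (n.-tuple R -> R[i]))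
    (U : (n.-tuple R * n.-tuple R -> R[i]) -> (n.-tuple R * n.-tuple R -> R[i]))
    (A : n.-tuple R * n.-tuple R -> partial_operator (leb n))
    (c : R) :
  (0 < n)%N ->
  closed_subspace leb2 V ->
  twisted_shift_invariant V ->
  range_function_of V J ->
  bounded_operator leb2 V U ->
  twisted_shift_preserving V U ->
  corresponding_range_operator V J U A ->
  0 < c ->
  bounded_below leb2 V U c <->
  {ae torus2, forall w, bounded_below (leb n) (J w) (A w) c}.
Proof.
move=> _ Vclosed Vinv [Jclosed [f [Vf f_dense JE]]] Ubounded Upres [AJ _ AE] c0.
have LV g : V g -> LpC leb2 2%:E g by exact: V_LpC.
have LU g : V g -> LpC leb2 2%:E (U g) by exact: U_LpC.
have inJ g : V g -> {ae torus2, forall w, J w (calJ g w)}.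
  (* At almost every [w] the span equals [J w], which supplies the closedness that membership
     needs. *)
  move=> Vg; apply: filterS2 JE (calJ_mem_span Vclosed Vf f_dense Vg) => w e.
  by rewrite -e; apply; exact: Jclosed.
have qA g : V g -> {ae torus2, forall w,
    qn (leb n) (A w (calJ g w)) = qn (leb n) (calJ (U g) w)}.
  move=> Vg; apply: filterS3 AJ (inJ g Vg) (AE g Vg) => w dJ Jg e.
  have [AL _ _] := op_bounded (A w).
  have /AL/LpC2P[mA _] : dom (A w) (calJ g w) by rewrite dJ.
  by apply/esym/ae_eq_qn => //; apply: Cmeasurable_calJ; exact: LU.
split=> [Uc|Ac].
(* The null set of the fiberwise bound depends on the function, so the bound is collected along the
   dense sequence and not over all of [V]. *)
- have lef : {ae torus2, forall w, forall i,
      ((c ^+ 2)%:E * qn (leb n) (calJ (f i) w) <= qn (leb n) (A w (calJ (f i) w)))%E}.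
    apply: ae_foralln => i.
    apply: filterS2 (qA _ (Vf i)) (fiber_bounded_below Vclosed Vinv Ubounded Upres c0 Uc (Vf i)).
    by move=> w ->.
  have inf : {ae torus2, forall w, forall i, J w (calJ (f i) w)}.
    by apply: ae_foralln => i; exact: inJ.
  have dens := closed_span_calJ_dense Vclosed Vf f_dense.
  have AJE : {ae torus2, forall w, dom (A w) = J w /\
      J w = closed_span (leb n) (range (fun i => calJ (f i) w))}.
    by apply: filterS2 AJ JE.
  have lef2 : {ae torus2, forall w, forall i, J w (calJ (f i) w) /\
      ((c ^+ 2)%:E * qn (leb n) (calJ (f i) w) <= qn (leb n) (A w (calJ (f i) w)))%E}.
    by apply: filterS2 inf lef => w h1 h2 i.
  apply: filterS3 AJE lef2 dens => w [d1 d2] h dw; rewrite -d1.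
  apply: (bounded_below_dense (F := fun i => calJ (f i) w)) => // [i|a|i].
  + by rewrite d1; have [] := h i.
  + by rewrite d1 d2; exact: dw.
  + by have [] := h i.
- move=> g Vg; have [Lg LUg] := (LV g Vg, LU g Vg).
  have c20 : 0 <= c ^+ 2 by exact: sqr_ge0.
  (* In squared form both norms are integrals of squared fiber norms, and the inequality can be
     checked under the integral. *)
  rewrite le_cL2norm// (qn_calJ Lg) (qn_calJ LUg) -ge0_integralZl_EFin//; last 2 first.
  + by move=> w _; exact: qn_ge0.
  + exact: measurable_qn_calJ.
  apply: ae_ge0_le_integral => //.
  + by move=> w _; rewrite mule_ge0// qn_ge0.
  + by apply: measurable_funeM; exact: measurable_qn_calJ.
  + by move=> w _; exact: qn_ge0.
  + exact: measurable_qn_calJ.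
  apply: filterS3 Ac (inJ g Vg) (qA g Vg) => w Aw Jw e _.
  by rewrite -e -le_cL2norm//; exact: Aw.
Qed.
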